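(* Let $P$ be a torsion-free complex. There are a unique $\omega$-polygraph $Q$ and a unique $\omega$-functor $F\colon Q^*\to\mathrm{Cell}(P)$ such that $Q_n=P_n$ for every $n\in\mathbb{N}$ and $F(g)=\langle g\rangle$ for every $g\in P$. Moreover, $F$ is an isomorphism.
   Context: An $\omega$-hypergraph is a set $P$ with a partition $P=\bigsqcup_{n\in\mathbb{N}}P_n$ together with, for $n\in\mathbb{N}$ and $u\in P_{n+1}$, two finite subsets $u^-,u^+\subseteq P_n$. For $U\subseteq P$ and $\epsilon\in\{-,+\}$, $U^\epsilon=\bigcup_{u\in U}u^\epsilon$; also $U^\mp=U^-\setminus U^+$ and $U^\pm=U^+\setminus U^-$. A subset $U\subseteq P_n$ is fork-free if either $n=0$ and $|U|=1$, or $n>0$ and $u^\epsilon\cap v^\epsilon=\emptyset$ for all distinct $u,v\in U$ and all $\epsilon\in\{-,+\}$. For $U\subseteq P_n$, $\triangleleft_U$ is the transitive closure of the relation on $U$ relating $u$ to $v$ when $n\ge 1$ and $u^+\cap v^-\neq\emptyset$; for $V,W\subseteq U$, $V\triangleleft_U W$ means $v\triangleleft_U w$ for some $v\in V$, $w\in W$; a subset $V\subseteq U$ is a segment for $\triangleleft_U$ if $u_1,u_3\in V$ and $u_1\triangleleft_U u_2\triangleleft_U u_3$ imply $u_2\in V$. An $n$-pre-cell of $P$ is a tuple $X=(X_{0,-},X_{0,+},\ldots,X_{n-1,-},X_{n-1,+},X_n)$ of finite subsets $X_{i,\epsilon}\subseteq P_i$, $X_n\subseteq P_n$; one writes $X_{n,-}=X_{n,+}=X_n$.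 For $i<n$, $\partial^\epsilon_i X=(X_{0,-},X_{0,+},\ldots,X_{i-1,-},X_{i-1,+},X_{i,\epsilon})$. A finite set $M\subseteq P_{i+1}$ moves a finite $U\subseteq P_i$ to a finite $V\subseteq P_i$ if $U=(V\cup M^-)\setminus M^+$ and $V=(U\cup M^+)\setminus M^-$. An $n$-cell is an $n$-pre-cell such that $X_{i+1,\epsilon}$ moves $X_{i,-}$ to $X_{i,+}$ for $0\le i<n$, $\epsilon\in\{-,+\}$, and every $X_{i,\epsilon}$ ($0\le i\le n$) is fork-free. $\mathrm{Cell}(P)$ is the graded set of cells. Operations: for an $n$-cell $X$, $\mathrm{id}^{n+1}(X)=(X_{0,-},X_{0,+},\ldots,X_{n-1,-},X_{n-1,+},X_n,X_n,\emptyset)$. For $i<n$ and $n$-cells $X,Y$ with $\partial^+_iX=\partial^-_iY$, $X\ast_iY$ is the $n$-pre-cell $Z$ with $Z_{j,\epsilon}=X_{j,\epsilon}$ for $j<i$, $Z_{i,-}=X_{i,-}$, $Z_{i,+}=Y_{i,+}$, and $Z_{j,\epsilon}=X_{j,\epsilon}\cup Y_{j,\epsilon}$ for $j>i$. For $u\in P_n$, the atom $\langle u\rangle$ is the $n$-pre-cell with $\langle u\rangle_{n,-}=\langle u\rangle_{n,+}=\{u\}$ and, for $j<n$, $\langle u\rangle_{j,-}=(\langle u\rangle_{j+1,-})^\mp$, $\langle u\rangle_{j,+}=(\langle u\rangle_{j+1,+})^\pm$. $P$ is a torsion-free complex if it satisfies: (non-emptiness) $u^-\ne\emptyset$ and $u^+\neq\emptyset$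 for all $u\in P_n$, $n\ge1$; (acyclicity) $\triangleleft_{P_n}$ is irreflexive for all $n\geq 1$; (relevance) $\langle u\rangle$ is a cell for all $u\in P$; (segment) for all $k\in\mathbb N$, $u\in P_k$, $n<k$, every $n$-cell $X$ and $\epsilon\in\{-,+\}$, if $\langle u\rangle_{n,\epsilon}\subseteq X_n$ then $\langle u\rangle_{n,\epsilon}$ is a segment for $\triangleleft_{X_n}$; (torsion-freeness) there are no $n,k,l\ge1$ with $n<\min(k,l)$, $u\in P_k$, $v\in P_l$ and $n$-cell $X$ with $\langle u\rangle_{n,+}\subseteq X_n$, $\langle v\rangle_{n,-}\subseteq X_n$, $\langle u\rangle_{n,+}\cap\langle v\rangle_{n,-}=\emptyset$, $\langle u\rangle_{n,+}\triangleleft_{X_n}\langle v\rangle_{n,-}$ and $\langle v\rangle_{n,-}\triangleleft_{X_n}\langle u\rangle_{n,+}$. For a torsion-free complex $P$, $\mathrm{Cell}(P)$ with source and target operations $\partial^-_i,\partial^+_i$, identities $X\mapsto\mathrm{id}^{n+1}(X)$ and compositions $(X,Y)\mapsto X\ast_iY$ is a strict $\omega$-category. Polygraphs: an $n$-cellular extension is a pair $(C,S)$ of a strict $n$-category $C$ and a set $S$ with functions $d^-_n,d^+_n\colon S\to C_n$ such that, when $n>0$, $\partial^\epsilon_{n-1}\circ d^-_n=\partial^\epsilon_{n-1}\circ d^+_n$ for $\epsilon\in\{-,+\}$. The free extension $C[S]$ is the strict $(n+1)$-category with $n$-truncation $C$ and $(n+1)$-cells freely generated by $S$ with the prescribed sources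 and targets (i.e. the value on $(C,S)$, chosen with $n$-truncation equal to $C$, of the left adjoint to the forgetful functor from strict $(n+1)$-categories to $n$-cellular extensions). A $0$-polygraph $Q$ is a set $Q_0$, with $Q^*=Q_0$. An $(n+1)$-polygraph $Q$ is an $n$-polygraph $Q_{\le n}$ with an $n$-cellular extension $((Q_{\le n})^*,Q_{n+1})$, and $Q^*=(Q_{\le n})^*[Q_{n+1}]$. An $\omega$-polygraph is a sequence of $k$-polygraphs $Q^k$ with $(Q^{k+1})_{\le k}=Q^k$, and $Q^*$ is the strict $\omega$-category whose $k$-truncation is $(Q^k)^*$ for each $k$. Generators $g\in Q_n$ are identified with the corresponding $n$-cells of $Q^*$. *)

(* Defs.v *)
From mathcomp Require Import all_boot finmap.
From mathcomp Require Import boolp.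
From Stdlib Require Import Relation_Operators.

Set Implicit Arguments.
Unset Strict Implicit.
Unset Printing Implicit Defensive.

(* Signs are booleans: [false] is -, [true] is +. *)

(** * Strict n-categories *)

(* What an (n+1)-category adds to its n-truncation, where X is the set of
   n-cells.  [lcomp i x y z] is the graph of the partial composition in
   dimension n+1: x *_i y is defined and equal to z. *)
Record layer (X : Type) := Layer {
  lcell : Type;
  lbd : bool -> lcell -> X;
  lid : X -> lcell;
  lcomp : nat -> lcell -> lcell -> lcell -> Prop
}.

(* The type of n-precategories (the data of a strict n-category, without the
   axioms), together with the function giving the set of n-cells. *)
Fixpoint tower (n : nat) : {M : Type & M -> Type} :=
  if n is m.+1 then
    existT (fun M => M -> Type)
      {C : projT1 (tower m) & layer (projT2 (tower m) C)}
      (fun C => lcell (projT2 C))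
  else existT (fun M => M -> Type) Type (fun X => X).

Definition precat (n : nat) : Type := projT1 (tower n).
Definition cells (n : nat) (C : precat n) : Type := projT2 (tower n) C.

Definition addlayer (n : nat) (C : precat n) (L : layer (cells C)) :
  precat n.+1 := existT (fun C => layer (cells C)) C L.
Definition trunc (n : nat) (C : precat n.+1) : precat n := projT1 C.
Definition bd (n : nat) (C : precat n.+1) : bool -> cells C -> cells (trunc C) :=
  @lbd _ (projT2 C).
Definition ide (n : nat) (C : precat n.+1) : cells (trunc C) -> cells C :=
  @lid _ (projT2 C).
Definition comp (n : nat) : forall C : precat n,
    nat -> cells C -> cells C -> cells C -> Prop :=
  match n with
  | 0 => fun _ _ _ _ _ => False
  | m.+1 => fun C => @lcomp _ (projT2 C)
  end.

(* For n-cells x and y, the condition that i < n and that the boundaries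
   bd_i^+ x and bd_i^- y are equal, where bd_i^e is the (n-i)-fold iterate of
   the one-step boundary of sign e. *)
Fixpoint composable (n : nat) : forall C : precat n,
    nat -> cells C -> cells C -> Prop :=
  match n with
  | 0 => fun _ _ _ _ => False
  | m.+1 => fun C i x y =>
      if i == m then bd true x = bd false y
      else composable (C := trunc C) i (bd true x) (bd false y)
  end.

(* For an n-cell x and i < n, the iterated identity id^n (bd_i^e x). *)
Fixpoint idbd (n : nat) : forall C : precat n,
    bool -> nat -> cells C -> cells C :=
  match n with
  | 0 => fun _ _ _ x => x
  | m.+1 => fun C e i x =>
      ide (if i == m then bd e x else idbd (C := trunc C) e i (bd e x))
  end.

Definition parallel (n : nat) : forall C : precat n,
    cells C -> cells C -> Prop :=
  match n with
  | 0 => fun _ _ _ => True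
  | m.+1 => fun C x y => forall e, bd e x = bd e y
  end.

Record strict_layer (n : nat) (C : precat n.+1) : Prop := StrictLayer {
  globular : forall x : cells C, parallel (bd false x) (bd true x);
  bd_ide : forall e (x : cells (trunc C)), bd e (ide x) = x;
  comp_dom : forall i (x y : cells C),
    (exists z, comp i x y z) <-> composable i x y;
  comp_fun : forall i (x y z z' : cells C),
    comp i x y z -> comp i x y z' -> z = z';
  bd_comp : forall i (x y z : cells C), comp i x y z ->
    if i == n then bd false z = bd false x /\ bd true z = bd true y
    else forall e, comp i (bd e x) (bd e y) (bd e z);
  comp_idl : forall i (x : cells C), i <= n -> comp i (idbd false i x) x x;
  comp_idr : forall i (x : cells C), i <= n -> comp i x (idbd true i x) x;
  comp_assoc : forall i (x y z u v w : cells C),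
    comp i x y u -> comp i u z w -> comp i y z v -> comp i x v w;
  comp_ide : forall i (x y z : cells (trunc C)),
    comp i x y z -> comp i (ide x) (ide y) (ide z);
  comp_exchange : forall i j (x x' y y' a b p q c : cells C), i < j ->
    comp i x x' a -> comp i y y' b -> comp j a b c ->
    comp j x y p -> comp j x' y' q -> comp i p q c
}.

Fixpoint strict (n : nat) : precat n -> Prop :=
  match n with
  | 0 => fun _ => True
  | m.+1 => fun C => strict (trunc C) /\ strict_layer C
  end.

Record ncat (n : nat) := NCat { ndata :> precat n; nstrict : strict ndata }.

Definition ntrunc (n : nat) (C : ncat n.+1) : ncat n :=
  NCat (proj1 (nstrict C)).

(** * Functors of strict n-categories *)

Definition preserves (n : nat) (C D : precat n.+1)
    (f : cells (trunc C) -> cells (trunc D)) (h : cells C -> cells D) : Prop :=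
  [/\ forall e x, bd e (h x) = f (bd e x),
      forall x, h (ide x) = ide (f x)
    & forall i x y z, comp i x y z -> comp i (h x) (h y) (h z)].

Fixpoint ftower (n : nat) : forall C D : precat n,
    {F : Type & F -> cells C -> cells D} :=
  match n with
  | 0 => fun C D =>
      existT (fun F => F -> cells C -> cells D) (cells C -> cells D)
        (fun f => f)
  | m.+1 => fun C D =>
      existT (fun F => F -> cells C -> cells D)
        {f : projT1 (ftower (trunc C) (trunc D)) &
           {h : cells C -> cells D |
              preserves (projT2 (ftower (trunc C) (trunc D)) f) h}}
        (fun F => sval (projT2 F))
  end.

Definition nfunctor (n : nat) (C D : precat n) : Type := projT1 (ftower C D).
Definition fapp (n : nat) (C D : precat n) (F : nfunctor C D) :
  cells C -> cells D := projT2 (ftower C D) F.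
Definition ftrunc (n : nat) (C D : precat n.+1) (F : nfunctor C D) :
  nfunctor (trunc C) (trunc D) := projT1 F.

(** * Free extensions *)

Record cellext (n : nat) (C : precat n) (S : Type) := CellExt {
  ebd :> bool -> S -> cells C;
  ebd_parallel : forall s, parallel (ebd false s) (ebd true s)
}.

(* A layer over an n-category C, with a map from S to its set of cells. *)
Record based_layer (n : nat) (C : precat n) (S : Type) := BasedLayer {
  blayer : layer (cells C);
  binc : S -> lcell blayer
}.

(* The (n+1)-category obtained by adding [blayer E] to C, with [binc E], is the
   value at (C, S) of the left adjoint of the functor sending a strict
   (n+1)-category D to the n-cellular extension given by the n-truncation of D
   and the set of its (n+1)-cells. *)
Definition is_free (n : nat) (C : ncat n) (S : Type) (d : cellext C S)
    (E : based_layer C S) : Prop :=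
  [/\ strict (addlayer (blayer E)),
      forall e s, lbd e (binc E s) = d e s
    & forall (D : ncat n.+1) (f : nfunctor C (trunc D)) (g : S -> cells D),
        (forall e s, bd e (g s) = fapp f (d e s)) ->
        exists! F : nfunctor (addlayer (blayer E)) D,
          ftrunc F = f /\ forall s, fapp F (binc E s) = g s].

(* Existence of free extensions, by formal composites identified when they have
   the same boundary and the same value in every model. *)
Module FreeExistence.

Section FreeExistence.

Variables (n : nat) (C : ncat n) (S : Type) (d : cellext C S).

Let X := cells C.

Local Lemma comp_lt m (B : precat m) (hB : strict B) i (x y z : cells B) :
  comp i x y z -> i < m /\ composable i x y.
Proof.
case: m B hB x y z => [//|m] B [_ hB] x y z h.
have hc : composable i x y by apply/(comp_dom hB); exists z.
split=> //; clear h z hB; elim: m B x y hc => [|m IH] B x y /=; first by case: eqP => [->|].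
case: eqP => [-> //|_ h].
by apply: ltnW; rewrite ltnS; exact: (IH (trunc B) _ _ h).
Qed.

Local Lemma composable_par m (B : precat m) i (x x' y y' : cells B) :
  parallel x x' -> parallel y y' -> composable i x y -> composable i x' y'.
Proof.
case: m B x x' y y' => [//|m] B x x' y y' /= hx hy.
by rewrite !hx !hy.
Qed.

Local Lemma composable_ex m (B : precat m) (hB : strict B) i (x y : cells B) :
  composable i x y -> exists z, comp i x y z.
Proof.
by case: m B hB x y => [//|m] B [_ hB] x y h; apply/(comp_dom hB).
Qed.

Local Lemma comp_uniq m (B : precat m) (hB : strict B) i (x y z z' : cells B) :
  comp i x y z -> comp i x y z' -> z = z'.
Proof. by case: m B hB x y z z' => [//|m] B [_ hB] x y z z'; exact: comp_fun. Qed.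

Local Lemma par_comp m (B : precat m) (hB : strict B) i
    (x y z x' y' z' : cells B) :
  parallel x x' -> parallel y y' -> comp i x y z -> comp i x' y' z' ->
  parallel z z'.
Proof.
case: m B hB x y z x' y' z' => [//|m] B [hB0 hB] x y z x' y' z' hx hy h h' e.
have := bd_comp hB h; have := bd_comp hB h'.
case: eqP => [_ [h1 h2] [h3 h4]|_ h1 h2].
  by case: e; rewrite ?h2 ?h4 ?h1 ?h3 ?hx ?hy.
have := h1 e; rewrite -hx -hy => h3.
exact: comp_uniq (h2 e) h3.
Qed.

Local Lemma parxx m (B : precat m) (x : cells B) : parallel x x.
Proof. by case: m B x. Qed.

Local Lemma par_sym m (B : precat m) (x y : cells B) :
  parallel x y -> parallel y x.
Proof. by case: m B x y => [//|m] B x y h e; rewrite h. Qed.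

Local Lemma par_trans m (B : precat m) (x y z : cells B) :
  parallel x y -> parallel y z -> parallel x z.
Proof. by case: m B x y z => [//|m] B x y z h h' e; rewrite h h'. Qed.

Local Lemma fapp_comp m (B B' : precat m) (f : nfunctor B B') i
    (x y z : cells B) :
  comp i x y z -> comp i (fapp f x) (fapp f y) (fapp f z).
Proof.
by case: m B B' f x y z => [//|m] B B' [f [h [h1 h2 h3]]] x y z; exact: h3.
Qed.

Local Lemma fapp_idbd m (B B' : precat m) (f : nfunctor B B') e i (x : cells B) :
  fapp f (idbd e i x) = idbd e i (fapp f x).
Proof.
elim: m B B' f x => [//|m IH] B B' [f [h [h1 h2 h3]]] x.
rewrite /fapp /= h2 h1; congr ide; case: eqP => // _.
exact: (IH (trunc B) (trunc B') f).
Qed.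

Inductive tm := Gen of S | Ide of X | Cmp of nat & tm & tm.

Inductive wt : tm -> X -> X -> Prop :=
| wtG s : wt (Gen s) (d false s) (d true s)
| wtI x : wt (Ide x) x x
| wtV t t' x y z : wt t x y -> wt t' y z -> wt (Cmp n t t') x z
| wtH i t t' x y x' y' a b : wt t x y -> wt t' x' y' ->
    comp i x x' a -> comp i y y' b -> wt (Cmp i t t') a b.

Local Lemma wt_par t x y : wt t x y -> parallel x y.
Proof.
have hC := nstrict C.
elim=> [s|z|{}t t' {}x {}y z _ h _ h'|i {}t t' {}x {}y x' y' a b _ h _ h' ha hb].
- exact: ebd_parallel.
- exact: parxx.
- exact: par_trans h h'.
- exact: par_comp ha hb.
Qed.

Record model := Model {
  mcat : ncat n.+1;
  mfun : nfunctor C (trunc mcat);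
  mgen : S -> cells mcat;
  mgenE : forall e s, bd e (mgen s) = fapp mfun (d e s)
}.

Fixpoint interp (M : model) (t : tm) (z : cells (mcat M)) : Prop :=
  match t with
  | Gen s => z = mgen M s
  | Ide x => z = ide (fapp (mfun M) x)
  | Cmp i t t' =>
      exists u v, [/\ interp t u, interp t' v & comp i u v z]
  end.

Local Lemma interp_uniq M t z z' : interp (M := M) t z -> interp t z' -> z = z'.
Proof.
elim: t z z' => [s|x|i t IH t' IH'] z z' /=; try by move=> -> ->.
move=> [u [v [hu hv h]]] [u' [v' [hu' hv' h']]].
rewrite (IH _ _ hu' hu) (IH' _ _ hv' hv) in h'.
exact: (comp_fun (proj2 (nstrict (mcat M))) h h').
Qed.

Local Lemma interp_ex M t x y : wt t x y ->
  exists z : cells (mcat M), [/\ interp t z, bd false z = fapp (mfun M) x &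
    bd true z = fapp (mfun M) y].
Proof.
have [hD0 hD] := nstrict (mcat M).
elim=> [s|z|{}t t' {}x {}y z _ [u [hu hu1 hu2]] _ [v [hv hv1 hv2]]|
    i {}t t' {}x {}y x' y' a b ht [u [hu hu1 hu2]] ht' [v [hv hv1 hv2]] ha hb].
- by exists (mgen M s); rewrite !mgenE.
- by exists (ide (fapp (mfun M) z)); rewrite !(bd_ide hD).
- have [|w hw] := (comp_dom hD n u v).2; first by rewrite /= eqxx hu2 hv1.
  have := bd_comp hD hw; rewrite eqxx hu1 hv2 => -[h1 h2].
  by exists w; split=> //; exists u, v.
- have [li _] := comp_lt (nstrict C) ha.
  have hne : (i == n) = false by rewrite ltn_eqF.
  have [|w hw] := (comp_dom hD i u v).2.
    rewrite /= hne.
    have hc : composable i (bd false u) (bd false v).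
      by rewrite hu1 hv1; exact: (comp_lt hD0 (fapp_comp (mfun M) ha)).2.
    exact: composable_par (globular hD u) (parxx _) hc.
  have := bd_comp hD hw; rewrite hne => hbw.
  exists w; split; first by exists u, v.
    have := hbw false; rewrite hu1 hv1 => h; apply: (comp_uniq hD0 h).
    exact: fapp_comp.
  have := hbw true; rewrite hu2 hv2 => h; apply: (comp_uniq hD0 h).
  exact: fapp_comp.
Qed.

Record atm := Atm { aterm : tm; abd : bool -> X;
  awt : wt aterm (abd false) (abd true) }.

Definition aeqv (a b : atm) : Prop :=
  abd a = abd b /\
  forall M z, interp (M := M) (aterm a) z <-> interp (aterm b) z.

Definition acls : Type := {A : atm -> Prop | exists a, A = aeqv a}.
Definition cls (a : atm) : acls := exist _ (aeqv a) (ex_intro _ a erefl).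

Local Lemma clsP a b : cls a = cls b <-> aeqv a b.
Proof.
split=> [h|[h1 h2]].
  have <- : sval (cls a) b = aeqv a b by [].
  by rewrite h /=; split.
apply: eq_exist; apply: funext => c; apply: propext; split=> -[h3 h4]; split.
- by rewrite -h1.
- by move=> M z; rewrite -h2.
- by rewrite h1.
- by move=> M z; rewrite h2.
Qed.

Local Lemma cls_ex (q : acls) : exists a, q = cls a.
Proof. by case: q => A [a Aa]; exists a; apply: eq_exist. Qed.

Definition rep (q : acls) : atm := sval (cid (cls_ex q)).
Local Lemma repK q : cls (rep q) = q.
Proof. by rewrite -(svalP (cid (cls_ex q))). Qed.
Local Lemma rep_cls a : aeqv (rep (cls a)) a.
Proof. by apply/clsP; rewrite repK. Qed.

Definition pairb (x y : X) : bool -> X := fun e => if e then y else x.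
Definition mk t x y (h : wt t x y) : atm :=
  @Atm t (pairb x y) h.

Definition flayer : layer X := @Layer X acls
  (fun e q => abd (rep q) e)
  (fun x => cls (mk (wtI x)))
  (fun i q r s => exists a b c, [/\ q = cls a, r = cls b, s = cls c,
     aterm c = Cmp i (aterm a) (aterm b) &
     if i == n then [/\ abd a true = abd b false, abd c false = abd a false
       & abd c true = abd b true]
     else forall e, comp i (abd a e) (abd b e) (abd c e)]).

Definition fprecat : precat n.+1 := addlayer flayer.

Local Lemma fbd_cls e a : bd (C := fprecat) e (cls a) = abd a e.
Proof. by rewrite /bd /=; have [->] := rep_cls a. Qed.

Definition acond i (a b c : atm) : Prop :=
  if i == n then [/\ abd a true = abd b false, abd c false = abd a false
       & abd c true = abd b true]
  else forall e, comp i (abd a e) (abd b e) (abd c e).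

Local Lemma fcompP i a b (s : acls) :
  comp (C := fprecat) i (cls a) (cls b) s <->
  exists c, [/\ s = cls c, acond i a b c &
     forall M z, interp (M := M) (aterm c) z <->
        interp (Cmp i (aterm a) (aterm b)) z].
Proof.
split=> [[a' [b' [c [/clsP[ha ha'] /clsP[hb hb'] -> hc hi]]]]|].
  exists c; split=> //; first by rewrite /acond ha hb.
  move=> M z; rewrite hc /=; split=> -[u [v [/ha' hu /hb' hv huv]]];
    by exists u, v.
move=> [c [-> hc hi]].
have hw : wt (Cmp i (aterm a) (aterm b)) (abd c false) (abd c true).
  move: hc; rewrite /acond; case: eqP => [->|_ h].
    move=> [h1 -> ->]; apply: wtV (awt a) _; rewrite h1; exact: awt.
  exact: wtH (awt a) (awt b) (h false) (h true).
exists a, b, (@Atm _ (abd c) hw); split=> //.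
by apply/clsP; split.
Qed.

Local Lemma acond_lt i a b c : acond i a b c -> i <= n.
Proof.
rewrite /acond; case: eqP => [-> //|_ /(_ true) /(comp_lt (nstrict C))[h _]].
exact: ltnW.
Qed.

Local Lemma acond_dom i (a b : atm) :
  composable i (cls a : cells fprecat) (cls b) -> exists c, [/\ acond i a b c &
    aterm c = Cmp i (aterm a) (aterm b)].
Proof.
rewrite /composable -/composable !fbd_cls /acond.
case: eqP => [-> h|_ h].
  have hw : wt (Cmp n (aterm a) (aterm b)) (abd a false) (abd b true).
    by apply: wtV (awt a) _; rewrite h; exact: awt.
  by exists (mk hw).
have hC := nstrict C.
have [x hx] := composable_ex hC (composable_par (par_sym (wt_par (awt a)))
  (parxx _) h).
have [y hy] := composable_ex hC (composable_par (parxx _) (wt_par (awt b)) h).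
by exists (mk (wtH (awt a) (awt b) hx hy)); split=> // -[].
Qed.

(* identities on iterated boundaries are classes of formal identities *)
Local Lemma fidbd e i (a : atm) :
  idbd e i (cls a : cells fprecat) =
  cls (mk (wtI (if i == n then abd a e else idbd e i (abd a e)))).
Proof. by rewrite /idbd -/idbd fbd_cls. Qed.

Local Lemma acond_composable i a b c : acond i a b c ->
  composable i (cls a : cells fprecat) (cls b).
Proof.
rewrite /acond /composable -/composable !fbd_cls; case: eqP => [_ []//|_ h].
have [_ hc] := comp_lt (nstrict C) (h false).
exact: composable_par (wt_par (awt a)) (parxx _) hc.
Qed.

Local Lemma acond_uniq i a b c c' : acond i a b c -> acond i a b c' ->
  abd c = abd c'.
Proof.
rewrite /acond; case: eqP => [_ [_ h1 h2] [_ h3 h4]|_ h h'].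
  by apply: funext => -[]; rewrite ?h1 ?h2 ?h3 ?h4.
by apply: funext => e; exact: (comp_uniq (nstrict C) (h e) (h' e)).
Qed.

Local Lemma interp_atm M (a : atm) : exists z : cells (mcat M),
  interp (aterm a) z /\ forall e, bd e z = fapp (mfun M) (abd a e).
Proof.
by have [z [h1 h2 h3]] := interp_ex M (awt a); exists z; split=> // -[].
Qed.

Definition val (M : model) (a : atm) : cells (mcat M) :=
  sval (cid (interp_atm M a)).

Local Lemma interp_val M (a : atm) : interp (M := M) (aterm a) (val M a).
Proof. by rewrite /val; case: cid => z []. Qed.

Local Lemma bd_val M (a : atm) e : bd e (val M a) = fapp (mfun M) (abd a e).
Proof. by rewrite /val; case: cid => z []. Qed.

Local Lemma interpE M (a : atm) z : interp (M := M) (aterm a) z <-> z = val M a.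
Proof.
by split=> [h|->]; [exact: interp_uniq h (interp_val M a)|exact: interp_val].
Qed.

Local Lemma cls_eq a b : cls a = cls b <->
  abd a = abd b /\ forall M, val M a = val M b.
Proof.
rewrite clsP /aeqv; split=> -[h1 h2]; split=> //.
  by move=> M; apply/interpE/h2/interpE.
by move=> M z; rewrite !interpE h2.
Qed.

Local Lemma compE i a b (s : acls) :
  comp (C := fprecat) i (cls a) (cls b) s <->
  exists c, [/\ s = cls c, acond i a b c &
     forall M, comp i (val M a) (val M b) (val M c)].
Proof.
rewrite fcompP; split=> -[c [h1 h2 h3]]; exists c; split=> // M.
  have /h3 [u [v [/interpE -> /interpE ->]]] := interp_val M c.
  by [].
move=> z; rewrite interpE; split=> [->|[u [v [/interpE -> /interpE ->]]]].
  by exists (val M a), (val M b); split=> //; exact: interp_val.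
by move=> h; exact: (comp_fun (proj2 (nstrict (mcat M))) h (h3 M)).
Qed.

Local Lemma val_ide M x : val M (mk (wtI x)) = ide (fapp (mfun M) x).
Proof. by apply/esym/interpE. Qed.

Local Lemma comp_assoc' m (B : precat m) (hB : strict B) i
    (x y z u v w : cells B) :
  comp i x y u -> comp i u z w -> comp i y z v -> comp i x v w.
Proof. by case: m B hB x y z u v w => [//|m] B [_ hB] x y z u v w; exact: (comp_assoc hB). Qed.

Local Lemma comp_idl' m (B : precat m) (hB : strict B) i (x : cells B) :
  i < m -> comp i (idbd false i x) x x.
Proof. by case: m B hB x => [//|m] B [_ hB] x; rewrite ltnS; exact: (comp_idl hB). Qed.

Local Lemma comp_idr' m (B : precat m) (hB : strict B) i (x : cells B) :
  i < m -> comp i x (idbd true i x) x.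
Proof. by case: m B hB x => [//|m] B [_ hB] x; rewrite ltnS; exact: (comp_idr hB). Qed.

Local Lemma comp_exchange' m (B : precat m) (hB : strict B) i j
    (x x' y y' a b p q c : cells B) : i < j ->
  comp i x x' a -> comp i y y' b -> comp j a b c ->
  comp j x y p -> comp j x' y' q -> comp i p q c.
Proof.
case: m B hB x x' y y' a b p q c => [//|m] B [_ hB] x x' y y' a b p q c.
exact: (comp_exchange hB).
Qed.

Local Lemma idbd_par m (B : precat m) e i (x y : cells B) :
  i < m -> parallel x y -> idbd e i x = idbd e i y.
Proof. by case: m B x y => [//|m] B x y _ /= h; rewrite h. Qed.

Local Lemma val_idbd M e i (a : atm) :
  val M (mk (wtI (if i == n then abd a e else idbd e i (abd a e)))) =
  idbd e i (val M a).
Proof. by rewrite val_ide /= bd_val; case: eqP; rewrite // fapp_idbd. Qed.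

Local Lemma fstrict_layer : strict_layer fprecat.
Proof.
have hC := nstrict C.
have hM M := proj2 (nstrict (mcat M)).
split.
- by move=> q; rewrite -(repK q) !fbd_cls; exact: wt_par (awt _).
- by move=> e x; rewrite fbd_cls; case: e.
- move=> i q r; rewrite -(repK q) -(repK r); split.
    by move=> [z /compE[c [_ h _]]]; exact: acond_composable h.
  move=> /acond_dom [c [h1 h2]]; exists (cls c); apply/fcompP; exists c.
  by split=> // M z; rewrite h2.
- move=> i q r s s'; rewrite -(repK q) -(repK r).
  move=> /compE[c [-> h1 h2]] /compE[c' [-> h1' h2']]; apply/cls_eq.
  split; first exact: acond_uniq h1 h1'.
  by move=> M; exact: (comp_fun (hM M) (h2 M) (h2' M)).
- move=> i q r s; rewrite -(repK q) -(repK r) => /compE[c [-> h _]].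
  rewrite !fbd_cls; move: h; rewrite /acond; case: eqP => [_ []//|_ h] e.
  by rewrite !fbd_cls.
- move=> i q le_in; rewrite -(repK q) fidbd; set a := rep q.
  apply/compE; exists a; split=> //; last first.
    by move=> M; rewrite val_idbd; exact: (comp_idl (hM M)).
  rewrite /acond; case: eqP => [_ //|/eqP ne_in] e.
  have lt_in : i < n by rewrite ltn_neqAle ne_in.
  suff -> : abd (mk (wtI (idbd false i (abd a false)))) e =
    idbd false i (abd a e) by exact: comp_idl'.
  by case: e => //=; exact: idbd_par (wt_par (awt a)).
- move=> i q le_in; rewrite -(repK q) fidbd; set a := rep q.
  apply/compE; exists a; split=> //; last first.
    by move=> M; rewrite val_idbd; exact: (comp_idr (hM M)).
  rewrite /acond; case: eqP => [_ //|/eqP ne_in] e.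
  have lt_in : i < n by rewrite ltn_neqAle ne_in.
  suff -> : abd (mk (wtI (idbd true i (abd a true)))) e =
    idbd true i (abd a e) by exact: comp_idr'.
  by case: e => //=; exact: (idbd_par _ lt_in (par_sym (wt_par (awt a)))).
- move=> i qx qy qz u v w; rewrite -(repK qx) -(repK qy) -(repK qz).
  move=> /compE[cu [-> hu hu']] /compE[cw [-> hw hw']] /compE[cv [-> hv hv']].
  apply/compE; exists cw; split=> //; last first.
    by move=> M; exact: (comp_assoc (hM M) (hu' M) (hw' M) (hv' M)).
  move: hu hw hv; rewrite /acond; case: eqP.
    move=> _ [h1 h2 h3] [h4 h5 h6] [h7 h8 h9].
    by split; rewrite ?h1 ?h8 ?h5 ?h2 ?h6 ?h9.
  by move=> _ h1 h2 h3 e; exact: (comp_assoc' hC (h1 e) (h2 e) (h3 e)).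
- move=> i x y z h; apply/compE; exists (mk (wtI z)); split=> //.
    have [lt_in _] := comp_lt hC h.
    by rewrite /acond ltn_eqF // => -[].
  move=> M; rewrite !val_ide; apply: (comp_ide (hM M)); exact: fapp_comp.
- move=> i j qx qx' qy qy' a b p q c lt_ij.
  rewrite -(repK qx) -(repK qx') -(repK qy) -(repK qy').
  move=> /compE[ca [-> ha ha']] /compE[cb [-> hb hb']].
  move=> /compE[cc [-> hc hc']] /compE[cp [-> hp hp']] /compE[cq [-> hq hq']].
  apply/compE; exists cc; split=> //; last first.
    move=> M; exact: (comp_exchange (hM M) lt_ij (ha' M) (hb' M) (hc' M)
      (hp' M) (hq' M)).
  have lt_in : i < n := leq_trans lt_ij (acond_lt hc).
  move: ha hb hc hp hq; rewrite /acond (ltn_eqF lt_in) => ha hb.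
  case: eqP => [_ [_ h1 h2] [_ h3 h4] [_ h5 h6] [] |_ hc hp hq e].
    by rewrite h2 h4 h6; exact: hb.
    by rewrite h1 h3 h5; exact: ha.
  exact: (comp_exchange' hC lt_ij (ha e) (hb e) (hc e) (hp e) (hq e)).
Qed.

Definition fbased : based_layer C S :=
  @BasedLayer _ _ _ flayer (fun s => cls (mk (wtG s))).

Local Lemma fbased_free : is_free d fbased.
Proof.
split.
- by split; [exact: nstrict|exact: fstrict_layer].
- by move=> e s; have := fbd_cls e (mk (wtG s)); rewrite /bd /= => ->; case: e.
move=> D f g hg; pose M := Model hg.
pose h (q : acls) : cells D := val M (rep q).
have hE a : h (cls a) = val M a.
  by have /clsP/cls_eq[_ hv] := rep_cls a; exact: (hv M).
have hP : preserves (C := fprecat) (fapp f) h.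
  split=> [e q|x|i q r s].
  - by rewrite -(repK q) hE fbd_cls; exact: (bd_val M (rep q) e).
  - by rewrite hE; exact: (val_ide M x).
  - rewrite -(repK q) -(repK r) => /compE[c [-> _ h2]].
    by rewrite !hE; exact: (h2 M).
pose F : nfunctor fprecat D := existT _ f (exist _ h hP).
exists F; split.
  split=> // s; rewrite /fapp /= hE; apply/esym.
  exact: (interpE (M := M) (mk (wtG s)) (g s)).1.
move=> [f' [h' hP']] [/= ef hg']; rewrite /ftrunc /= in ef; subst f'.
have key t x y : wt t x y -> forall a, aterm a = t -> abd a = pairb x y ->
    interp (M := M) t (h' (cls a)).
  have [p1 p2 p3] := hP'.
  elim=> [s|z|{}t t' {}x {}y z w IH w' IH'|
      i {}t t' {}x {}y x' y' b c w IH w' IH' hb hc] a at_ ab_.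
  - suff -> : cls a = cls (mk (wtG s)) by exact: hg'.
    by apply/clsP; split; rewrite /= ?at_ ?ab_.
  - suff -> : cls a = cls (mk (wtI z)) by exact: p2.
    by apply/clsP; split; rewrite /= ?at_ ?ab_.
  - exists (h' (cls (mk w))), (h' (cls (mk w'))); split; [exact: IH|exact: IH'|].
    apply: p3; apply/fcompP; exists a; rewrite /acond eqxx /= at_ ab_.
    by split.
  - exists (h' (cls (mk w))), (h' (cls (mk w'))); split; [exact: IH|exact: IH'|].
    apply: p3; apply/fcompP; exists a.
    rewrite /acond (ltn_eqF (comp_lt (nstrict C) hb).1) /= at_ ab_.
    by split=> // -[].
have eh : h' = h.
  apply: funext => q; rewrite -(repK q) hE; apply: (interpE (M := M) (rep q) _).1.
  by apply: key (awt _) _ _ _ => //; apply: funext => -[].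
by subst h'; congr (existT _ f _); apply: eq_exist.
Qed.

End FreeExistence.

Lemma free_exists (n : nat) (C : ncat n) (S : Type) (d : cellext C S) :
  exists E : based_layer C S, is_free d E.
Proof. by exists (fbased d); exact: fbased_free. Qed.

End FreeExistence.

(* A chosen value of the left adjoint, whose n-truncation is C by construction. *)
Definition free_layer (n : nat) (C : ncat n) (S : Type) (d : cellext C S) :
  based_layer C S := sval (cid (FreeExistence.free_exists d)).

Lemma free_layerP (n : nat) (C : ncat n) (S : Type) (d : cellext C S) :
  is_free d (free_layer d).
Proof. exact: svalP (cid (FreeExistence.free_exists d)). Qed.

Lemma free_layer_strict (n : nat) (C : ncat n) (S : Type) (d : cellext C S) :
  strict (addlayer (blayer (free_layer d))).
Proof. by case: (free_layerP d). Qed.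

Definition free_ext (n : nat) (C : ncat n) (S : Type) (d : cellext C S) :
  ncat n.+1 := NCat (free_layer_strict d).

(** * Strict omega-categories *)

Record ocat := OCat {
  otrunc : forall k, ncat k;
  otruncE : forall k, trunc (otrunc k.+1) = otrunc k :> precat k
}.

(* A globular set with identities and partial compositions: the data of a
   strict omega-category, with all the dimensions side by side.  [ocomp i x y z]
   means that x *_i y is defined and equal to z. *)
Record odata := OData {
  ocell : nat -> Type;
  obd : forall k, bool -> ocell k.+1 -> ocell k;
  oide : forall k, ocell k -> ocell k.+1;
  ocomp : forall k, nat -> ocell k -> ocell k -> ocell k -> Prop
}.

Definition odata_of (C : ocat) : odata := {|
  ocell k := cells (otrunc C k);
  obd k e x := ecast B (cells B) (otruncE C k) (bd e x);
  oide k x := ide (ecast B (cells B) (esym (otruncE C k)) x);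
  ocomp k i x y z := comp i x y z
|}.
Coercion odata_of : ocat >-> odata.

Record ofunctor (C D : odata) := OFunctor {
  ofun :> forall k, ocell C k -> ocell D k;
  ofun_bd : forall k e (x : ocell C k.+1), ofun (obd e x) = obd e (ofun x);
  ofun_ide : forall k (x : ocell C k), ofun (oide x) = oide (ofun x);
  ofun_comp : forall k i (x y z : ocell C k),
    ocomp i x y z -> ocomp i (ofun x) (ofun y) (ofun z)
}.

Definition isomorphism (C D : odata) (F : ofunctor C D) : Prop :=
  exists G : ofunctor D C,
    (forall k x, G k (F k x) = x) /\ (forall k y, F k (G k y) = y).

(** * Polygraphs *)

(* The n-polygraphs whose set of k-generators is G k for each k, together with
   the function Q |-> Q^*.  With the sets of generators fixed, a 0-polygraph has
   no further data and an (n+1)-polygraph is an n-polygraph Q with the sources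
   and targets in Q^* of the (n+1)-generators. *)
Fixpoint ptower (G : nat -> Type) (n : nat) : {T : Type & T -> ncat n} :=
  match n with
  | 0 => existT (fun T => T -> ncat 0) unit
           (fun _ => @NCat 0 (G 0 : precat 0) Logic.I)
  | m.+1 => existT (fun T => T -> ncat m.+1)
      {Q : projT1 (ptower G m) & cellext (projT2 (ptower G m) Q) (G m.+1)}
      (fun Q => free_ext (projT2 Q))
  end.

Definition polygraph (G : nat -> Type) (n : nat) : Type := projT1 (ptower G n).
Definition pstar (G : nat -> Type) (n : nat) (Q : polygraph G n) : ncat n :=
  projT2 (ptower G n) Q.
Definition ptrunc (G : nat -> Type) (n : nat) (Q : polygraph G n.+1) :
  polygraph G n := projT1 Q.
Definition pgen (G : nat -> Type) (n : nat) :
    forall Q : polygraph G n, G n -> cells (pstar Q) :=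
  match n with
  | 0 => fun _ g => g
  | m.+1 => fun Q => @binc _ _ _ (free_layer (projT2 Q))
  end.

Record opolygraph (G : nat -> Type) := OPolygraph {
  opol : forall k, polygraph G k;
  opolE : forall k, ptrunc (opol k.+1) = opol k
}.

Definition ostar (G : nat -> Type) (Q : opolygraph G) : ocat :=
  @OCat (fun k => pstar (opol Q k))
    (fun k => congr1 (fun R => ndata (pstar R)) (opolE Q k)).

Definition ogen (G : nat -> Type) (Q : opolygraph G) (n : nat) (g : G n) :
  ocell (ostar Q) n := pgen (opol Q n) g.

(** * Hypergraphs, cells and torsion-free complexes *)

Local Open Scope fset_scope.

Record hypergraph := Hypergraph {
  hcell :> nat -> choiceType;
  hbd : forall n, bool -> hcell n.+1 -> {fset hcell n}
}.

(* U^- and U^+ *)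
Definition sbd (P : hypergraph) (n : nat) (e : bool) (U : {fset P n.+1}) :
  {fset P n} := \bigcup_(u <- U) hbd e u.

(* U^- minus U^+ for the sign -, and U^+ minus U^- for the sign + *)
Definition sbdD (P : hypergraph) (n : nat) (e : bool) (U : {fset P n.+1}) :
  {fset P n} := sbd e U `\` sbd (~~ e) U.

Definition fork_free (P : hypergraph) (n : nat) : {fset P n} -> Prop :=
  match n with
  | 0 => fun U => #|` U| = 1
  | m.+1 => fun U => forall u v, u \in U -> v \in U -> u <> v ->
      forall e, hbd e u `&` hbd e v = fset0
  end.

Definition hstep (P : hypergraph) (n : nat) : P n -> P n -> Prop :=
  match n with
  | 0 => fun _ _ => False
  | m.+1 => fun u v => hbd true u `&` hbd false v <> fset0
  end.

Definition tri (P : hypergraph) (n : nat) (U : pred (P n)) :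
    P n -> P n -> Prop :=
  clos_trans (P n) (fun u v => [/\ U u, U v & hstep u v]).

Definition tri_set (P : hypergraph) (n : nat) (U : pred (P n))
    (V W : {fset P n}) : Prop :=
  exists v w, [/\ v \in V, w \in W & tri U v w].

Definition segment (P : hypergraph) (n : nat) (U : pred (P n))
    (V : {fset P n}) : Prop :=
  forall u1 u2 u3, u1 \in V -> u3 \in V -> tri U u1 u2 -> tri U u2 u3 ->
    u2 \in V.

(* The tuple (X_{0,-}, X_{0,+}, ..., X_{n-1,-}, X_{n-1,+}, X_n), as a function
   of all the dimensions, extended by X_{n,-} = X_{n,+} = X_n and by empty sets
   in the dimensions above n. *)
Record precell (P : hypergraph) (n : nat) := Precell {
  pface :> forall j, bool -> {fset P j};
  pface_top : pface n false = pface n true;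
  pface_out : forall j e, n < j -> pface j e = fset0
}.

Definition ptop (P : hypergraph) (n : nat) (X : precell P n) : {fset P n} :=
  X n true.

Definition pbd_face (P : hypergraph) (n : nat) (i : nat) (e : bool)
    (X : precell P n) (j : nat) (e' : bool) : {fset P j} :=
  if j < i then X j e' else if j == i then X j e else fset0.

Lemma pbd_top (P : hypergraph) (n i : nat) (e : bool) (X : precell P n) :
  pbd_face i e X i false = pbd_face i e X i true.
Proof. by rewrite /pbd_face ltnn eqxx. Qed.

Lemma pbd_out (P : hypergraph) (n i : nat) (e : bool) (X : precell P n) j e' :
  i < j -> pbd_face i e X j e' = fset0.
Proof. by move=> h; rewrite /pbd_face ltnNge (ltnW h) gtn_eqF. Qed.

(* used for i < n only *)
Definition pbd (P : hypergraph) (n i : nat) (e : bool) (X : precell P n) :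
  precell P i := Precell (pbd_top i e X) (@pbd_out P n i e X).

Lemma pid_top (P : hypergraph) (n : nat) (X : precell P n) :
  X n.+1 false = X n.+1 true.
Proof. by rewrite !pface_out. Qed.

Lemma pid_out (P : hypergraph) (n : nat) (X : precell P n) j e :
  n.+1 < j -> X j e = fset0.
Proof. by move=> h; rewrite pface_out // ltnW. Qed.

(* With the convention on the dimensions above n, the identity of X has the
   same components as X. *)
Definition pid (P : hypergraph) (n : nat) (X : precell P n) : precell P n.+1 :=
  Precell (pid_top X) (@pid_out P n X).

Definition pcomp_face (P : hypergraph) (n : nat) (i : nat) (X Y : precell P n)
    (j : nat) (e : bool) : {fset P j} :=
  if j < i then X j e
  else if j == i then (if e then Y j true else X j false)
  else X j e `|` Y j e.

Definition moves (P : hypergraph) (i : nat) (M : {fset P i.+1})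
    (U V : {fset P i}) : Prop :=
  U = (V `|` sbd false M) `\` sbd true M /\
  V = (U `|` sbd true M) `\` sbd false M.

Definition is_cell (P : hypergraph) (n : nat) (X : precell P n) : Prop :=
  (forall i e, i < n -> moves (X i.+1 e) (X i false) (X i true)) /\
  (forall i e, i <= n -> fork_free (X i e)).

Record cell (P : hypergraph) (n : nat) := MkCell {
  cprecell :> precell P n;
  cellP : is_cell cprecell
}.

Lemma pbd_cell (P : hypergraph) (n : nat) (e : bool) (X : cell P n.+1) :
  is_cell (pbd n e X).
Proof.
have [h1 h2] := cellP X; split=> i e' hi; rewrite /= /pbd_face.
  rewrite hi [i.+1 < n]ltn_neqAle hi andbT.
  by case: eqP => [_|_] /=; apply: h1; exact: ltnW.
by move: (hi); rewrite leq_eqVlt => /orP[/eqP ->|->];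
  rewrite ?ltnn ?eqxx; apply: h2; rewrite // ltnW.
Qed.

Lemma pid_cell (P : hypergraph) (n : nat) (X : cell P n) : is_cell (pid X).
Proof.
have [h1 h2] := cellP X; split=> i e; rewrite /=.
  rewrite ltnS leq_eqVlt => /orP[/eqP ->|]; last exact: h1.
  have h0 d : sbd d (X n.+1 e) = fset0.
    by rewrite pface_out // /sbd big_seq_fset0.
  by rewrite /moves !h0 !fsetU0 !fsetD0 pface_top.
rewrite leq_eqVlt => /orP[/eqP ->|]; last exact: h2.
by rewrite pface_out.
Qed.

(* The graded set Cell(P), with its operations.  For torsion-free P, a
   composite of cells is a cell. *)
Definition Cell (P : hypergraph) : odata := {|
  ocell n := cell P n;
  obd n e X := MkCell (pbd_cell e X);
  oide n X := MkCell (pid_cell X);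
  ocomp n i X Y Z :=
    [/\ i < n, pbd i true X = pbd i false Y
      & forall j e, Z j e = pcomp_face i X Y j e]
|}.

(* The graded set equal to U in dimension n and empty elsewhere. *)
Definition single (P : hypergraph) (n : nat) (U : {fset P n}) (j : nat) :
  {fset P j} :=
  if n =P j is ReflectT h then ecast k {fset P k} h U else fset0.

(* The components of sign e in dimensions <= n, from the one in dimension n:
   each is obtained from the next one by [sbdD e]. *)
Fixpoint descend (P : hypergraph) (n : nat) (e : bool) :
    {fset P n} -> forall j, {fset P j} :=
  match n with
  | 0 => fun U j => single U j
  | m.+1 => fun U j =>
      if j == m.+1 then single U j else descend e (sbdD e U) j
  end.

Lemma singlexx (P : hypergraph) (n : nat) (U : {fset P n}) : single U n = U.
Proof. by rewrite /single; case: eqP => // h; rewrite eq_axiomK. Qed.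

Lemma descend_top (P : hypergraph) (n : nat) e (U : {fset P n}) :
  descend e U n = U.
Proof. by case: n U => [|n] U /=; rewrite ?eqxx singlexx. Qed.

Lemma descend_out (P : hypergraph) (n : nat) e (U : {fset P n}) j :
  n < j -> descend e U j = fset0.
Proof.
elim: n U => [|n IH] U /= h.
  by rewrite /single; case: eqP => // h'; rewrite -h' in h.
by rewrite gtn_eqF // IH // ltnW.
Qed.

Lemma atom_top (P : hypergraph) (n : nat) (u : P n) :
  descend false [fset u] n = descend true [fset u] n.
Proof. by rewrite !descend_top. Qed.

Definition atom (P : hypergraph) (n : nat) (u : P n) : precell P n :=
  @Precell P n (fun j e => descend e [fset u] j) (atom_top u)
    (fun j e => @descend_out P n e [fset u] j).

Record torsion_free_complex (P : hypergraph) : Prop := TorsionFreeComplex {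
  nonemptiness : forall n (u : P n.+1) e, hbd e u <> fset0;
  acyclicity : forall n (u : P n), 1 <= n -> ~ tri predT u u;
  relevance : forall n (u : P n), is_cell (atom u);
  segment_condition : forall k n (u : P k) (X : cell P n) e, n < k ->
    atom u n e `<=` ptop X -> segment [in ptop X] (atom u n e);
  torsion_freeness : forall n k l (u : P k) (v : P l) (X : cell P n),
    1 <= n -> n < minn k l ->
    atom u n true `<=` ptop X -> atom v n false `<=` ptop X ->
    atom u n true `&` atom v n false = fset0 ->
    ~ (tri_set [in ptop X] (atom u n true) (atom v n false) /\
       tri_set [in ptop X] (atom v n false) (atom u n true))
}.

(* Main.v *)
From Pilot Require Import Defs.
From mathcomp Require Import all_boot finmap.
From mathcomp Require Import boolp zify.
From Stdlib Require Import Relation_Operators.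
Import Pilot.Defs.

Set Implicit Arguments.
Unset Strict Implicit.
Unset Printing Implicit Defensive.

Local Open Scope fset_scope.

(* Gluing. If S is a fork-free set of (n+1)-generators whose consumed part S^- - S^+
   lies in the top of an n-cell, then activating S gives an n-cell again and S
   produces nothing already present. By induction on n and on #|S| one reduces to
   S = {u}: the segment condition cuts the top as U + u^- + V with U before u^-
   and V after it, and u^- and u^+ have the same effect in dimension n-1, so that
   u^- can be replaced by u^+. That nothing is consumed and then produced again
   follows by acyclicity: a producer of y coming after a consumer of y could be
   activated while y is still there. Hence composites of cells are cells.

   Decompositions. A cell is split in dimension i by any initial part of its
   (i+1)-dimensional boundary that is compatible with the faces in higher
   dimensions. So two decompositions X1 *_j X2 = Y *_i Z of a cell have a common
   refinement, and a cell that cannot be split in any dimension >= i agrees with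
   an atom <u> above dimension i.

   Freeness. Given f and g into an (n+1)-category E as in the universal property,
   let gen be the subcategory of Cell(P) x E generated by the pairs (<u>, g u) and
   the identities (id X, id (f X)). It is total because every cell decomposes into atoms. It is
   functional because decompositions lift: if (X, x) is in gen and X = Y *_i Z
   then x = y *_i z with (Y, y) and (Z, z) in gen. By induction on X, common
   refinements and the exchange law reduce this to the exchange of two factors
   carried by atoms <u> and <v>; there torsion-freeness separates u from v in
   their common boundary, hence both factors split one dimension lower and the
   exchange law applies. So gen is the graph of the required functor, and the
   truncations of Cell(P) are iterated free extensions. *)

(** Gluing: the disjointness in [glue_at] is what turns an activation into a movement, and the
    absence of revisits, which the next dimension needs, is extracted from it; so both go through
    the induction together.

    Lifting: a factor of a cell split in dimension i loses elements in dimension i + 1 and gains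
    none above, but its i-dimensional boundary may be larger than that of the cell. Total size is
    therefore useless, and the induction is lexicographic with the top dimension first. The obstacle
    is a pair of decompositions in the same dimension: two pieces may occur in opposite orders, and
    no refinement removes this. They are commuted by an Eckmann-Hilton argument, with identities as
    padding and one dimension lower as room.

    Uniqueness: an isomorphism in dimension n leaves one choice for the source and target of an
    (n+1)-generator. Since the type of F depends on Q, both are determined together, as a dependent
    pair. *)

Ltac mem_cases :=
  repeat match goal with
  | H : context [in_mem ?y ?A] |- _ => move: H
  end;
  rewrite ?inE;
  repeat match goal with
  | |- context [in_mem ?y ?A] => case: (in_mem y A) => //=
  end;
  try solve [rewrite /is_true; intuition congruence].

(** Bare families are used instead of [precell]: equations between composites are then equalities of
    functions, without proof components. *)
Notation fam P := (forall j : nat, bool -> {fset hcell P j}).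

(** * Movements *)

Section Movement.

Variable P : hypergraph.
Implicit Types (n : nat) (e : bool).
Implicit Types X Y : fam P.

Lemma sbdP n e (U : {fset P n.+1}) (y : P n) :
  reflect (exists2 u, u \in U & y \in hbd e u) (y \in sbd e U).
Proof.
apply: (iffP (bigfcupP _ _ _ _)) => [[u]|[u uU yu]].
  by rewrite andbT => uU yu; exists u.
by exists u; rewrite // uU.
Qed.

Lemma mem_sbd n e (U : {fset P n.+1}) u y :
  u \in U -> y \in hbd e u -> y \in sbd e U.
Proof. by move=> uU yu; apply/sbdP; exists u. Qed.

Lemma sbdU n e (U V : {fset P n.+1}) :
  sbd e (U `|` V) = sbd e U `|` sbd e V.
Proof.
apply/fsetP => y; rewrite inE; apply/sbdP/orP => [[u]|].
  by rewrite inE => /orP[] h yu; [left|right]; apply: mem_sbd yu.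
by move=> [] /sbdP[u uU yu]; exists u; rewrite // inE uU ?orbT.
Qed.

Lemma sbd0 n e : sbd e (fset0 : {fset P n.+1}) = fset0.
Proof. by rewrite /sbd big_seq_fset0. Qed.

Lemma sbd1 n e (u : P n.+1) : sbd e [fset u] = hbd e u.
Proof. by rewrite /sbd big_seq_fset1. Qed.

Lemma sbdS n e (U V : {fset P n.+1}) : {subset U <= V} ->
  {subset sbd e U <= sbd e V}.
Proof. by move=> h y /sbdP[u /h uV yu]; apply: mem_sbd yu. Qed.

(** Stated on booleans, so that [mem_cases] can treat it together with memberships. *)
Definition dis (T : choiceType) (A B : {fset T}) : Prop :=
  forall y, ~~ ((y \in A) && (y \in B)).

Lemma disC (T : choiceType) (A B : {fset T}) : dis A B -> dis B A.
Proof. by move=> h y; rewrite andbC. Qed.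

Lemma disP (T : choiceType) (A B : {fset T}) :
  dis A B <-> (forall y, y \in A -> y \in B -> False).
Proof.
split=> h y; first by move=> a b; have := h y; rewrite a b.
by apply/negP => /andP[]; exact: h.
Qed.

Lemma movesP n (M : {fset P n.+1}) (U V : {fset P n}) :
  moves M U V <-> forall y,
   (y \in U) = (y \notin sbd true M) && ((y \in V) || (y \in sbd false M)) /\
   (y \in V) = (y \notin sbd false M) && ((y \in U) || (y \in sbd true M)).
Proof.
split=> [[h1 h2] y|h].
  by split; [rewrite {1}h1|rewrite {1}h2]; rewrite !inE.
by split; apply/fsetP => y; rewrite !inE; have [] := h y.
Qed.

Definition act n (S : {fset P n.+1}) (W : {fset P n}) : {fset P n} :=
  (W `|` sbd true S) `\` sbd false S.

Lemma in_act n (S : {fset P n.+1}) (W : {fset P n}) y :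
  (y \in act S W) = (y \notin sbd false S) && ((y \in W) || (y \in sbd true S)).
Proof. by rewrite !inE. Qed.

Lemma moves_act n (S : {fset P n.+1}) (U V : {fset P n}) :
  moves S U V -> V = act S U.
Proof. by case. Qed.

Lemma sbdDP n e (S : {fset P n.+1}) y :
  (y \in sbdD e S) = (y \notin sbd (~~ e) S) && (y \in sbd e S).
Proof. by rewrite inE. Qed.

Lemma moves_sub n (S : {fset P n.+1}) (U V : {fset P n}) :
  moves S U V -> {subset sbdD false S <= U}.
Proof.
by move=> /movesP h y; rewrite sbdDP /=; have [] := h y; mem_cases.
Qed.

Lemma moves_subr n (S : {fset P n.+1}) (U V : {fset P n}) :
  moves S U V -> {subset sbdD true S <= V}.
Proof.
by move=> /movesP h y; rewrite sbdDP /=; have [] := h y; mem_cases.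
Qed.

Lemma act_moves n (S : {fset P n.+1}) (U : {fset P n}) :
  {subset sbdD false S <= U} -> dis (sbd true S) U -> moves S U (act S U).
Proof.
move=> h1 h2; apply/movesP => y; have := h1 y; have := h2 y.
by rewrite in_act sbdDP /=; mem_cases.
Qed.

(** The last hypothesis is what consecutive movements lack in general: an element consumed by [S]
    and produced again by [T] is on both sides of the union, which does not remember the order. *)
Lemma moves_comp n (S T : {fset P n.+1}) (A B C : {fset P n}) :
  moves S A B -> moves T B C -> dis (sbd false S) (sbd true T) ->
  moves (S `|` T) A C.
Proof.
move=> /movesP h1 /movesP h2 h; apply/movesP => y.
have [h1a h1b] := h1 y; have [h2a h2b] := h2 y; have := h y.
clear h1 h2 h.
by rewrite !sbdU !inE; mem_cases.
Qed.

Lemma moves_union n (S T : {fset P n.+1}) (A B C D : {fset P n}) :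
  moves S A B -> moves T C D ->
  dis (sbd true S) (D `|` sbd false T) -> dis (sbd true T) (B `|` sbd false S) ->
  dis (sbd false S) (C `|` sbd true T) -> dis (sbd false T) (A `|` sbd true S) ->
  moves (S `|` T) (A `|` C) (B `|` D).
Proof.
move=> /movesP h1 /movesP h2 a b c d; apply/movesP => y.
have [h1a h1b] := h1 y; have [h2a h2b] := h2 y.
move: (a y) (b y) (c y) (d y); clear h1 h2 a b c d.
by rewrite !sbdU !inE; mem_cases.
Qed.

(* The tuple of the X_{j,e} with j < n, completed by W, is an n-cell exactly when
   [sph n X] and [fill X W] hold. *)
Fixpoint fill n (X : fam P) : {fset P n} -> Prop :=
  match n return {fset P n} -> Prop with
  | 0 => fun W => fork_free W
  | m.+1 => fun W => fork_free W /\ moves W (X m false) (X m true)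
  end.

Fixpoint sph n (X : fam P) : Prop :=
  if n is m.+1 then sph m X /\ forall e, fill X (X m e) else True.

Lemma fill_ff n X (W : {fset P n}) : fill X W -> fork_free W.
Proof. by case: n W => [|n] W //= []. Qed.

Lemma ffS n (U V : {fset P n.+1}) : {subset U <= V} -> fork_free V -> fork_free U.
Proof. by move=> h ff u v /h uV /h vV; exact: ff. Qed.

Lemma ff_eq n (U : {fset P n.+1}) u v e y : fork_free U ->
  u \in U -> v \in U -> y \in hbd e u -> y \in hbd e v -> u = v.
Proof.
move=> ff uU vU yu yv; apply: contrapT => uv.
by have /fsetP/(_ y) := ff _ _ uU vU uv e; rewrite !inE yu yv.
Qed.

Lemma ffU n (U V : {fset P n.+1}) : fork_free U -> fork_free V ->
  (forall e, dis (sbd e U) (sbd e V)) -> fork_free (U `|` V).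
Proof.
move=> fU fV h u v; rewrite !inE => /orP[] uU /orP[] vV uv e;
  [exact: fU|apply/fsetP=> y|apply/fsetP=> y|exact: fV]; rewrite !inE;
  apply/negP => /andP[yu yv];
  [have := h e y|have := disC (h e) y];
  by rewrite (mem_sbd uU yu) (mem_sbd vV yv).
Qed.

Lemma ff0 (U V : {fset P 0}) : fork_free U -> fork_free V ->
  {subset U <= V} -> U = V.
Proof.
rewrite /= => hU hV h; apply/eqP; rewrite eqEfcard hU hV leqnn andbT.
by apply/fsubsetP.
Qed.

Lemma eq_fill n X Y (W : {fset P n}) : (forall j e, j < n -> X j e = Y j e) ->
  fill X W -> fill Y W.
Proof. by case: n W => [|n] W //= h; rewrite !h. Qed.

Lemma eq_sph n X Y : (forall j e, j < n -> X j e = Y j e) ->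
  sph n X -> sph n Y.
Proof.
elim: n => //= n IH h [h1 h2]; split.
  by apply: IH h1 => j e jn; apply: h; apply: ltnW.
move=> e; rewrite -h //; apply: eq_fill (h2 e) => j e' jn.
by apply: h; apply: ltnW.
Qed.

Lemma sph_le n m X : m <= n -> sph n X -> sph m X.
Proof.
elim: n => [|n IH]; first by rewrite leqn0 => /eqP ->.
by rewrite leq_eqVlt => /orP[/eqP -> //|mn [h _]]; exact: IH.
Qed.

Lemma sph_fill n m X e : m < n -> sph n X -> fill X (X m e).
Proof. by move=> mn /(sph_le mn) [_]; exact. Qed.

Lemma sph_moves n m X e : m.+1 < n -> sph n X ->
  moves (X m.+1 e) (X m false) (X m true).
Proof. by move=> mn /(sph_fill e mn) []. Qed.

Lemma sph_ff n m X e : m < n -> sph n X -> fork_free (X m e).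
Proof. by move=> mn /(sph_fill e mn)/fill_ff. Qed.

Lemma sphP n X :
  (forall i e, i.+1 < n -> moves (X i.+1 e) (X i false) (X i true)) ->
  (forall i e, i < n -> fork_free (X i e)) -> sph n X.
Proof.
elim: n => //= n IH h1 h2; split.
  by apply: IH => i e h; [apply: h1|apply: h2]; apply: ltnW.
move=> e; have := h2 n e (leqnn _).
by case: n {IH h2} h1 => [|n] h1 //=; split=> //; apply: h1.
Qed.

End Movement.

Lemma fcard_lt (T : choiceType) (A B : {fset T}) x :
  {subset A <= B} -> x \in B -> x \notin A -> #|` A| < #|` B|.
Proof.
move=> AB xB xA; apply: fproper_ltn_card; rewrite fproperE.
apply/andP; split; first exact/fsubsetP.
by apply/negP => /fsubsetP/(_ x xB); apply/negP.
Qed.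

Lemma minimal_ex (T : choiceType) (R : T -> T -> Prop) (S : {fset T}) :
  (forall x y z, R x y -> R y z -> R x z) -> (forall x, ~ R x x) ->
  S != fset0 -> exists2 s, s \in S & forall t, t \in S -> ~ R t s.
Proof.
move=> tr irr; have [k] := ubnP #|` S|; elim: k S => // k IH S hk.
move=> /fset0Pn[x xS].
have [[t tS tx]|h] := pselect (exists2 t, t \in S & R t x); last first.
  by exists x => // t tS tx; apply: h; exists t.
pose S' := [fset y in S | `[< R y x >]].
have [||t' ht'] := IH S'.
- rewrite -ltnS; apply: leq_trans hk; apply: (fcard_lt (x := x)) => //.
    by move=> y; rewrite !inE => /andP[].
  by rewrite !inE xS /=; apply/asboolP.
- by apply/fset0Pn; exists t; rewrite !inE tS /=; apply/asboolP.
move: ht'; rewrite !inE => /andP[t'S /asboolP t'x] ht.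
exists t' => // y yS yt; apply: (ht y) => //.
by rewrite !inE yS /=; apply/asboolP; apply: tr yt t'x.
Qed.

(** * Gluing *)

(* The part of the axioms used by gluing, in a form invariant under the reversal
   of all signs. *)
Record gluable (P : hypergraph) : Prop := Gluable {
  glu_ne : forall n (u : P n.+1) e, hbd e u != fset0;
  glu_acy : forall n (u : P n.+1), ~ tri predT u u;
  glu_ff : forall n (u : P n.+1) e, fork_free (hbd e u);
  glu_glob : forall n (u : P n.+2) e,
    sbdD e (hbd false u) = sbdD e (hbd true u);
  glu_seg : forall n (u : P n.+1) e X (W : {fset P n}), sph n X -> fill X W ->
    {subset hbd e u <= W} -> segment [in W] (hbd e u)
}.

Section Gluing.

Variable P : hypergraph.
Hypothesis hP : gluable P.

Lemma hstepP n (u v : P n.+1) y :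
  y \in hbd true u -> y \in hbd false v -> hstep u v.
Proof.
by move=> yu yv /fsetP/(_ y); rewrite !inE yu yv.
Qed.

Lemma tri_step n (u v : P n.+1) y :
  y \in hbd true u -> y \in hbd false v -> tri predT u v.
Proof. by move=> yu yv; apply: t_step; split=> //; exact: hstepP yu yv. Qed.

Lemma tri_trans n U (u v w : P n) : tri U u v -> tri U v w -> tri U u w.
Proof. exact: t_trans. Qed.

Lemma triW n U (u v : P n) : tri U u v -> tri predT u v.
Proof.
elim=> [x y [_ _ h]|x y z _ h1 _ h2]; first exact: t_step.
exact: tri_trans h1 h2.
Qed.

(** [sbdD false S] is what [S] needs from outside: the elements that it consumes without producing
    them. *)
Definition glues n (S : {fset P n.+1}) (W : {fset P n}) : Prop :=
  {subset sbdD false S <= W}.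

(** Closed under producers, so that [S'] can be activated before the rest of [S]. *)
Definition initial n (S S' : {fset P n.+1}) : Prop :=
  {subset S' <= S} /\
  forall t s y, t \in S -> s \in S' -> y \in hbd true t -> y \in hbd false s ->
    t \in S'.

Lemma bd_dis n (u : P n.+1) y :
  y \in hbd false u -> y \in hbd true u -> False.
Proof. by move=> y1 y2; apply: (glu_acy hP (u := u)); exact: tri_step y2 y1. Qed.

Lemma initial_glues n (S S' : {fset P n.+1}) W :
  initial S S' -> glues S W -> glues S' W.
Proof.
move=> [sub ini] gl y; rewrite inE => /andP[h] /sbdP[s sS' ys].
apply: gl; rewrite sbdDP (mem_sbd (sub _ sS') ys) andbT.
apply: contra h => /sbdP[t tS yt].
by apply: (mem_sbd _ yt); exact: ini tS sS' yt ys.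
Qed.

Lemma initial_rest n (S S' : {fset P n.+1}) :
  initial S S' -> dis (sbd false S') (sbd true (S `\` S')).
Proof.
move=> [sub ini]; apply/disP => y /sbdP[s sS' ys] /sbdP[t].
rewrite inE => /andP[tS' tS] yt.
by rewrite (ini t s y) in tS'.
Qed.

(** By fork-freeness, an element needed by the rest has not been consumed by [S']. It was either
    produced by [S'] or already required from [W] by [S]. *)
Lemma rest_glues n (S S' : {fset P n.+1}) W : fork_free S ->
  initial S S' -> glues S W -> glues (S `\` S') (act S' W).
Proof.
move=> ff ini gl y; rewrite inE => /andP[h] /sbdP[t tR yt].
have [tS' tS] : t \notin S' /\ t \in S by move: tR; rewrite inE => /andP[].
rewrite in_act; apply/andP; split.
  apply/negP => /sbdP[s sS' ys].
  by rewrite (ff_eq ff tS (ini.1 _ sS') yt ys) sS' in tS'.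
have [_|yS'] := boolP (y \in sbd true S'); first by rewrite orbT.
rewrite orbF; apply: gl; rewrite sbdDP (mem_sbd tS yt) andbT.
apply/negP => /sbdP[s sS ys]; have [sS'|sS'] := boolP (s \in S').
  by rewrite (mem_sbd sS' ys) in yS'.
by case/negP: h; apply: mem_sbd ys; rewrite inE sS'.
Qed.

Lemma fsetUDK (T : choiceType) (S S' : {fset T}) : {subset S' <= S} ->
  S = S' `|` (S `\` S').
Proof. by move=> h; apply/fsetP => y; have := h y; mem_cases. Qed.

Lemma act_union n (S T : {fset P n.+1}) W : dis (sbd false S) (sbd true T) ->
  act (S `|` T) W = act T (act S W).
Proof.
move=> h; apply/fsetP => y; have := h y; rewrite !in_act !sbdU; clear h.
by mem_cases.
Qed.

Lemma act_rest n (S S' : {fset P n.+1}) W : initial S S' ->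
  act S W = act (S `\` S') (act S' W).
Proof.
move=> ini; rewrite {1}(fsetUDK ini.1) act_union //.
exact: initial_rest.
Qed.

Lemma initialD n (S S' S'' : {fset P n.+1}) : initial S S' ->
  initial S (S' `|` S'') -> dis S' S'' -> initial (S `\` S') S''.
Proof.
move=> [s1 i1] [s2 i2] d; split.
  move=> y yS; rewrite inE s2 ?inE ?yS ?orbT // andbT.
  by have := d y; rewrite yS andbT.
move=> t s y; rewrite inE => /andP[tS' tS] sS'' yt ys.
have := i2 t s y tS _ yt ys; rewrite !inE sS'' orbT (negPf tS').
by apply.
Qed.

Definition glue_at n : Prop := forall X (W : {fset P n}) S, sph n X ->
  fill X W -> fork_free S -> glues S W ->
  dis (sbd true S) W /\ fill X (act S W).

Definition no_revisit_at n : Prop := forall X (W : {fset P n}) S T,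
  sph n X -> fill X W -> fork_free S -> glues S W -> fork_free T ->
  glues T (act S W) ->
  [/\ dis (sbd false S) (sbd true T),
      dis (sbd false S) (sbd false T) & dis (sbd true S) (sbd true T)].

(* If b produces an element y consumed by an earlier a, then a is not below b,
   so that b and the part of S and T below it can be activated before a, at a
   stage where y is still present: this contradicts the disjointness in
   [glue_at]. *)
Lemma no_revisit_of_glue n : glue_at n -> no_revisit_at n.
Proof.
move=> glue X W S T sX fW fS gS fT gT.
pose le (a b : P n.+1) := a = b \/ tri predT a b.
have le_tri a b c y : y \in hbd true a -> y \in hbd false b -> le b c ->
    tri predT a c.
  by move=> h1 h2 [<-|h3]; [|apply: tri_trans h3]; apply: tri_step h1 h2.
have ge_tri a b c y : le a b -> y \in hbd true b -> y \in hbd false c ->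
    tri predT a c.
  by move=> [->|h3] h1 h2; [|apply: (tri_trans h3)]; apply: tri_step h1 h2.
have main : dis (sbd false S) (sbd true T).
  apply/disP => y /sbdP[a aS ya] /sbdP[b bT yb].
  (* Activate first what does not depend on [a]. After that [y] is present, since a producer of [y]
     at or above [a] would close a cycle. *)
  pose S' := [fset s in S | ~~ `[< le a s >]].
  have iS' : initial S S'.
    split=> [s|t s z tS]; rewrite !inE; first by case/andP.
    move=> /andP[sS /asboolP h] zt zs; rewrite tS /=.
    by apply/asboolP => ats; apply: h; right; exact: ge_tri ats zt zs.
  have gS' := initial_glues iS' gS.
  have [_ fW1] := glue X W S' sX fW (ffS iS'.1 fS) gS'.
  pose S1 := S `\` S'; pose W1 := act S' W.
  have gS1 : glues S1 W1 := rest_glues fS iS' gS.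
  have inS1 s : s \in S1 -> s \in S /\ le a s.
    by rewrite !inE => /andP[/nandP[/negPf->//|/negPn/asboolP h] sS].
  have fS1 : fork_free S1 by apply: ffS fS => s /inS1[].
  have aS1 : a \in S1.
    rewrite !inE aS andbT; apply/nandP; right; apply/negPn/asboolP.
    by left.
  have yW1 : y \in W1.
    apply: gS1; rewrite sbdDP (mem_sbd aS1 ya) andbT.
    apply/negP => /sbdP[c /inS1[cS ac] yc].
    by apply: (glu_acy hP (u := a)); apply: ge_tri ac yc ya.
  (* [T1] is what [T2] below needs from the remaining part of [S]. It does not contain [a], since
     [b] is strictly below [a]; by fork-freeness it does not consume [y]. *)
  pose T1 := [fset s in S1 | `[< le s b >]].
  have iT1 : initial S1 T1.
    split=> [s|t s z tS].
      by rewrite in_fset => /andP[].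
    rewrite in_fset => /andP[_ /asboolP h] zt zs.
    rewrite in_fset; apply/andP; split=> //; apply/asboolP; right.
    exact: le_tri zt zs h.
  have gT1 := initial_glues iT1 gS1.
  have [_ fW2] := glue X W1 T1 sX fW1 (ffS iT1.1 fS1) gT1.
  pose T2 := [fset s in T | `[< le s b >]].
  have iT2 : initial T T2.
    split=> [s|t s z tS].
      by rewrite in_fset => /andP[].
    rewrite in_fset => /andP[_ /asboolP h] zt zs.
    rewrite in_fset; apply/andP; split=> //; apply/asboolP; right.
    exact: le_tri zt zs h.
  have gT2 := initial_glues iT2 gT.
  have gT2' : glues T2 (act T1 W1).
    move=> z zT2; have := gT2 z zT2; rewrite (act_rest W iS') -/S1 -/W1.
    rewrite !in_act => /andP[zS1 h].
    apply/andP; split; first by apply: contra zS1; apply: sbdS; case: iT1.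
    case/orP: h => [-> //|/sbdP[s sS1 zs]].
    apply/orP; right; apply: (mem_sbd _ zs); rewrite in_fset; apply/andP; split=> //.
    move: zT2; rewrite sbdDP => /andP[_ /sbdP[t]].
    rewrite in_fset => /andP[_ /asboolP tb] zt.
    by apply/asboolP; right; exact: le_tri zs zt tb.
  have [d _] := glue X (act T1 W1) T2 sX fW2 (ffS iT2.1 fT) gT2'.
  have bT2 : b \in T2.
    by rewrite in_fset; apply/andP; split=> //; apply/asboolP; left.
  have := d y; rewrite (mem_sbd bT2 yb) in_act yW1 /= andbT => /negPn.
  move=> /sbdP[c cT1 yc].
  have ca : c = a by apply: (ff_eq fS1) (iT1.1 _ cT1) aS1 yc ya.
  move: cT1; rewrite ca in_fset => /andP[_ /asboolP ab].
  by apply: (glu_acy hP (u := b)); exact: le_tri yb ya ab.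
have [dT _] := glue X _ T sX (glue X W S sX fW fS gS).2 fT gT.
split=> //; apply/disP => y yS yT.
  have := gT y; rewrite sbdDP yT andbT in_act yS /=.
  by have := main y; rewrite yS /= => -> /(_ isT).
have := dT y; rewrite yT in_act yS orbT andbT /= => /negPn yS'.
by have := main y; rewrite yS' yT.
Qed.

(** An element both consumed and produced by [S] is neither in [act S W] nor, by disjointness, in
    [W]; so only the net boundaries matter. *)
Lemma act_eq n (S T : {fset P n.+1}) W :
  (forall e, sbdD e S = sbdD e T) -> glues S W -> dis (sbd true S) W ->
  dis (sbd true T) W -> act S W = act T W.
Proof.
move=> h g d1 d2; apply/fsetP => y; rewrite !in_act.
have := g y; rewrite sbdDP.
have /fsetP/(_ y) := h false; have /fsetP/(_ y) := h true; rewrite !sbdDP /=.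
have := d1 y; have := d2 y; clear h g d1 d2; mem_cases.
Qed.

Definition glue1_at n : Prop := forall X (W : {fset P n}) u, sph n X ->
  fill X W -> {subset hbd false u <= W} ->
  dis (hbd true u) W /\ fill X (act [fset u] W).

(** A minimal element of [S] consumes nothing that [S] produces, so it can be activated first; the
    rest is glued by induction on the cardinal. *)
Lemma glue_of_glue1 n : glue1_at n -> glue_at n.
Proof.
move=> g1 X W S sX; have [k] := ubnP #|` S|; elim: k W S => // k IH W S hk.
move=> fW fS gS; have [->|S0] := eqVneq S fset0.
  by rewrite /act !sbd0 fsetU0 fsetD0; split=> // y; rewrite in_fset0.
have [s sS smin] := minimal_ex (@tri_trans _ predT) (@glu_acy _ hP n) S0.
have ini : initial S [fset s].
  split=> [x|t x y tS]; rewrite !inE => /eqP -> // yt ys.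
  by case: (smin t tS); exact: tri_step yt ys.
have sW : {subset hbd false s <= W}.
  move=> y ys; apply: (initial_glues ini gS); rewrite sbdDP !sbd1 ys andbT.
  by apply/negP; exact: bd_dis ys.
have [d1 f1] := g1 X W s sX fW sW.
have [] := IH (act [fset s] W) (S `\` [fset s]) _ f1 _ (rest_glues fS ini gS).
- rewrite -ltnS; apply: leq_trans hk; apply: (fcard_lt (x := s)) => //.
    by move=> y; rewrite !inE => /andP[].
  by rewrite !inE eqxx.
- by apply: ffS fS => y; rewrite !inE => /andP[].
move=> d2 f2; split; last by rewrite (act_rest _ ini).
apply/disP => y; rewrite (fsetUDK ini.1) sbdU inE sbd1 => /orP[ys|yS] yW.
  by have := d1 y; rewrite ys yW.
have := d2 y; rewrite yS in_act yW /= andbT => /negPn; rewrite sbd1 => ys.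
by have := initial_rest ini y; rewrite yS sbd1 ys.
Qed.

Lemma glue1_0 : glue1_at 0.
Proof.
move=> X W u _ fW uW.
have uE : hbd false u = W := ff0 (glu_ff hP u false) fW uW.
have d : dis (hbd true u) W.
  by apply/disP => y yu; rewrite -uE => yu'; exact: bd_dis yu' yu.
split=> //; suff -> : act [fset u] W = hbd true u by exact: (glu_ff hP u true).
apply/fsetP => y; rewrite in_act !sbd1 uE; have := d y; mem_cases.
Qed.

Lemma glue1_S n : glue_at n -> glue1_at n.+1.
Proof.
move=> glue X W u sX fW uW; have nr := no_revisit_of_glue glue.
have [s0 fX] := sX; have [ffW mW] := fW.
set N := hbd false u in uW *; set M := hbd true u.
have seg := glu_seg hP sX fW uW; rewrite -/N in seg.
(* The elements outside [N] that precede one of [N]. The segment condition makes [U], and then [U]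
   with [N], initial, so that the lower boundary runs through [U], then [N], then the rest [V]. *)
pose U := [fset y in W | (y \notin N) && `[< exists2 w, w \in N & tri [in W] y w >]].
pose V := (W `\` U) `\` N.
have step t s y : t \in W -> s \in W -> y \in hbd true t ->
    y \in hbd false s -> tri [in W] t s.
  by move=> tW sW yt ys; apply: t_step; split=> //; exact: hstepP yt ys.
have inU y : y \in U <-> [/\ y \in W, y \notin N &
    exists2 w, w \in N & tri [in W] y w].
  rewrite in_fset; split.
    by move=> /andP[yW /andP[yN /asboolP h]].
  by move=> [yW yN h]; rewrite inE; apply/andP; split=> //; rewrite yN /=; apply/asboolP.
have iU : initial W U.
  split=> [y /inU[] //|t s y tW /inU[sW sN [w wN sw]] yt ys].
  have ts := step _ _ _ tW sW yt ys.
  apply/inU; split=> //; last by exists w => //; exact: tri_trans ts sw.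
  by apply/negP => tN; case/negP: sN; exact: seg tN wN ts sw.
have iUN : initial W (U `|` N).
  split=> [y|t s y tW]; first by rewrite in_fsetU => /orP[/inU[] //|]; exact: uW.
  rewrite !in_fsetU => h yt ys; have [tN|tN] := boolP (t \in N).
    by rewrite orbT.
  rewrite orbF; apply/inU; split=> //; case/orP: h => [/inU|sN].
    move=> [sW sN [w wN sw]]; exists w => //; apply: tri_trans sw.
    exact: step yt ys.
  by exists s => //; apply: step yt ys => //; exact: uW.
have dUN : dis U N by apply/disP => y /inU[_ /negP].
set x := X n false in mW; pose A := act U x; pose B := act N A.
have gW : glues W x := moves_sub mW.
have gU : glues U x := initial_glues iU gW.
have ffU' : fork_free U := ffS iU.1 ffW.
have [dU fA] := glue X x U s0 (fX false) ffU' gU.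
have gWU : glues (W `\` U) A := rest_glues ffW iU gW.
have iN : initial (W `\` U) N := initialD iU iUN dUN.
have gN : glues N A := initial_glues iN gWU.
have ffWU : fork_free (W `\` U).
  by apply: ffS ffW => y; rewrite in_fsetD => /andP[].
have ffN : fork_free N := glu_ff hP u false.
have ffM : fork_free M := glu_ff hP u true.
have [dN fB] := glue X A N s0 fA ffN gN.
have gV : glues V B := rest_glues ffWU iN gWU.
have ffV : fork_free V by apply: ffS ffWU => y; rewrite /V in_fsetD => /andP[].
have [dV _] := glue X B V s0 fB ffV gV.
have eV : X n true = act V B.
  by rewrite (moves_act mW) (act_rest _ iU) (act_rest _ iN).
have glob e : sbdD e N = sbdD e M := glu_glob hP u e.
(* By globularity [M] needs and yields the same as [N], so it can replace [N] between [A] and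
   [B]. *)
have gM : glues M A by rewrite /glues -glob.
have [dM _] := glue X A M s0 fA ffM gM.
have eM : act M A = B by apply/esym/act_eq.
have [d1 d2 d3] := nr X x U M s0 (fX false) ffU' gU ffM gM.
have mU : moves U x A := act_moves gU dU.
have mM : moves M A B by rewrite -eM; exact: act_moves gM dM.
have mUM : moves (U `|` M) x B := moves_comp mU mM d1.
have ffUM : fork_free (U `|` M) by apply: ffU => // -[].
have gV' : glues V (act (U `|` M) x) by rewrite -(moves_act mUM).
have [d4 d5 d6] := nr X x (U `|` M) V s0 (fX false) ffUM (moves_sub mUM) ffV gV'.
have mV : moves V B (X n true) by rewrite eV; exact: act_moves gV dV.
(* Non-emptiness of sources turns disjointness of consumed sets into disjointness of the sets
   themselves. *)
have ne (y : P n.+1) : exists z, z \in hbd false y.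
  exact/fset0Pn/(glu_ne hP).
have inW y : y \in W -> y \in U \/ (y \in N \/ y \in V).
  by move=> yW; rewrite /V !in_fsetD yW andbT; case: (y \in U); case: (y \in N); auto.
split.
  apply/disP => y yM /inW[yU|[yN|yV]].
  - have [z zy] := ne y; have := d2 z.
    by rewrite (mem_sbd yU zy) (mem_sbd yM zy).
  - exact: bd_dis yN yM.
  - have [z zy] := ne y; have := d5 z.
    by rewrite sbdU in_fsetU (mem_sbd yV zy) (mem_sbd yM zy) orbT.
suff -> : act [fset u] W = (U `|` M) `|` V.
  split; first by apply: ffU => // -[].
  exact: moves_comp mUM mV d4.
apply/fsetP => y; rewrite in_act !sbd1 -/N -/M.
have := dUN y; have := iU.1 y; have := uW y; have := @bd_dis _ u y.
rewrite -/N -/M !(in_fsetU, in_fsetD).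
clear; case: (y \in M); case: (y \in N); case: (y \in U); case: (y \in W) => //=;
  rewrite /is_true; intuition congruence.
Qed.

Lemma glue n : glue_at n.
Proof.
by elim: n => [|n IH]; apply: glue_of_glue1; [exact: glue1_0|exact: glue1_S].
Qed.

Lemma no_revisit n : no_revisit_at n.
Proof. exact: no_revisit_of_glue (@glue n). Qed.

End Gluing.

(** * Reversal of signs *)

Section Reversal.

Variable P : hypergraph.

(** Reversing signs exchanges the two ends of every movement and reverses the order, so that
    backward gluing in [P] is forward gluing in [opp]. *)
Definition opp : hypergraph := @Hypergraph P (fun n e u => hbd (~~ e) u).

Definition oppf (X : fam P) : fam opp := fun j e => X j (~~ e).

Definition unoppf (X : fam opp) : fam P := fun j e => X j (~~ e).

Lemma opp_tri n (U : pred (P n)) u v : @tri opp n U u v -> tri U v u.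
Proof.
elim=> {u v} [x y [Ux Uy h]|x y z _ h1 _ h2]; last exact: t_trans h2 h1.
apply: t_step; split=> //; case: n U x y {Ux Uy} h => // n U x y.
by rewrite /= fsetIC.
Qed.

Lemma opp_ff n (U : {fset P n}) : fork_free U <-> @fork_free opp n U.
Proof.
case: n U => // n U; split=> h u v uU vU uv e; first exact: h.
by have := h u v uU vU uv (~~ e); rewrite /= negbK.
Qed.

Lemma opp_moves n (M : {fset P n.+1}) (U V : {fset P n}) :
  moves M U V <-> @moves opp n M V U.
Proof. by split=> -[]. Qed.

Lemma opp_fill n (X : fam opp) (W : {fset P n}) :
  @fill opp n X W -> @fill P n (unoppf X) W.
Proof.
case: n W => [|n] W; first exact.
by move=> [h1 [h2 h3]]; split; [exact: (opp_ff W).2 h1|split].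
Qed.

Lemma fill_opp n (X : fam P) (W : {fset P n}) :
  fill X W -> @fill opp n (oppf X) W.
Proof.
case: n W => [|n] W; first exact.
by move=> [h1 [h2 h3]]; split; [exact: (opp_ff W).1 h1|split].
Qed.

Lemma opp_sph n (X : fam opp) : @sph opp n X -> @sph P n (unoppf X).
Proof.
elim: n => //= n IH [h1 h2]; split; first exact: IH.
by move=> e; exact: opp_fill (h2 (~~ e)).
Qed.

Lemma sph_opp n (X : fam P) : sph n X -> @sph opp n (oppf X).
Proof.
elim: n => //= n IH [h1 h2]; split; first exact: IH.
by move=> e; exact: fill_opp (h2 (~~ e)).
Qed.

Lemma opp_gluable : gluable P -> gluable opp.
Proof.
case=> h1 h2 h3 h4 h5; split.
- by move=> n u e; exact: h1.
- by move=> n u /opp_tri; exact: h2.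
- by move=> n u e; apply/opp_ff/h3.
- by move=> n u e; have := h4 n u (~~ e); rewrite /sbdD /sbd /=.
- move=> n u e X W sX fX uW u1 u2 u3 m1 m3 /opp_tri t1 /opp_tri t2.
  exact: h5 (opp_sph sX) (opp_fill fX) uW _ _ _ m3 m1 t2 t1.
Qed.

End Reversal.

(** * Supports of cells, and composites of cells *)

Section Cells.

Variable P : hypergraph.
Hypothesis hP : gluable P.
Implicit Types X Y : fam P.

Definition bact n (S : {fset P n.+1}) (W : {fset P n}) : {fset P n} :=
  (W `|` sbd false S) `\` sbd true S.

Lemma moves_bact n (S : {fset P n.+1}) (U V : {fset P n}) :
  moves S U V -> U = bact S V.
Proof. by case. Qed.

Lemma glue_back n X (W : {fset P n}) S : sph n X -> fill X W ->
  fork_free S -> {subset sbdD true S <= W} ->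
  fill X (bact S W) /\ moves S (bact S W) W.
Proof.
move=> sX fX ffS gS.
have [|d /opp_fill f] :=
  glue (opp_gluable hP) (sph_opp sX) (fill_opp fX) ((opp_ff S).1 ffS) _ => //.
split; first by apply: eq_fill f => j e _; rewrite /unoppf /oppf negbK.
by apply/opp_moves/act_moves.
Qed.

Lemma glue_moves n X (W : {fset P n}) S : sph n X -> fill X W ->
  fork_free S -> glues S W -> fill X (act S W) /\ moves S W (act S W).
Proof.
move=> sX fX ffS gS; have [d f] := glue hP sX fX ffS gS.
by split=> //; exact: act_moves.
Qed.

Definition fcell n (X : fam P) : Prop :=
  [/\ sph n.+1 X, X n false = X n true & forall j e, n < j -> X j e = fset0].

(** The support of a cell: its elements and all their iterated faces, including those that are
    produced and consumed inside the cell and appear in no component. *)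
Inductive clo n (X : fam P) : forall l, P l -> Prop :=
| clo_in l e (y : P l) : l <= n -> y \in X l e -> clo n X y
| clo_bd l e (s : P l.+1) (y : P l) : clo n X s -> y \in hbd e s -> clo n X y.

(** Every element of the support is present at some stage of the passage from a source to a target,
    hence in a set that completes the lower components to a cell. For a face of [s] one stops just
    after [s] if [e] is [true], and just before [s] otherwise. *)
Lemma clo_fill n X l (y : P l) : sph n.+1 X -> clo n X y ->
  l <= n /\ exists2 W, fill X W & y \in W.
Proof.
move=> sX; elim=> {l y} [l e y ln yX|l e s y _ [ln [W [ffW mW] sW]] ys].
  by split=> //; exists (X l e) => //; exact: (sph_fill _ _ sX).
split; first exact: ltnW.
pose le (a b : P l.+1) := a = b \/ tri predT a b.
pose R t := if e then le t s else tri predT t s.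
pose S := [fset t in W | `[< R t >]].
have stepR t u z : z \in hbd true t -> z \in hbd false u -> le u s ->
    tri predT t s.
  by move=> h1 h2 [<-|h3]; [|apply: tri_trans h3]; apply: tri_step h1 h2.
have Rle t : R t -> le t s by rewrite /R; case: (e) => // h; right.
have leR t : tri predT t s -> R t by rewrite /R; case: (e) => // h; right.
have ini : initial W S.
  split=> [t|t u z tW]; rewrite !inE; first by case/andP.
  move=> /andP[uW /asboolP Ru] zt zu; rewrite tW /=; apply/asboolP/leR.
  by apply: stepR zt zu _; exact: Rle.
have gS := initial_glues ini (moves_sub mW).
have sl : sph l X by apply: (sph_le _ sX); apply: ltnW; apply: ltnW.
have fl : fill X (X l false) by apply: (sph_fill _ _ sX); exact: ltnW.
have [f _] := glue_moves sl fl (ffS ini.1 ffW) gS.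
exists (act S (X l false)) => //.
case: e ys @R @S stepR Rle leR ini gS f => ys R S stepR Rle leR ini gS f.
  rewrite in_act; apply/andP; split.
    apply/negP => /sbdP[t]; rewrite in_fset => /andP[_ /asboolP ts] yt.
    by apply: (glu_acy hP (u := s)); exact: stepR ys yt ts.
  apply/orP; right; apply: (mem_sbd _ ys); rewrite !inE sW /=.
  by apply/asboolP; left.
apply: (rest_glues ffW ini (moves_sub mW)); rewrite sbdDP; apply/andP; split.
  apply/negP => /sbdP[t]; rewrite in_fsetD => /andP[/negP h tW] yt.
  apply: h; rewrite !inE tW /=; apply/asboolP.
  by apply: stepR yt ys _; left.
apply: (mem_sbd _ ys); rewrite in_fsetD sW andbT !inE sW /=.
by apply/negP => /asboolP; exact: glu_acy.
Qed.

Definition fcmp i (X Y : fam P) : Prop :=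
  (forall j e, j < i -> X j e = Y j e) /\ X i true = Y i false.

Definition fcomp i (X Y : fam P) : fam P := fun j e =>
  if j < i then X j e
  else if j == i then (if e then Y j true else X j false)
  else X j e `|` Y j e.

Lemma nr_fill n X Y i (S T : {fset P i.+1}) : i < n -> sph n X -> sph n Y ->
  fcmp i X Y -> fill X S -> fill Y T ->
  [/\ dis (sbd false S) (sbd true T),
      dis (sbd false S) (sbd false T) & dis (sbd true S) (sbd true T)].
Proof.
move=> ln sX sY [c1 c2] [fS mS] [fT mT].
apply: (no_revisit hP (X := X) (W := X i false)) => //.
- by apply: sph_le sX; exact: ltnW.
- exact: sph_fill sX.
- exact: moves_sub mS.
- by rewrite -(moves_act mS) c2; exact: moves_sub mT.
Qed.

(** Non-empty sources bring a common element down to dimension [i.+1]. There it lies in two sets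
    that fill the spheres of [X] and of [Y] and can be activated in succession; by [no_revisit]
    these consume disjoint sets. *)
Lemma clo_dis n X Y i l (y : P l) : i < n -> sph n.+1 X -> sph n.+1 Y ->
  fcmp i X Y -> i < l -> clo n X y -> clo n Y y -> False.
Proof.
move=> ln sX sY c il; move: y; rewrite -(subnK il).
elim: (l - i.+1) => [|d IH] y.
  move=> /(clo_fill sX) [_ [S fS yS]] /(clo_fill sY) [_ [T fT yT]].
  have [_ d _] := nr_fill (leqW ln) sX sY c fS fT.
  have /fset0Pn[z zy] := glu_ne hP y false.
  by have := d z; rewrite (mem_sbd yS zy) (mem_sbd yT zy).
have /fset0Pn[z zy] := glu_ne hP y false.
by move=> h1 h2; apply: (IH z); apply: clo_bd zy.
Qed.

Lemma sbd_clo n X l e e' (y : P l) : l < n -> y \in sbd e (X l.+1 e') ->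
  clo n X y.
Proof. by move=> ln /sbdP[s sX ys]; apply: clo_bd ys; apply: clo_in sX. Qed.

Lemma comp_dis n X Y i l e1 e2 : i < n -> sph n.+1 X -> sph n.+1 Y ->
  fcmp i X Y -> i < l -> l <= n -> dis (X l e1) (Y l e2).
Proof.
move=> ln sX sY c il h; apply/disP => y yX yY.
by apply: (clo_dis ln sX sY c il); [apply: clo_in yX|apply: clo_in yY].
Qed.

(** The excluded signs are those of an element produced by [X] and consumed by [Y], the only contact
    possible when [l = i]. *)
Lemma comp_sbd_dis n X Y i l e e' e1 e2 : i < n -> sph n.+1 X -> sph n.+1 Y ->
  fcmp i X Y -> i <= l -> l < n -> e ==> e' ->
  dis (sbd e (X l.+1 e1)) (sbd e' (Y l.+1 e2)).
Proof.
move=> ln sX sY c; rewrite leq_eqVlt => /orP[/eqP il h|il h].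
  subst l.
  have fX : fill X (X i.+1 e1) by exact: sph_fill sX.
  have fY : fill Y (Y i.+1 e2) by exact: sph_fill sY.
  by have [h1 h2 h3] := nr_fill (leqW ln) sX sY c fX fY; case: e; case: e'.
by move=> _; apply/disP => y yX yY; apply: (clo_dis ln sX sY c il); apply: sbd_clo; eauto.
Qed.

Lemma fcomp_lt i X Y j e : j < i -> fcomp i X Y j e = X j e.
Proof. by rewrite /fcomp => ->. Qed.

Lemma fcomp_eq i X Y e : fcomp i X Y i e = if e then Y i true else X i false.
Proof. by rewrite /fcomp ltnn eqxx. Qed.

Lemma fcomp_gt i X Y j e : i < j -> fcomp i X Y j e = X j e `|` Y j e.
Proof. by move=> h; rewrite /fcomp ltnNge (ltnW h) gtn_eqF. Qed.

(** On the boundaries of dimension [i] the two movements are consecutive; on those above [i] they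
    are independent, because the supports are disjoint. *)
Lemma fcomp_cell n X Y i : i < n -> fcell n X -> fcell n Y -> fcmp i X Y ->
  fcell n (fcomp i X Y).
Proof.
move=> ln [sX tX oX] [sY tY oY] c; have [c1 c2] := c; split; first last.
- move=> j e nj; rewrite fcomp_gt; last exact: ltn_trans nj.
  by rewrite oX // oY // fsetU0.
- by rewrite !fcomp_gt // tX tY.
apply: sphP => [l e|l e]; rewrite ltnS => hl.
  have mX e' := @sph_moves _ _ _ _ e' (hl : l.+1 < n.+1) sX.
  have mY e' := @sph_moves _ _ _ _ e' (hl : l.+1 < n.+1) sY.
  have [li|li|li] := ltngtP l i.
  - rewrite !(fcomp_lt _ _ _ li); move: (li); rewrite leq_eqVlt.
    move=> /orP[/eqP h|h]; last by rewrite fcomp_lt.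
    subst i; rewrite fcomp_eq; case: e; last exact: mX.
    by rewrite !c1.
  - rewrite !fcomp_gt //; last exact: ltnW.
    by apply: moves_union => //; apply/disP => y yX;
      rewrite in_fsetU => /orP[] yY; apply: (clo_dis (y := y) ln sX sY c li);
      first [exact: (sbd_clo hl yX)|exact: (sbd_clo hl yY)
            |exact: (clo_in (ltnW hl) yX)|exact: (clo_in (ltnW hl) yY)].
  - subst l; rewrite fcomp_gt // !fcomp_eq; apply: moves_comp (mX e) _ _.
      by rewrite c2.
    exact: (comp_sbd_dis _ _ ln sX sY c (leqnn i) hl).
have [li|li|li] := ltngtP l i.
- by rewrite fcomp_lt //; apply: sph_ff sX.
- rewrite fcomp_gt //; case: l hl li => // l hl li.
  apply: ffU; [exact: sph_ff sX|exact: sph_ff sY|move=> e'].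
  by apply: (comp_sbd_dis _ _ ln sX sY c li hl); case: e'.
- by rewrite li fcomp_eq; rewrite li in hl; case: e; [exact: sph_ff sY|exact: sph_ff sX].
Qed.

End Cells.

(** * Splitting cells *)

Section Splitting.

Variable P : hypergraph.
Hypothesis hP : gluable P.
Implicit Types X Y Z A B C D : fam P.

Lemma fam_eq X Y : (forall j e, X j e = Y j e) -> X = Y.
Proof.
by move=> h; apply: functional_extensionality_dep => j; apply: funext => e.
Qed.

Definition sel (f : forall l, P l -> bool) l (S : {fset P l}) : {fset P l} :=
  [fset y in S | f l y].

Lemma in_sel f l (S : {fset P l}) y : (y \in sel f S) = (y \in S) && f l y.
Proof. by rewrite !inE. Qed.

Lemma sel_sub f l (S : {fset P l}) : {subset sel f S <= S}.
Proof. by move=> y; rewrite in_sel => /andP[]. Qed.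

(** Selection then commutes with boundaries, so that the selected elements and the others move
    independently. *)
Definition faces_agree (f : forall l, P l -> bool) l (S : {fset P l.+1}) :
  Prop := forall s e y, s \in S -> y \in hbd e s -> f l y = f l.+1 s.

Lemma sbd_sel f l (S : {fset P l.+1}) e y : faces_agree f S ->
  (y \in sbd e (sel f S)) = (y \in sbd e S) && f l y.
Proof.
move=> h; apply/sbdP/andP.
  move=> [s]; rewrite in_sel => /andP[sS fs] ys.
  by rewrite (mem_sbd sS ys) (h s e y).
move=> [/sbdP[s sS ys] fy]; exists s => //.
by rewrite in_sel sS -(h s e y).
Qed.

Lemma moves_sel f l (S : {fset P l.+1}) U V : faces_agree f S ->
  moves S U V -> moves (sel f S) (sel f U) (sel f V).
Proof.
move=> h /movesP m; apply/movesP => y; have [] := m y.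
rewrite !sbd_sel // !in_sel; case: (f l y); last by rewrite !andbF.
by rewrite !andbT.
Qed.

Lemma fsetU_sel f l (S : {fset P l}) :
  S = sel f S `|` sel (fun l y => ~~ f l y) S.
Proof.
by apply/fsetP => y; rewrite in_fsetU !in_sel; case: (f l y); case: (y \in S).
Qed.

(* The complement of a glued part is again glued, so by [no_revisit] it does
   not produce what the part consumes. *)
Lemma rest_moves n X (S T R : {fset P n.+1}) U V M : sph n X -> fill X U ->
  S = T `|` R -> dis T R -> fork_free S -> moves S U V -> moves T U M ->
  moves R M V.
Proof.
move=> sX fU eS dTR fS mS mT.
have ffT : fork_free T by apply: ffS fS => y; rewrite eS in_fsetU => ->.
have ffR : fork_free R.
  by apply: ffS fS => y; rewrite eS in_fsetU => ->; rewrite orbT.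
have d e : dis (sbd e T) (sbd e R).
  apply/disP => y /sbdP[t tT yt] /sbdP[r rR yr].
  have tr : t = r by apply: (ff_eq fS _ _ yt yr); rewrite eS in_fsetU ?tT ?rR ?orbT.
  by have := dTR r; rewrite rR -tr tT.
have gR : glues R M.
  move=> y; rewrite sbdDP => /andP[yR yR'].
  have gS : glues S U := moves_sub mS.
  have := gS y; have /movesP/(_ y)[_] := mT.
  rewrite sbdDP eS !sbdU !in_fsetU (negPf yR) yR' /= orbF orbT andbT.
  have := d false y; rewrite yR' andbT => /negPf -> ->.
  by case: (y \in sbd true T) => [_|->]; rewrite ?orbT.
have [d1 _ _] := no_revisit hP sX fU ffT (moves_sub mT) ffR
  (eq_ind _ (fun W => glues R W) gR _ (moves_act mT)).
have [_] := glue_moves hP sX (glue hP sX fU ffT (moves_sub mT)).2 ffR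
  (eq_ind _ (fun W => glues R W) gR _ (moves_act mT)).
by rewrite -act_union // -eS -(moves_act mS) -(moves_act mT).
Qed.

(** Initiality for one sign [e0] is enough to construct the intermediate boundary of dimension [i];
    the other sign is handled through the movement of the selected parts one dimension up. *)
Lemma split_cell n i e0 f X : i < n -> fcell n X ->
  (forall l e, i < l -> l < n -> faces_agree f (X l.+1 e)) ->
  initial (X i.+1 e0) (sel f (X i.+1 e0)) ->
  exists A B, [/\ fcell n A, fcell n B, fcmp i A B, X = fcomp i A B
    & forall l e, i < l ->
      A l e = sel f (X l e) /\ B l e = sel (fun l y => ~~ f l y) (X l e)].
Proof.
move=> ln [sX tX oX] agr ini.
pose g l y := ~~ f l y.
have agr' l e : i < l -> l < n -> faces_agree g (X l.+1 e).
  by move=> il hl s e' y sX' ys; rewrite /g (agr l e il hl s e' y).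
have si : sph i X by apply: sph_le sX; apply: ltnW; apply: ltnW.
have fi e : fill X (X i e) by apply: sph_fill sX; apply: ltnW.
have mi e : moves (X i.+1 e) (X i false) (X i true).
  by apply: sph_moves sX.
have ffX l e : l <= n -> fork_free (X l e) by move=> h; apply: sph_ff sX.
pose S e := sel f (X i.+1 e).
have ffSl l e : fork_free (sel f (X l.+1 e)).
  have [h|h] := ltnP l n; first by apply: ffS (ffX _ e h); exact: sel_sub.
  by rewrite oX // => u v; rewrite in_sel.
have ffRl l e : fork_free (sel g (X l.+1 e)).
  have [h|h] := ltnP l n; first by apply: ffS (ffX _ e h); exact: sel_sub.
  by rewrite oX // => u v; rewrite in_sel.
pose M := act (S e0) (X i false).
have [fM mM] : fill X M /\ moves (S e0) (X i false) M.
  apply: (glue_moves hP si (fi false) (ffSl i e0)).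
  exact: initial_glues ini (moves_sub (mi e0)).
(* The middle boundary [M] is written with [l] in place of [i], which avoids a cast along
   [l == i]. *)
pose A : fam P := fun l e => if l < i then X l e else
  if l == i then (if e then act (sel f (X l.+1 e0)) (X l false) else X l false)
  else sel f (X l e).
pose B : fam P := fun l e => if l < i then X l e else
  if l == i then (if e then X l true else act (sel f (X l.+1 e0)) (X l false))
  else sel g (X l e).
have Alt l e : l < i -> A l e = X l e by rewrite /A => ->.
have Blt l e : l < i -> B l e = X l e by rewrite /B => ->.
have Ai e : A i e = if e then M else X i false by rewrite /A ltnn eqxx.
have Bi e : B i e = if e then X i true else M by rewrite /B ltnn eqxx.
have Agt l e : i < l -> A l e = sel f (X l e).
  by move=> h; rewrite /A ltnNge (ltnW h) gtn_eqF.
have Bgt l e : i < l -> B l e = sel g (X l e).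
  by move=> h; rewrite /B ltnNge (ltnW h) gtn_eqF.
have mgt l e : i < l -> l < n ->
    moves (sel f (X l.+1 e)) (sel f (X l false)) (sel f (X l true)).
  by move=> il hl; apply: moves_sel; [exact: agr|exact: sph_moves sX].
have mgt' l e : i < l -> l < n ->
    moves (sel g (X l.+1 e)) (sel g (X l false)) (sel g (X l true)).
  by move=> il hl; apply: moves_sel; [exact: agr'|exact: sph_moves sX].
have sA : sph i.+1 A.
  split; first by apply: eq_sph si => l e h; rewrite Alt.
  move=> e; have : fill X (A i e) by rewrite Ai; case: e.
  by apply: eq_fill => l e' h; rewrite Alt.
(* For [i.+1 = n] the two signs give the same set. Otherwise the selected part of dimension [i.+2]
   moves one to the other, and gluing along it, forwards or backwards, transfers [fill]. *)
have fS e : fill A (S e).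
  have fS0 : fill A (S e0) by split; [exact: ffSl|rewrite !Ai].
  have [->//|ee] := eqVneq e e0.
  move: (ln); rewrite leq_eqVlt => /orP[/eqP h|h].
    suff -> : S e = S e0 by [].
    move: tX; rewrite -h /S => tX; congr sel.
    by case: (e) (e0) => -[].
  have mS := mgt i.+1 true (leqnn _) h; rewrite -/(S _) -/(S _) in mS.
  have [e0t|e0t] := boolP e0.
    have [|fB _] := glue_back hP sA fS0 (ffSl i.+1 true).
      by rewrite e0t; exact: moves_subr mS.
    move: fB; rewrite e0t -(moves_bact mS).
    by suff -> : e = false by []; move: ee; rewrite e0t; case: (e).
  have e0f : e0 = false by apply/negbTE.
  have [|fB _] := glue_moves hP sA fS0 (ffSl i.+1 true).
    by rewrite e0f; exact: moves_sub mS.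
  move: fB; rewrite e0f -(moves_act mS).
  by suff -> : e = true by []; move: ee; rewrite e0f; case: (e).
have mS e : moves (S e) (X i false) M by have [_] := fS e; rewrite !Ai.
have mR e : moves (sel g (X i.+1 e)) M (X i true).
  apply: (rest_moves si (fi false) (fsetU_sel f _)) (mi e) (mS e).
    by move=> y; rewrite !in_sel; case: (f _ _); rewrite ?andbF.
  by apply: ffX.
have ffM : fork_free M := fill_ff fM.
exists A, B; split.
- split; first last.
  + move=> l e nl; rewrite Agt; last exact: ltn_trans nl.
    by rewrite oX //; apply/fsetP => y; rewrite in_sel.
  + by rewrite !Agt // tX.
  apply: sphP => l e; rewrite ltnS => hl.
    have [li|li|li] := ltngtP l i.
    - rewrite !(Alt l) //; have [li'|li'|li'] := ltngtP l.+1 i.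
      + by rewrite Alt //; exact: sph_moves sX.
      + by move: li'; rewrite ltnS leqNgt li.
      + subst i; rewrite Ai; have [_ h1] := fM; have [_ h2] := fi false.
        by case: e.
    - by have il : i < l.+1 := leqW li; rewrite !Agt //; exact: mgt.
    - by subst l; rewrite Agt // !Ai; exact: mS.
  have [li|li|li] := ltngtP l i.
  - by rewrite Alt //; apply: ffX.
  - by rewrite Agt //; case: l hl li.
  - by subst l; rewrite Ai; case: e => //; apply: ffX.
- split; first last.
  + move=> l e nl; rewrite Bgt; last exact: ltn_trans nl.
    by rewrite oX //; apply/fsetP => y; rewrite in_sel.
  + by rewrite !Bgt // tX.
  apply: sphP => l e; rewrite ltnS => hl.
    have [li|li|li] := ltngtP l i.
    - rewrite !(Blt l) //; have [li'|li'|li'] := ltngtP l.+1 i.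
      + by rewrite Blt //; exact: sph_moves sX.
      + by move: li'; rewrite ltnS leqNgt li.
      + subst i; rewrite Bi; have [_ h1] := fM; have [_ h2] := fi true.
        by case: e.
    - by have il : i < l.+1 := leqW li; rewrite !Bgt //; exact: mgt'.
    - by subst l; rewrite Bgt // !Bi; exact: mR.
  have [li|li|li] := ltngtP l i.
  - by rewrite Blt //; apply: ffX.
  - by rewrite Bgt //; case: l hl li.
  - by subst l; rewrite Bi; case: e => //; apply: ffX.
- by split; [move=> l e h; rewrite Alt // Blt|rewrite Ai Bi].
- apply: fam_eq => l e; have [li|li|li] := ltngtP l i.
  + by rewrite fcomp_lt // Alt.
  + by rewrite fcomp_gt // Agt // Bgt // -fsetU_sel.
  + by subst l; rewrite fcomp_eq Ai Bi; case: e.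
- by move=> l e h; rewrite Agt // Bgt.
Qed.

Definition inb (l : nat) n X (y : P l) : bool := `[< clo n X y >].

Lemma inbP l n X (y : P l) : reflect (clo n X y) (inb n X y).
Proof. exact: asboolP. Qed.

(** The predicate is membership in the support of [X1]. It passes to faces because the supports are
    disjoint, and the selected part is initial because [X2] never produces what [X1] consumes. *)
Lemma split_along n j X1 X2 (V : fam P) : j < n -> fcell n X1 -> fcell n X2 ->
  fcmp j X1 X2 -> fcell n V ->
  (forall l e (y : P l), j < l -> y \in V l e -> clo n X1 y \/ clo n X2 y) ->
  (exists e0, forall y, y \in V j.+1 e0 ->
     (exists e, y \in X1 j.+1 e) \/ (exists e, y \in X2 j.+1 e)) ->
  exists A B, [/\ fcell n A, fcell n B, fcmp j A B, V = fcomp j A B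
    & forall l e, j < l ->
      A l e = sel (fun l y => inb n X1 y) (V l e) /\
      B l e = sel (fun l y => ~~ inb n X1 y) (V l e)].
Proof.
move=> ln [s1 t1 o1] [s2 t2 o2] c cV hV [e0 he0].
have dis12 l (y : P l) : j < l -> clo n X1 y -> clo n X2 y -> False.
  by move=> jl; exact: (clo_dis hP ln s1 s2 c jl).
apply: (split_cell (e0 := e0)) => //.
  move=> l e jl hl s e' y sV ys.
  case: (hV _ _ _ (leqW jl) sV) => hs.
    by apply/inbP/inbP => _ //; exact: clo_bd hs ys.
  transitivity false; first by apply/inbP => /dis12; apply => //; exact: clo_bd hs ys.
  by apply/esym/inbP => /dis12; apply => //; exact: leqW.
split; first exact: sel_sub.
move=> t s y tV; rewrite !in_sel => /andP[sV /inbP cs] yt ys; rewrite tV /=.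
apply/inbP; case: (he0 _ tV) => -[e te]; first exact: clo_in te.
case: (he0 _ sV) => -[e' se'].
  have := comp_sbd_dis hP e' e ln s1 s2 c (leqnn j) ln (isT : false ==> true) y.
  by rewrite (mem_sbd se' ys) (mem_sbd te yt).
by case: (dis12 _ s); rewrite // ; apply: clo_in se'.
Qed.

Lemma det_true n i X Y e : i < n -> fcell n X -> fcell n Y ->
  X i.+1 e = Y i.+1 e -> X i false = Y i false -> X i true = Y i true.
Proof.
move=> ln [sX _ _] [sY _ _] h1 h2.
by rewrite (moves_act (sph_moves e _ sX)) // (moves_act (sph_moves e _ sY)) // h1 h2.
Qed.

Lemma det_false n i X Y e : i < n -> fcell n X -> fcell n Y ->
  X i.+1 e = Y i.+1 e -> X i true = Y i true -> X i false = Y i false.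
Proof.
move=> ln [sX _ _] [sY _ _] h1 h2.
by rewrite (moves_bact (sph_moves e _ sX)) // (moves_bact (sph_moves e _ sY)) // h1 h2.
Qed.

End Splitting.

(** * Common refinements of decompositions *)

Section Refinement.

Variable P : hypergraph.
Hypothesis hP : gluable P.
Implicit Types X Y Z A B C D : fam P.

Lemma in_fcomp i X Y l e y : i < l ->
  (y \in fcomp i X Y l e) = (y \in X l e) || (y \in Y l e).
Proof. by move=> h; rewrite fcomp_gt // in_fsetU. Qed.

Lemma clo_fcomp n i X Y l (y : P l) : i < l -> clo n (fcomp i X Y) y ->
  clo n X y \/ clo n Y y.
Proof.
move=> il cy; elim: cy il => {l y} [l e y ln yX|l e s y _ IH ys] il.
  by move: yX; rewrite in_fcomp // => /orP[] h; [left|right]; apply: clo_in h.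
by case: (IH (leqW il)) => h; [left|right]; apply: clo_bd ys.
Qed.

Lemma fcell_le n X l e y : fcell n X -> y \in X l e -> l <= n.
Proof. by move=> [_ _ oX] yX; rewrite leqNgt; apply/negP => /(oX l e) h; rewrite h in yX. Qed.

Lemma clo_cell n X l e y : fcell n X -> y \in X l e -> clo n X y.
Proof. by move=> cX yX; apply: (clo_in (fcell_le cX yX) yX). Qed.

Lemma clo_disj n i X Y l (y : P l) : i < n -> fcell n X -> fcell n Y ->
  fcmp i X Y -> i < l -> clo n X y -> clo n Y y -> False.
Proof. by move=> ln [sX _ _] [sY _ _] c il; exact: (clo_dis hP ln sX sY c il). Qed.

Lemma sel_fst n i X Y l e : i < n -> fcell n X -> fcell n Y -> fcmp i X Y ->
  i < l -> sel (fun l y => inb n X y) (fcomp i X Y l e) = X l e.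
Proof.
move=> ln cX cY c il; apply/fsetP => y; rewrite in_sel in_fcomp //.
apply/andP/idP => [[/orP[//|yY] /inbP yX]|yX].
  by case: (clo_disj ln cX cY c il yX (clo_cell cY yY)).
by rewrite yX; split=> //; apply/inbP; exact: clo_cell yX.
Qed.

Lemma sel_snd n i X Y l e : i < n -> fcell n X -> fcell n Y -> fcmp i X Y ->
  i < l -> sel (fun l y => ~~ inb n X y) (fcomp i X Y l e) = Y l e.
Proof.
move=> ln cX cY c il; apply/fsetP => y; rewrite in_sel in_fcomp //.
apply/andP/idP => [[/orP[yX|//] /inbP[]]|yY]; first exact: clo_cell yX.
rewrite yY orbT; split=> //; apply/inbP => yX.
by case: (clo_disj ln cX cY c il yX (clo_cell cY yY)).
Qed.

Lemma sel_union f l (S T : {fset P l}) : sel f (S `|` T) = sel f S `|` sel f T.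
Proof.
by apply/fsetP => y; rewrite !(in_sel, in_fsetU) andb_orl.
Qed.

(** [Y] and [Z] are both split along the supports of [X1] and [X2]. The pieces match in dimension
    [j] because a movement is determined by one of its ends. *)
Lemma refine_lt n j i X1 X2 Y Z : j < i -> i < n ->
  fcell n X1 -> fcell n X2 -> fcell n Y -> fcell n Z ->
  fcmp j X1 X2 -> fcmp i Y Z -> fcomp j X1 X2 = fcomp i Y Z ->
  exists Y1 Y2 Z1 Z2,
    [/\ [/\ fcell n Y1, fcell n Y2, fcell n Z1 & fcell n Z2],
        [/\ fcmp j Y1 Y2, fcmp j Z1 Z2, fcmp i Y1 Z1 & fcmp i Y2 Z2],
        Y = fcomp j Y1 Y2 /\ Z = fcomp j Z1 Z2
      & X1 = fcomp i Y1 Z1 /\ X2 = fcomp i Y2 Z2].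
Proof.
move=> ji li c1 c2 cY cZ f12 fYZ eX.
have lj : j < n := ltn_trans ji li.
set X := fcomp j X1 X2 in eX.
have cX : fcell n X by exact: fcomp_cell.
have XE l e y : j < l -> y \in X l e -> clo n X1 y \/ clo n X2 y.
  by move=> jl yX; apply: (clo_fcomp jl); exact: clo_cell yX.
have Xlt l e : l < i -> Y l e = X l e /\ Z l e = X l e.
  by move=> h; rewrite eX fcomp_lt // (fYZ.1 l e h).
have YX l e y : i < l -> y \in Y l e -> y \in X l e.
  by move=> il yY; rewrite eX in_fcomp // yY.
have ZX l e y : i < l -> y \in Z l e -> y \in X l e.
  by move=> il yZ; rewrite eX in_fcomp // yZ orbT.
have Yi : Y i false = X i false by rewrite eX fcomp_eq.
have Zi : Z i true = X i true by rewrite eX fcomp_eq.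
(* The boundary between [Y] and [Z] is not a component of the composite, but its elements come from
   the source or are produced by [Y]. *)
have mid y : y \in Y i true -> clo n X1 y \/ clo n X2 y.
  have [sY _ _] := cY; rewrite (moves_act (sph_moves false _ sY)) //.
  rewrite in_act Yi => /andP[_ /orP[|/sbdP[s sY' ys]]]; first exact: XE.
  case: (XE i.+1 false s) => [||h|h]; first exact: leqW.
  - exact: YX sY'.
  - by left; exact: clo_bd ys.
  - by right; exact: clo_bd ys.
have YE l e y : j < l -> y \in Y l e -> clo n X1 y \/ clo n X2 y.
  move=> jl yY; have [il|il|il] := ltngtP l i.
  - by apply: (XE l e); rewrite // -(Xlt l e il).1.
  - by apply: (XE l e) => //; exact: YX.
  - by subst l; case: e yY; [exact: mid|rewrite Yi; exact: XE].
have ZE l e y : j < l -> y \in Z l e -> clo n X1 y \/ clo n X2 y.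
  move=> jl yZ; have [il|il|il] := ltngtP l i.
  - by apply: (XE l e); rewrite // -(Xlt l e il).2.
  - by apply: (XE l e) => //; exact: ZX.
  - by subst l; case: e yZ; [rewrite Zi; exact: XE|rewrite -fYZ.2; exact: mid].
(* If [j.+1 = i], only the source of [Y] and the target of [Z] are components of [X]; hence the
   different signs given to [split_along] below. *)
have Yj : Y j.+1 false = X j.+1 false.
  move: ji; rewrite leq_eqVlt => /orP[/eqP h|h]; last by rewrite (Xlt _ _ h).1.
  by rewrite h.
have Zj : Z j.+1 true = X j.+1 true.
  move: ji; rewrite leq_eqVlt => /orP[/eqP h|h]; last by rewrite (Xlt _ _ h).2.
  by rewrite h.
have jj : j < j.+1 := leqnn _.
have inX e y : y \in X j.+1 e ->
    (exists e, y \in X1 j.+1 e) \/ (exists e, y \in X2 j.+1 e).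
  by rewrite in_fcomp // => /orP[]; [left|right]; exists e.
have [||Y1 [Y2 [cY1 cY2 fY eY hY]]] := split_along hP lj c1 c2 f12 cY.
- exact: YE.
- by exists false => y; rewrite Yj; exact: inX.
have [||Z1 [Z2 [cZ1 cZ2 fZ eZ hZ]]] := split_along hP lj c1 c2 f12 cZ.
- exact: ZE.
- by exists true => y; rewrite Zj; exact: inX.
have X1j l e : j < l -> sel (fun l y => inb n X1 y) (X l e) = X1 l e.
  by move=> h; exact: sel_fst.
have X2j l e : j < l -> sel (fun l y => ~~ inb n X1 y) (X l e) = X2 l e.
  by move=> h; exact: sel_snd.
have lt1 l e : l < j -> [/\ Y1 l e = X1 l e, Y2 l e = X1 l e, Z1 l e = X1 l e &
    [/\ Z2 l e = X1 l e, Y l e = X1 l e & Z l e = X1 l e]].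
  move=> h; have [h1 h2] := Xlt l e (ltn_trans h ji).
  have e1 : X l e = X1 l e by rewrite /X fcomp_lt.
  have e2 : Y1 l e = Y l e by rewrite eY fcomp_lt.
  have e3 : Z1 l e = Z l e by rewrite eZ fcomp_lt.
  by rewrite -(fY.1 l e h) -(fZ.1 l e h) e2 e3 h1 h2 e1.
have Yjf : Y1 j false = X1 j false.
  by rewrite -(fcomp_eq j Y1 Y2 false) -eY (Xlt j false ji).1 /X fcomp_eq.
have Zjf : Z1 j false = X1 j false.
  by rewrite -(fcomp_eq j Z1 Z2 false) -eZ (Xlt j false ji).2 /X fcomp_eq.
have Yjt : Y2 j true = X2 j true.
  by rewrite -(fcomp_eq j Y1 Y2 true) -eY (Xlt j true ji).1 /X fcomp_eq.
have Zjt : Z2 j true = X2 j true.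
  by rewrite -(fcomp_eq j Z1 Z2 true) -eZ (Xlt j true ji).2 /X fcomp_eq.
have Y1j : Y1 j true = X1 j true.
  apply: (det_true (e := false) lj cY1 c1 _ Yjf).
  by rewrite (hY _ _ jj).1 Yj X1j.
have Z1j : Z1 j true = X1 j true.
  apply: (det_true (e := true) lj cZ1 c1 _ Zjf).
  by rewrite (hZ _ _ jj).1 Zj X1j.
have Y2j : Y2 j false = X2 j false by rewrite -fY.2 Y1j f12.2.
have Z2j : Z2 j false = X2 j false by rewrite -fZ.2 Z1j f12.2.
have mlt l e : j < l -> l < i -> [/\ Y1 l e = X1 l e, Z1 l e = X1 l e,
    Y2 l e = X2 l e & Z2 l e = X2 l e].
  move=> jl h; have [h1 h2] := Xlt l e h; have [h3 h4] := hY l e jl.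
  by have [h5 h6] := hZ l e jl; rewrite h3 h4 h5 h6 h1 h2 X1j // X2j.
exists Y1, Y2, Z1, Z2; split=> //.
- split=> //; split.
  + move=> l e h; have [jl|jl|jl] := ltngtP l j.
    * by have [-> _ ->] := lt1 l e jl.
    * by have [-> -> _ _] := mlt l e jl h.
    * by subst l; case: e; rewrite ?Y1j ?Z1j ?Yjf ?Zjf.
  + by rewrite (hY _ _ ji).1 (hZ _ _ ji).1 fYZ.2.
  + move=> l e h; have [jl|jl|jl] := ltngtP l j.
    * by have [_ -> _ [-> _ _]] := lt1 l e jl.
    * by have [_ _ -> ->] := mlt l e jl h.
    * by subst l; case: e; rewrite ?Y2j ?Z2j ?Yjt ?Zjt.
  + by rewrite (hY _ _ ji).2 (hZ _ _ ji).2 fYZ.2.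
- split; apply: fam_eq => l e; have [il|il|il] := ltngtP l i.
  + rewrite fcomp_lt //; have [jl|jl|jl] := ltngtP l j.
    * by have [-> _ _ _] := lt1 l e jl.
    * by have [-> _ _ _] := mlt l e jl il.
    * by subst l; case: e; rewrite ?Y1j ?Yjf.
  + have jl := ltn_trans ji il.
    rewrite fcomp_gt // (hY _ _ jl).1 (hZ _ _ jl).1 -sel_union.
    by rewrite -(fcomp_gt Y Z e il) -eX X1j.
  + subst l; rewrite fcomp_eq (hY _ _ ji).1 (hZ _ _ ji).1 Yi Zi.
    by case: e; rewrite X1j.
  + rewrite fcomp_lt //; have [jl|jl|jl] := ltngtP l j.
    * by have [_ -> _ _] := lt1 l e jl; rewrite (f12.1 l e jl).
    * by have [_ _ -> _] := mlt l e jl il.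
    * by subst l; case: e; rewrite ?Y2j ?Yjt.
  + have jl := ltn_trans ji il.
    rewrite fcomp_gt // (hY _ _ jl).2 (hZ _ _ jl).2 -sel_union.
    by rewrite -(fcomp_gt Y Z e il) -eX X2j.
  + subst l; rewrite fcomp_eq (hY _ _ ji).2 (hZ _ _ ji).2 Yi Zi.
    by case: e; rewrite X2j.
Qed.

(** [A], [B], [C], [D] are the intersections of [X1] and [X2] with [Y] and [Z]. The middle pieces
    occur as [B] then [C] and also as [C'] then [B']: the same elements above [i], with possibly
    different boundaries in dimension [i]. *)
Lemma refine_eq n i X1 X2 Y Z : i < n ->
  fcell n X1 -> fcell n X2 -> fcell n Y -> fcell n Z ->
  fcmp i X1 X2 -> fcmp i Y Z -> fcomp i X1 X2 = fcomp i Y Z ->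
  exists A B C D B' C',
    [/\ [/\ fcell n A, fcell n B, fcell n C, fcell n D &
            fcell n B' /\ fcell n C'],
        [/\ fcmp i A B, fcmp i C D, fcmp i A C', fcmp i B' D &
            fcmp i B C /\ fcmp i C' B'],
        [/\ X1 = fcomp i A B, X2 = fcomp i C D, Y = fcomp i A C' &
            Z = fcomp i B' D],
        fcomp i B C = fcomp i C' B'
      & forall l e, i < l -> B l e = B' l e /\ C l e = C' l e].
Proof.
move=> li c1 c2 cY cZ f12 fYZ eX.
set X := fcomp i X1 X2 in eX.
have lii : i < i.+1 := leqnn _.
have in1 l e y : i < l -> (y \in X l e) = (y \in X1 l e) || (y \in X2 l e).
  by move=> il; rewrite in_fcomp.
have in2 l e y : i < l -> (y \in X l e) = (y \in Y l e) || (y \in Z l e).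
  by move=> il; rewrite eX in_fcomp.
have V1 (V : fam P) : fcell n V -> (forall l e y, i < l -> y \in V l e -> y \in X l e) ->
    exists A B, [/\ fcell n A, fcell n B, fcmp i A B, V = fcomp i A B
    & forall l e, i < l ->
      A l e = sel (fun l y => inb n X1 y) (V l e) /\
      B l e = sel (fun l y => ~~ inb n X1 y) (V l e)].
  move=> cV VX; apply: (split_along hP li c1 c2) => //.
    move=> l e y il /(VX l e y il); rewrite in1 // => /orP[] h;
    [left; exact: clo_cell c1 h|right; exact: clo_cell c2 h].
  exists false => y /VX -/(_ lii); rewrite in1 // => /orP[] h;
  by [left; exists false|right; exists false].
have V2 (V : fam P) : fcell n V -> (forall l e y, i < l -> y \in V l e -> y \in X l e) ->
    exists A B, [/\ fcell n A, fcell n B, fcmp i A B, V = fcomp i A B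
    & forall l e, i < l ->
      A l e = sel (fun l y => inb n Y y) (V l e) /\
      B l e = sel (fun l y => ~~ inb n Y y) (V l e)].
  move=> cV VX; apply: (split_along hP li cY cZ) => //.
    move=> l e y il /(VX l e y il); rewrite in2 // => /orP[] h;
    [left; exact: clo_cell cY h|right; exact: clo_cell cZ h].
  exists false => y /VX -/(_ lii); rewrite in2 // => /orP[] h;
  by [left; exists false|right; exists false].
have X1X l e y : i < l -> y \in X1 l e -> y \in X l e by move=> h; rewrite in1 // => ->.
have X2X l e y : i < l -> y \in X2 l e -> y \in X l e by move=> h; rewrite in1 // orbC => ->.
have YX l e y : i < l -> y \in Y l e -> y \in X l e by move=> h; rewrite in2 // => ->.
have ZX l e y : i < l -> y \in Z l e -> y \in X l e by move=> h; rewrite in2 // orbC => ->.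
have [A [B [cA cB fAB e1 hAB]]] := V2 _ c1 X1X.
have [C [D [cC cD fCD e2 hCD]]] := V2 _ c2 X2X.
have [A' [C' [cA' cC' fAC' eY hAC]]] := V1 _ cY YX.
have [B' [D' [cB' cD' fBD' eZ hBD]]] := V1 _ cZ ZX.
have q l e (y : P l) : i < l -> y \in X l e ->
    [/\ (y \in X1 l e) = inb n X1 y, (y \in X2 l e) = ~~ inb n X1 y,
        (y \in Y l e) = inb n Y y & (y \in Z l e) = ~~ inb n Y y].
  move=> il yX; rewrite -(sel_fst e li c1 c2 f12 il) -(sel_snd e li c1 c2 f12 il).
  rewrite -(sel_fst e li cY cZ fYZ il) -(sel_snd e li cY cZ fYZ il) -/X -eX.
  by rewrite !in_sel yX.
have nq l e (y : P l) : i < l -> y \notin X l e ->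
    [/\ (y \in X1 l e) = false, (y \in X2 l e) = false,
        (y \in Y l e) = false & (y \in Z l e) = false].
  move=> il /negP yX; split; apply/negP => h; apply: yX;
  [exact: X1X h|exact: X2X h|exact: YX h|exact: ZX h].
have eqs l e : i < l -> [/\ A l e = A' l e, B l e = B' l e, C l e = C' l e &
    D l e = D' l e].
  move=> il; have [-> ->] := hAB l e il; have [-> ->] := hCD l e il.
  have [-> ->] := hAC l e il; have [-> ->] := hBD l e il.
  split; apply/fsetP => y; rewrite !in_sel;
  (have [yX|yX] := boolP (y \in X l e);
   [have [h1 h2 h3 h4] := q l e y il yX|have [h1 h2 h3 h4] := nq l e y il yX]);
  by rewrite ?h1 ?h2 ?h3 ?h4 // andbC.
have lt1 l e : l < i -> [/\ A l e = X l e, B l e = X l e, C l e = X l e,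
   D l e = X l e & [/\ A' l e = X l e, B' l e = X l e, C' l e = X l e &
   D' l e = X l e]].
  move=> h.
  have x1 : X l e = X1 l e by rewrite /X fcomp_lt.
  have a1 : X1 l e = A l e by rewrite e1 fcomp_lt.
  have a2 : X2 l e = C l e by rewrite e2 fcomp_lt.
  have a3 : Y l e = A' l e by rewrite eY fcomp_lt.
  have a4 : Z l e = B' l e by rewrite eZ fcomp_lt.
  have x2 : X l e = Y l e by rewrite eX fcomp_lt.
  rewrite -(fAB.1 l e h) -(fCD.1 l e h) -(fAC'.1 l e h) -(fBD'.1 l e h).
  by rewrite -a1 -a2 -a3 -a4 -(f12.1 l e h) -(fYZ.1 l e h) -x1 -x2.
have i1 : A i false = X i false by rewrite /X fcomp_eq e1 fcomp_eq.
have i2 : D i true = X i true by rewrite /X fcomp_eq e2 fcomp_eq.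
have i3 : A' i false = X i false by rewrite eX fcomp_eq eY fcomp_eq.
have i4 : D' i true = X i true by rewrite eX fcomp_eq eZ fcomp_eq.
(* [A] and [A'] start at the same boundary and perform the same movement, while [D] and [D'] end at
   the same one; so they coincide in all dimensions. *)
have i5 : A i true = A' i true.
  apply: (det_true (e := false) li cA cA' _ _); last by rewrite i1.
  by have [] := eqs i.+1 false lii.
have i6 : D i false = D' i false.
  apply: (det_false (e := false) li cD cD' _ _); last by rewrite i2.
  by have [] := eqs i.+1 false lii.
have eA : A' = A.
  apply: fam_eq => l e; have [h|h|h] := ltngtP l i.
  - by have [-> _ _ _ [->]] := lt1 l e h.
  - by have [-> _ _ _] := eqs l e h.
  - by subst l; case: e; rewrite ?i5 ?i1 ?i3.
have eD : D' = D.
  apply: fam_eq => l e; have [h|h|h] := ltngtP l i.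
  - by have [_ _ _ -> [_ _ _ ->]] := lt1 l e h.
  - by have [_ _ _ ->] := eqs l e h.
  - by subst l; case: e; rewrite ?i6 ?i2 ?i4.
subst A' D'.
have j1 : B i true = C i false.
  have -> : B i true = X1 i true by rewrite e1 fcomp_eq.
  by rewrite f12.2 e2 fcomp_eq.
have j2 : C' i true = B' i false.
  have -> : C' i true = Y i true by rewrite eY fcomp_eq.
  by rewrite fYZ.2 eZ fcomp_eq.
exists A, B, C, D, B', C'; split=> //.
- split=> //; split; split=> //.
    by move=> l e h; have [_ -> -> _ _] := lt1 l e h.
  by move=> l e h; have [_ _ _ _ [_ -> -> _]] := lt1 l e h.
- apply: fam_eq => l e; have [h|h|h] := ltngtP l i.
  + rewrite !(fcomp_lt _ _ _ h).
    by have [_ -> _ _ [_ _ ->]] := lt1 l e h.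
  + rewrite !fcomp_gt // fsetUC.
    by have [_ -> -> _] := eqs l e h.
  + subst l; rewrite !fcomp_eq; case: e.
      by rewrite fCD.2 fBD'.2.
    by rewrite -fAB.2 -fAC'.2.
- by move=> l e h; have [_ -> -> _] := eqs l e h.
Qed.

End Refinement.

(** * Atoms and indecomposable cells *)

Section Atoms.

Variable P : hypergraph.
Implicit Types X Y Z A B C D : fam P.

Lemma single_out n (U : {fset P n}) j : n != j -> single U j = fset0.
Proof. by rewrite /single; case: eqP. Qed.

Lemma descend_step n e (U : {fset P n}) j : j < n ->
  descend e U j = sbdD e (descend e U j.+1).
Proof.
elim: n U => // n IH U; rewrite ltnS leq_eqVlt /= => /orP[/eqP ->|jn].
  by rewrite ltn_eqF // eqxx singlexx descend_top.
by rewrite (ltn_eqF (leqW jn)) eqSS (ltn_eqF jn) IH.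
Qed.

Lemma atom_step n (u : P n) e j : j < n -> atom u j e = sbdD e (atom u j.+1 e).
Proof. exact: descend_step. Qed.

Lemma atom_self n (u : P n) e : atom u n e = [fset u].
Proof. exact: descend_top. Qed.

Lemma atom_gt n (u : P n) e j : n < j -> atom u j e = fset0.
Proof. exact: descend_out. Qed.

Lemma is_cell_sph n (X : precell P n) : is_cell X -> sph n.+1 X.
Proof. by move=> [h1 h2]; apply: sphP. Qed.

Lemma is_cell_fcell n (X : precell P n) : is_cell X -> fcell n X.
Proof.
move=> h; split; [exact: is_cell_sph|exact: pface_top|exact: pface_out].
Qed.

Lemma fcell_is_cell n (X : precell P n) : fcell n X -> is_cell X.
Proof.
move=> [sX _ _]; split=> i e h; first exact: sph_moves sX.
exact: sph_ff sX.
Qed.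

Lemma cell_of_fcell n X : fcell n X ->
  exists c : cell P n, pface c = X.
Proof.
move=> cX; have [_ tX oX] := cX.
exists (@MkCell _ _ (Precell tX oX) (@fcell_is_cell _ (Precell tX oX) cX)).
by [].
Qed.

Lemma cell_of_fill n X W : sph n X -> fill X W ->
  exists c : cell P n, ptop c = W.
Proof.
move=> sX fX; pose Y : fam P := fun j e => if j < n then X j e else single W j.
have lt j e : j < n -> Y j e = X j e by rewrite /Y => ->.
have top e : Y n e = W by rewrite /Y ltnn singlexx.
have cY : fcell n Y.
  split; first split.
  - by apply: eq_sph sX => j e jn; rewrite lt.
  - by move=> e; rewrite top; apply: eq_fill fX => j e' jn; rewrite lt.
  - by rewrite !top.
  - by move=> j e nj; rewrite /Y ltnNge (ltnW nj) /= single_out // ltn_eqF.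
have [c hc] := cell_of_fcell cY; exists c.
by rewrite /ptop hc top.
Qed.

Hypothesis hP : torsion_free_complex P.

Lemma acyclic n (u : P n.+1) : ~ tri predT u u.
Proof. exact: (acyclicity hP). Qed.

Lemma atom_sph n (u : P n) : sph n.+1 (atom u).
Proof. exact/is_cell_sph/(relevance hP). Qed.

Lemma atom_bd n (u : P n.+1) e : atom u n e = hbd e u.
Proof.
rewrite atom_step // atom_self /sbdD !sbd1.
apply/fsetP => y; rewrite inE andbC.
have [yu|//] := boolP (y \in hbd e u); apply/negP => yu'.
apply: (@acyclic n u); apply: t_step; split=> // /fsetP/(_ y).
by rewrite !inE; case: e yu yu' => -> ->.
Qed.

(** Globularity comes from relevance: the movement equations of the atom identify the net boundaries
    of u^- and of u^+ with the same component of the atom. *)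
Lemma torsion_free_gluable : gluable P.
Proof.
split.
- by move=> n u e; apply/eqP; exact: (nonemptiness hP).
- exact: acyclic.
- by move=> n u e; rewrite -atom_bd; apply: sph_ff (atom_sph u).
- move=> n u e.
  have m e' := @sph_moves _ _ n _ e' (leqW (leqnn n.+2)) (atom_sph u).
  have s e' : sbdD e (hbd e' u) = atom u n e.
    apply/fsetP => y; apply/idP/idP.
      rewrite -atom_bd => h.
      by case: e h => h; [apply: (moves_subr (m e'))|apply: (moves_sub (m e'))].
    rewrite atom_step; last exact: leqW.
    rewrite -(atom_bd u e').
    have /movesP/(_ y) := m e'; have /movesP/(_ y) := m (~~ e').
    have := @atom_step _ u false n (leqW (leqnn _)).
    have := @atom_step _ u true n (leqW (leqnn _)).
    move=> /fsetP/(_ y) + /fsetP/(_ y).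
    rewrite !sbdDP /=; case: e; case: e' => /=; mem_cases.
  by rewrite !s.
- move=> n u e X W sX fX uW; have [c hc] := cell_of_fill sX fX.
  rewrite -hc -atom_bd; apply: (segment_condition hP) => //.
  by apply/fsubsetP => y; rewrite atom_bd hc; exact: uW.
Qed.

Let gP := torsion_free_gluable.

(** A minimal element has a source that [S] does not produce, a maximal one a target that [S] does
    not consume; acyclicity provides both. *)
Lemma sbdD_ne n e (S : {fset P n.+1}) : S != fset0 -> sbdD e S != fset0.
Proof.
move=> S0; apply/fset0Pn.
pose R (a b : P n.+1) := if e then tri predT b a else tri predT a b.
have [|||s sS smin] := @minimal_ex _ R S.
- by rewrite /R; case: (e) => x y z h1 h2; apply: t_trans; eauto.
- by rewrite /R; case: (e) => x; exact: acyclic.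
- by [].
have /fset0Pn[y ys] := glu_ne gP s e; exists y.
rewrite sbdDP (mem_sbd sS ys) andbT; apply/negP => /sbdP[t tS yt].
apply: (smin t tS); rewrite /R; case: e {R smin} ys yt => ys yt.
  exact: tri_step ys yt.
exact: tri_step yt ys.
Qed.

Lemma atom_ne n (u : P n) j e : j <= n -> atom u j e != fset0.
Proof.
move=> jn; rewrite -(subKn jn); elim: (n - j) (leq_subr j n) => [|d IH] dn.
  by rewrite subn0 atom_self; apply/fset0Pn; exists u; rewrite inE.
rewrite atom_step; last by rewrite -subn_gt0 subKn.
apply: sbdD_ne; rewrite subnSK //.
by apply: IH; exact: ltnW.
Qed.

(** Elements of [N] are then untouched by the next dimension, so that a splitting may put them on
    either side independently of the higher components. *)
Definition avoids n X i (N : {fset P i}) : Prop :=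
  forall y e e' s, i < n -> y \in N -> s \in X i.+1 e -> y \notin hbd e' s.

(** The predicate selects [N] in its own dimension and nothing above, which makes the first factor
    trivial there. *)
Lemma split_in n i e0 X (N : {fset P i.+1}) : i < n -> fcell n X ->
  initial (X i.+1 e0) N -> avoids n X N ->
  exists A B, [/\ fcell n A, fcell n B, fcmp i A B, X = fcomp i A B
    & [/\ A i.+1 e0 = N, B i.+1 e0 = X i.+1 e0 `\` N
      & forall l e, i.+1 < l -> A l e = fset0]].
Proof.
move=> ln cX ini av; pose f l (y : P l) := y \in single N l.
have sN : sel f (X i.+1 e0) = N.
  apply/fsetP => y; rewrite in_sel /f singlexx.
  by case: (boolP (y \in N)) => [/ini.1 ->|]; rewrite ?andbF.
have fl l (y : P l) : i.+1 < l -> f l y = false.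
  by move=> h; rewrite /f single_out ?inE // ltn_eqF.
have [||A [B [cA cB fAB eX h]]] := split_cell (f := f) (e0 := e0) gP ln cX.
- move=> l e il hl s e' y sX ys; rewrite [RHS]fl //.
  move: (il); rewrite leq_eqVlt => /orP[/eqP il'|]; last exact: fl.
  subst l; rewrite /f singlexx; apply/negP => yN.
  by have := av y e e' s hl yN sX; rewrite ys.
- by rewrite sN.
exists A, B; split=> //; split.
- by rewrite (h i.+1 e0 _).1.
- rewrite (h i.+1 e0 _).2 //; apply/fsetP => y.
  by rewrite in_sel in_fsetD andbC /f singlexx.
- move=> l e il; rewrite (h l e _).1; last exact: ltnW.
  by apply/fsetP => y; rewrite in_sel fl // andbF inE.
Qed.

(** Dual to [split_in]: the complement of [N] is isolated, and everything higher stays in the first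
    factor. *)
Lemma split_out n i e0 X (N : {fset P i.+1}) : i < n -> fcell n X ->
  initial (X i.+1 e0) N -> avoids n X (X i.+1 e0 `\` N) ->
  exists A B, [/\ fcell n A, fcell n B, fcmp i A B, X = fcomp i A B
    & [/\ A i.+1 e0 = N, B i.+1 e0 = X i.+1 e0 `\` N
      & forall l e, i.+1 < l -> B l e = fset0]].
Proof.
move=> ln cX ini av; pose f l (y : P l) := y \notin single (X i.+1 e0 `\` N) l.
have sN : sel f (X i.+1 e0) = N.
  apply/fsetP => y; rewrite in_sel /f singlexx in_fsetD negb_and negbK.
  by case: (boolP (y \in N)) => [/ini.1 ->|] //=; rewrite andbN.
have fl l (y : P l) : i.+1 < l -> f l y = true.
  by move=> h; rewrite /f single_out ?inE // ltn_eqF.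
have [||A [B [cA cB fAB eX h]]] := split_cell (f := f) (e0 := e0) gP ln cX.
- move=> l e il hl s e' y sX ys; rewrite [RHS]fl //.
  move: (il); rewrite leq_eqVlt => /orP[/eqP il'|]; last exact: fl.
  subst l; rewrite /f singlexx; apply/negP => yN.
  by have := av y e e' s hl yN sX; rewrite ys.
- by rewrite sN.
exists A, B; split=> //; split.
- by rewrite (h i.+1 e0 _).1.
- rewrite (h i.+1 e0 _).2 //; apply/fsetP => y.
  rewrite in_sel /f singlexx negbK in_fsetD.
  by case: (y \in X _ _); rewrite ?andbF.
- move=> l e il; rewrite (h l e _).2; last exact: ltnW.
  by apply/fsetP => y; rewrite in_sel fl // andbF inE.
Qed.

Definition splits n i X : Prop := exists A B,
  [/\ fcell n A, fcell n B, fcmp i A B, X = fcomp i A B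
    & A i.+1 false != fset0 /\ B i.+1 false != fset0].

Definition below i (W T : {fset P i}) : {fset P i} :=
  [fset y in W | `[< exists2 w, w \in T & tri [in W] y w >]].

Lemma belowP i (W T : {fset P i}) y :
  reflect (y \in W /\ exists2 w, w \in T & tri [in W] y w) (y \in below W T).
Proof.
by rewrite !inE; apply: (iffP andP) => -[h1 h2]; split=> //; apply/asboolP.
Qed.

Lemma below_initial i (W T : {fset P i.+1}) : {subset T <= W} ->
  initial W (T `|` below W T).
Proof.
move=> TW; split=> [y|t s y tW].
  by rewrite in_fsetU => /orP[/TW //|/belowP[]].
rewrite !in_fsetU => h yt ys; apply/orP; right; apply/belowP; split=> //.
have st : s \in W -> tri [in W] t s.
  by move=> sW; apply: t_step; split=> //; exact: hstepP yt ys.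
case/orP: h => [sT|/belowP[sW [w wT sw]]].
  by exists s => //; exact/st/TW.
by exists w => //; apply: t_trans sw; exact: st.
Qed.

(** If nothing outside [T] precedes it, [T] is initial and goes first; otherwise its predecessors
    outside [T] go first, and they are initial because [T] is a segment. In both cases the isolated
    elements lie outside [T]. *)
Lemma split_segment n i X (T : {fset P i.+1}) : i < n -> fcell n X ->
  {subset T <= X i.+1 false} -> segment [in X i.+1 false] T ->
  T != fset0 -> T != X i.+1 false -> avoids n X (X i.+1 false `\` T) ->
  splits n i X.
Proof.
move=> ln cX; set W := X i.+1 false => TW seg T0 TX av.
pose U := below W T `\` T.
have iTU := below_initial TW.
have [U0|U0] := boolP (U == fset0).
  have eT : T `|` below W T = T.
    apply/fsetP => y; rewrite in_fsetU; have := in_fset0 y; rewrite -(eqP U0).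
    by rewrite in_fsetD; case: (y \in T).
  rewrite eT in iTU.
  have [A [B [cA cB fAB eX [eA eB _]]]] := split_out ln cX iTU av.
  exists A, B; split=> //; rewrite eA eB; split=> //.
  apply: contra TX => /eqP h; apply/eqP/fsetP => y.
  have := in_fset0 y; rewrite -h in_fsetD -/W; have := TW y.
  by case: (y \in T); case: (y \in W) => // /(_ isT).
have UT y : y \in U -> y \notin T by rewrite in_fsetD => /andP[].
have UW y : y \in U -> y \in W.
  by rewrite in_fsetD => /andP[_ /belowP[]].
have iU : initial W U.
  split=> // t s y tW sU yt ys.
  have := sU; rewrite in_fsetD => /andP[sT /belowP[sW [w wT sw]]].
  have ts : tri [in W] t s.
    by apply: t_step; split=> //; exact: hstepP yt ys.
  rewrite in_fsetD; apply/andP; split.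
    by apply: contra sT => tT; exact: seg tT wT ts sw.
  by apply/belowP; split=> //; exists w => //; apply: t_trans sw.
have avU : avoids n X U.
  move=> y e e' s h yU; apply: av => //.
  by rewrite in_fsetD UT // UW.
have [A [B [cA cB fAB eX [eA eB _]]]] := split_in ln cX iU avU.
exists A, B; split=> //; rewrite eA eB; split=> //.
have /fset0Pn[y yT] := T0; apply/fset0Pn; exists y.
rewrite in_fsetD -/W TW // andbT.
by apply/negP => /UT; rewrite yT.
Qed.

Definition carried n k X m (u : P m) : Prop :=
  [/\ k <= m, m <= n & forall j e, k <= j -> X j e = atom u j e].

(** An element of a boundary that is touched by the movement above it belongs to the net boundary of
    that movement, which is the component of the atom. *)
Lemma carried_avoids n i X m (u : P m) e0 : i.+1 < m -> m <= n ->
  fcell n X -> carried n i.+2 X u -> avoids n X (X i.+1 e0 `\` atom u i.+1 e0).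
Proof.
move=> im mn [sX _ _] [_ _ hX] y e e' s iln; rewrite in_fsetD => /andP[yu yX] sX'.
have h2 : i.+2 < n.+1 by exact: leq_trans im mn.
have /movesP/(_ y)[m1 m2] := sph_moves e h2 sX.
have mu := sph_moves e (im : i.+2 < m.+1) (atom_sph u).
rewrite -hX // in mu; apply/negP => ys; have yS := mem_sbd sX' ys.
have sub1 : {subset _ <= _} := moves_sub mu.
have sub2 : {subset _ <= _} := moves_subr mu.
have := sub1 y; have := sub2 y; rewrite !sbdDP /=.
by case: e0 yu yX => yu yX; case: e' ys yS => ys yS; mem_cases.
Qed.

End Atoms.

(** * Indecomposable cells, and the exchange of two of them *)

Section Indecomposable.

Variable P : hypergraph.
Hypothesis hP : torsion_free_complex P.
Let gP := torsion_free_gluable hP.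
Implicit Types X Y Z A B C D : fam P.

Lemma atom_sub n k X m (u : P m) e : fcell n X -> carried n k.+1 X u ->
  {subset atom u k e <= X k e}.
Proof.
move=> [sX _ _] [km mn hX] y; rewrite atom_step // -hX //.
have mv := sph_moves e (leq_ltn_trans km (mn : m < n.+1)) sX.
by case: e mv => mv; [exact: (moves_subr mv)|exact: (moves_sub mv)].
Qed.

(** One dimension lower, take a single generator or the source of the atom found above. It is a
    segment, by acyclicity or by the segment condition, so it is the whole component or it splits
    the cell; in dimension 0 fork-freeness leaves only the first case. *)
Lemma classify_step n k X : fcell n X -> k <= n ->
  (forall l e, k < l -> X l e = fset0) \/ (exists m (u : P m), carried n k.+1 X u) ->
  (forall l e, k <= l -> X l e = fset0) \/
  (exists i, [/\ k <= i.+1, i < n & splits n i X]) \/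
  (exists m (u : P m), carried n k X u).
Proof.
move=> cX kn h; have [sX tX oX] := cX.
have kn1 : k < n.+1 by [].
have ffk e : fork_free (X k e) := sph_ff e kn1 sX.
case: h => [h|[m [u cu]]].
  have eqk : X k true = X k false.
    move: (kn); rewrite leq_eqVlt => /orP[/eqP ->|kn']; first by rewrite tX.
    have := sph_moves true (kn' : k.+1 < n.+1) sX; rewrite h // => mv.
    by rewrite (moves_act mv) /act !sbd0 fsetU0 fsetD0.
  have eqk' e : X k e = X k false by case: e.
  have [X0|/fset0Pn[u uX]] := eqVneq (X k false) fset0.
    left=> l e; rewrite leq_eqVlt => /orP[/eqP <-|]; last exact: h.
    by rewrite eqk'.
  have [X1|X1] := eqVneq (X k false) [fset u].
    right; right; exists k, u; split=> // j e.
    rewrite leq_eqVlt => /orP[/eqP <-|kj]; first by rewrite eqk' atom_self.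
    by rewrite h // atom_gt.
  have sub : {subset [fset u] <= X k false} by move=> y; rewrite inE => /eqP ->.
  case: k ffk kn kn1 h eqk eqk' u uX X1 sub => [|k] ffk kn kn1 h eqk eqk' u uX X1 sub.
    by case/eqP: X1; apply/esym/(ff0 _ (ffk false) sub); rewrite /= cardfs1.
  right; left; exists k; split=> //; apply: (split_segment hP kn cX sub) => //.
  - move=> u1 u2 u3; rewrite !inE => /eqP -> /eqP -> t1 t2.
    by case: (acyclic hP (tri_trans (triW t1) (triW t2))).
  - by apply/fset0Pn; exists u; rewrite inE.
  - by rewrite eq_sym.
  - by move=> y e e' s _ _; rewrite h.
have [km mn hX] := cu.
have sub : {subset atom u k false <= X k false} := atom_sub cX cu.
have [eT|eT] := eqVneq (atom u k false) (X k false).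
  right; right; exists m, u; split=> //; first exact: ltnW.
  move=> j e; rewrite leq_eqVlt => /orP[/eqP <-|kj]; last exact: hX.
  case: e => //.
  have m1 := sph_moves true (leq_ltn_trans km (mn : m < n.+1)) sX.
  have m2 := sph_moves true (km : k.+1 < m.+1) (atom_sph hP u).
  by rewrite (moves_act m1) (moves_act m2) eT hX.
case: k ffk kn kn1 cu km hX sub eT => [|k] ffk kn kn1 cu km hX sub eT.
  case/eqP: eT; apply: (ff0 _ (ffk false) sub).
  by apply: sph_ff (atom_sph hP u); exact: leqW.
right; left; exists k; split=> //; apply: (split_segment hP kn cX sub) => //.
- have [c hc] := cell_of_fill (sph_le (ltnW kn1) sX) (sph_fill false kn1 sX).
  rewrite -hc; apply: (segment_condition hP) => //; apply/fsubsetP => y.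
  by rewrite hc; exact: sub.
- by apply: (atom_ne hP); exact: ltnW.
- exact: (carried_avoids hP).
Qed.

Lemma classify n k X : fcell n X -> k <= n.+1 ->
  (forall l e, k <= l -> X l e = fset0) \/
  (exists i, [/\ k <= i.+1, i < n & splits n i X]) \/
  (exists m (u : P m), carried n k X u).
Proof.
move=> cX kn; rewrite -(subKn kn).
elim: (n.+1 - k) => [|d IH].
  by left=> l e; rewrite subn0 => nl; have [_ _ ->] := cX.
have [dn|dn] := leqP n.+1 d.
  suff -> : (n.+1 - d.+1 = n.+1 - d)%N by [].
  by apply/eqP; rewrite (eqP dn) subn_eq0; exact: leqW.
rewrite -(subnSK dn) in IH; rewrite subSS in IH *.
have [h|[[i [h1 h2 h3]]|h]] := IH.
- by apply: classify_step => //; [exact: leq_subr|left].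
- by right; left; exists i; split=> //; exact: ltnW.
- by apply: classify_step => //; [exact: leq_subr|right].
Qed.

(* Torsion-freeness separates u and v inside their common i-boundary, so that
   both cells split one dimension lower. *)
Lemma exchange_split n i B C Y Z m (u : P m) m' (v : P m') :
  i < n -> fcell n B -> fcell n C -> fcell n Y -> fcell n Z ->
  fcmp i B C -> fcmp i Y Z ->
  (forall l e, i < l -> Y l e = C l e /\ Z l e = B l e) ->
  carried n i.+1 B u -> carried n i.+1 C v ->
  exists k B1 B2 C1 C2, [/\ i = k.+1,
    [/\ fcell n B1, fcell n B2, fcell n C1 & fcell n C2],
    [/\ fcmp k B1 B2, fcmp k C1 C2, fcmp i B1 C1 & fcmp i B2 C2],
    B = fcomp k B1 B2 /\ C = fcomp k C1 C2
    & (forall l e, i < l -> B2 l e = fset0 /\ C1 l e = fset0) \/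
      (forall l e, i < l -> B1 l e = fset0 /\ C2 l e = fset0)].
Proof.
move=> ln cB cC cY cZ fBC fYZ eYZ hu hv.
have [um mn hB] := hu; have [vm mn' hC] := hv.
have [sB _ _] := cB; have [sC _ _] := cC.
pose M := B i true; have eM : M = C i false := fBC.2.
pose Tu := atom u i true; pose Tv := atom v i false.
have uM : {subset Tu <= M} := atom_sub cB hu.
have vM : {subset Tv <= M} by rewrite eM; exact: atom_sub cC hv.
have lii : i < i.+1 := leqnn _.
(* In the other decomposition [Y] has the elements of [C] and comes first, so what it consumes is
   not produced later by [Z]. *)
have dT : dis Tu Tv.
  apply/disP => y; rewrite /Tu /Tv (atom_step u true um) (atom_step v false vm).
  rewrite -hB // -hC // !sbdDP.
  rewrite -(eYZ _ true lii).2 -(eYZ _ false lii).1 => /andP[_ yZ] /andP[_ yY].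
  have [sY _ _] := cY; have [sZ _ _] := cZ.
  have := comp_sbd_dis gP false true ln sY sZ fYZ (leqnn i) ln (isT : false ==> true) y.
  by rewrite yY yZ.
have i1 : i < n.+1 by exact: leqW.
have ffM : fork_free M := sph_ff true i1 sB.
have Tu0 : Tu != fset0 by apply: (atom_ne hP); exact: ltnW.
have Tv0 : Tv != fset0 by apply: (atom_ne hP); exact: ltnW.
(* In dimension 0 the boundary [M] is a single point and cannot contain two disjoint non-empty
   sets. *)
have i0 : 0 < i.
  case: (posnP i) => // i0; subst i; exfalso.
  have /fset0Pn[y yu] := Tu0; have /fset0Pn[z zv] := Tv0.
  have /eqP/cardfs1P[x eMx] := ffM.
  have := uM y yu; have := vM z zv; rewrite eMx !inE => /eqP ez /eqP ey.
  by have := dT x; rewrite -{1}ey yu -ez zv.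
have tor : ~ tri_set [in M] Tu Tv \/ ~ tri_set [in M] Tv Tu.
  have [c hc] := cell_of_fill (sph_le (ltnW i1) sB) (sph_fill true i1 sB).
  apply/not_andP => h; apply: (torsion_freeness hP (u := u) (v := v) (X := c) i0).
  - by rewrite leq_min um vm.
  - by apply/fsubsetP => y; rewrite hc; exact: uM.
  - by apply/fsubsetP => y; rewrite hc; exact: vM.
  - by apply/fsetP => y; rewrite in_fsetI in_fset0; apply/negbTE; exact: dT.
  - by rewrite hc.
case: i i0 ln fBC fYZ eYZ hu hv um vm hB hC @M eM @Tu @Tv uM vM lii dT i1 ffM Tu0 Tv0 tor
  => // k _ ln fBC fYZ eYZ hu hv um vm hB hC M eM Tu Tv uM vM lii dT i1 ffM Tu0 Tv0 tor.
have kn : k < n by exact: ltnW.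
(* The same part [N] of the common boundary cuts both cells, which makes the corresponding halves
   composable in dimension [k.+1]. *)
have finish N B1 B2 C1 C2 :
    fcell n B1 -> fcell n B2 -> fcell n C1 -> fcell n C2 ->
    fcmp k B1 B2 -> fcmp k C1 C2 -> B = fcomp k B1 B2 -> C = fcomp k C1 C2 ->
    B1 k.+1 true = N -> B2 k.+1 true = B k.+1 true `\` N ->
    C1 k.+1 false = N -> C2 k.+1 false = C k.+1 false `\` N ->
    fcmp k.+1 B1 C1 /\ fcmp k.+1 B2 C2.
  move=> cB1 cB2 cC1 cC2 fB fC eB eC b1 b2 c1 c2.
  have lt l e : l < k -> B1 l e = C1 l e.
    move=> h; rewrite -(fcomp_lt B1 B2 e h) -eB -(fcomp_lt C1 C2 e h) -eC.
    by apply: fBC.1; exact: leqW.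
  have kf : B1 k false = C1 k false.
    rewrite -(fcomp_eq k B1 B2 false) -eB -(fcomp_eq k C1 C2 false) -eC.
    exact: fBC.1.
  have kt : B2 k true = C2 k true.
    rewrite -(fcomp_eq k B1 B2 true) -eB -(fcomp_eq k C1 C2 true) -eC.
    exact: fBC.1.
  have k1t : B1 k true = C1 k true.
    have [sB1 _ _] := cB1; have [sC1 _ _] := cC1.
    have kk : k.+1 < n.+1 by exact: leqW.
    rewrite (moves_act (sph_moves true kk sB1)) (moves_act (sph_moves false kk sC1)).
    by rewrite b1 c1 kf.
  split; split; rewrite ?b1 ?c1 ?b2 ?c2 -?fBC.2 //.
    move=> j e; rewrite ltnS leq_eqVlt => /orP[/eqP ->|/lt //].
    by case: e.
  move=> j e; rewrite ltnS leq_eqVlt => /orP[/eqP ->|h].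
    by case: e => //; rewrite -fB.2 -fC.2.
  by rewrite -(fB.1 _ _ h) -(fC.1 _ _ h); exact: lt.
have avB N : {subset N <= M} -> dis N Tu -> avoids n B N.
  move=> NM d y e e' s h yN sB'.
  apply: (@carried_avoids _ hP n k B m u true um mn cB hu y e e' s h _ sB').
  rewrite in_fsetD; apply/andP; split; last exact: NM.
  by have := d y; rewrite yN.
have avC N : {subset N <= M} -> dis N Tv -> avoids n C N.
  move=> NM d y e e' s h yN sC'.
  apply: (@carried_avoids _ hP n k C m' v false vm mn' cC hv y e e' s h _ sC').
  rewrite in_fsetD; apply/andP; split; last by rewrite -eM; exact: NM.
  by have := d y; rewrite yN.
have notbelow (T1 T2 : {fset P k.+1}) : dis T1 T2 -> ~ tri_set [in M] T2 T1 ->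
    dis (T1 `|` below M T1) T2.
  move=> d ht; apply/disP => y; rewrite in_fsetU => /orP[y1|/belowP[yM [w wT yw]]] y2.
    by have := d y; rewrite y1 y2.
  by apply: ht; exists y, w.
have rest (T1 : {fset P k.+1}) : dis (M `\` (T1 `|` below M T1)) T1.
  apply/disP => y; rewrite in_fsetD in_fsetU negb_or.
  by move=> /andP[/andP[/negP h _] _].
have subD (N : {fset P k.+1}) : {subset M `\` N <= M}.
  by move=> y; rewrite in_fsetD => /andP[].
case: tor => tor.
(* Here nothing in [Tu] precedes [Tv]. So [N] contains what [v] consumes and avoids what [u]
   produces: [C1] keeps [v], [B2] keeps [u], and the two other pieces are trivial above [k.+1]. *)
- pose N := Tv `|` below M Tv.
  have iN : initial M N := below_initial vM.
  have iB : initial (B k.+1 true) N := iN.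
  have iC : initial (C k.+1 false) N by rewrite -eM.
  have [|B1 [B2 [cB1 cB2 fB eB [b1 b2 b3]]]] := split_in hP kn cB iB.
    by apply: avB; [exact: iN.1|apply: notbelow => //; exact: disC].
  have [|C1 [C2 [cC1 cC2 fC eC [c1 c2 c3]]]] := split_out hP kn cC iC.
    by rewrite -eM; apply: avC; [exact: subD|exact: rest].
  have [f1 f2] := finish N B1 B2 C1 C2 cB1 cB2 cC1 cC2 fB fC eB eC b1 b2 c1 c2.
  exists k, B1, B2, C1, C2; split=> //; right=> l e h.
  by rewrite b3 // c3.
- pose N := Tu `|` below M Tu.
  have iN : initial M N := below_initial uM.
  have iB : initial (B k.+1 true) N := iN.
  have iC : initial (C k.+1 false) N by rewrite -eM.
  have [|B1 [B2 [cB1 cB2 fB eB [b1 b2 b3]]]] := split_out hP kn cB iB.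
    by apply: avB; [exact: subD|exact: rest].
  have [|C1 [C2 [cC1 cC2 fC eC [c1 c2 c3]]]] := split_in hP kn cC iC.
    by apply: avC; [exact: iN.1|exact: notbelow].
  have [f1 f2] := finish N B1 B2 C1 C2 cB1 cB2 cC1 cC2 fB fC eB eC b1 b2 c1 c2.
  exists k, B1, B2, C1, C2; split=> //; left=> l e h.
  by rewrite b3 // c3.
Qed.

End Indecomposable.

(** * Truncations of strict omega-categories *)

Definition tcast (A B : Type) (E : A = B) (x : A) : B := ecast T T E x.

Lemma tcastK A B (E : A = B) : cancel (tcast E) (tcast (esym E)).
Proof. by case: _ / E. Qed.

Lemma tcastKV A B (E : A = B) : cancel (tcast (esym E)) (tcast E).
Proof. by case: _ / E. Qed.

Lemma idbdS n (C : precat n.+1) e i (x : cells C) :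
  idbd e i x = ide (if i == n then bd e x else idbd e i (bd e x)).
Proof. by []. Qed.

Section Tower.

Variable D : odata.

Fixpoint ocomposable n : nat -> ocell D n -> ocell D n -> Prop :=
  match n with
  | 0 => fun _ _ _ => False
  | m.+1 => fun i x y =>
      if i == m then obd true x = obd false y
      else ocomposable i (obd true x) (obd false y)
  end.

Fixpoint oidbd n : bool -> nat -> ocell D n -> ocell D n :=
  match n with
  | 0 => fun _ _ x => x
  | m.+1 => fun e i x =>
      oide (if i == m then obd e x else oidbd e i (obd e x))
  end.

Lemma ocomposableS n i (x y : ocell D n.+1) :
  ocomposable i x y = if i == n then obd true x = obd false y
    else ocomposable i (obd true x) (obd false y).
Proof. by []. Qed.

Lemma oidbdS n e i (x : ocell D n.+1) :
  oidbd e i x = oide (if i == n then obd e x else oidbd e i (obd e x)).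
Proof. by []. Qed.

Record ostrict : Prop := OStrict {
  ostrict_globular : forall n (x : ocell D n.+2) e,
    obd e (obd false x) = obd e (obd true x);
  ostrict_bd_ide : forall n e (x : ocell D n), obd e (oide x) = x;
  ostrict_comp0 : forall i (x y z : ocell D 0), ~ ocomp i x y z;
  ostrict_comp_dom : forall n i (x y : ocell D n.+1),
    (exists z, ocomp i x y z) <-> ocomposable i x y;
  ostrict_comp_fun : forall n i (x y z z' : ocell D n),
    ocomp i x y z -> ocomp i x y z' -> z = z';
  ostrict_bd_comp : forall n i (x y z : ocell D n.+1), ocomp i x y z ->
    if i == n then obd false z = obd false x /\ obd true z = obd true y
    else forall e, ocomp i (obd e x) (obd e y) (obd e z);
  ostrict_idl : forall n i (x : ocell D n.+1), i <= n ->
    ocomp i (oidbd false i x) x x;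
  ostrict_idr : forall n i (x : ocell D n.+1), i <= n ->
    ocomp i x (oidbd true i x) x;
  ostrict_assoc : forall n i (x y z u v w : ocell D n.+1),
    ocomp i x y u -> ocomp i u z w -> ocomp i y z v -> ocomp i x v w;
  ostrict_comp_ide : forall n i (x y z : ocell D n),
    ocomp i x y z -> ocomp i (oide x) (oide y) (oide z);
  ostrict_exchange : forall n i j (x x' y y' a b p q c : ocell D n.+1), i < j ->
    ocomp i x x' a -> ocomp i y y' b -> ocomp j a b c ->
    ocomp j x y p -> ocomp j x' y' q -> ocomp i p q c
}.

(** The identification of the cells with [ocell D n] is built along with the tower, since it holds
    by computation only once [n] is zero or a successor; [oval] and [oof] hide the cast. *)
Fixpoint otower n : {C : precat n & cells C = ocell D n} :=
  match n with
  | 0 => existT (fun C => cells C = ocell D 0) (ocell D 0 : precat 0) erefl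
  | m.+1 => existT (fun C => cells C = ocell D m.+1)
      (@addlayer m (projT1 (otower m)) (@Layer _ (ocell D m.+1)
        (fun e x => tcast (esym (projT2 (otower m))) (obd e x))
        (fun x => oide (tcast (projT2 (otower m)) x))
        (@ocomp D m.+1))) erefl
  end.

Definition tcat n : precat n := projT1 (otower n).
Definition oval n : cells (tcat n) -> ocell D n := tcast (projT2 (otower n)).
Definition oof n : ocell D n -> cells (tcat n) :=
  tcast (esym (projT2 (otower n))).

Lemma ovalK n : cancel (@oval n) (@oof n). Proof. exact: tcastK. Qed.
Lemma oofK n : cancel (@oof n) (@oval n). Proof. exact: tcastKV. Qed.
Lemma oval_inj n : injective (@oval n). Proof. exact: can_inj (@ovalK n). Qed.

Lemma oval_bd n e (x : cells (tcat n.+1)) : oval (bd e x) = obd e (oval x).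
Proof. exact: oofK. Qed.

Lemma oval_ide n (x : cells (tcat n)) :
  oval (@ide n (tcat n.+1) x) = oide (oval x).
Proof. by []. Qed.

Lemma oval_idbd n e i (x : cells (tcat n)) :
  oval (idbd e i x) = oidbd e i (oval x).
Proof.
elim: n x => // n IH x.
rewrite [LHS](oval_ide (n := n)) /=; congr oide; case: eqP => _.
  exact: oval_bd.
by rewrite (IH (bd e x)) oval_bd.
Qed.

Lemma oval_composable n i (x y : cells (tcat n)) :
  composable i x y <-> ocomposable i (oval x) (oval y).
Proof.
elim: n x y => // n IH x y /=; case: eqP => _.
  rewrite -(oval_bd true x) -(oval_bd false y).
  by split=> [->|/oval_inj].
by rewrite -(oval_bd true x) -(oval_bd false y); exact: IH.
Qed.

Hypothesis hD : ostrict.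

Lemma oval_comp n i (x y z : cells (tcat n)) :
  comp i x y z <-> ocomp i (oval x) (oval y) (oval z).
Proof.
case: n x y z => // x y z; split=> // h; exact: ostrict_comp0 hD _ _ _ _ h.
Qed.

Lemma tcat_strict n : strict (tcat n).
Proof.
elim: n => // n IH; split=> //; split.
- case: n {IH} => // n x e; apply: oval_inj; rewrite !oval_bd.
  exact: (ostrict_globular hD).
- by move=> e x; apply: oval_inj; rewrite oval_bd oval_ide (ostrict_bd_ide hD).
- move=> i x y; rewrite oval_composable; exact: (ostrict_comp_dom hD).
- by move=> i x y z z'; exact: (ostrict_comp_fun hD).
- move=> i x y z h; have := ostrict_bd_comp hD h; case: eqP => _.
    by move=> [h1 h2]; split; apply: oval_inj; rewrite !oval_bd.
  by move=> h' e; apply/oval_comp; rewrite !oval_bd.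
- move=> i x hi; apply/oval_comp; rewrite oval_idbd; exact: (ostrict_idl hD).
- move=> i x hi; apply/oval_comp; rewrite oval_idbd; exact: (ostrict_idr hD).
- by move=> i x y z u v w; exact: (ostrict_assoc hD).
- move=> i x y z /oval_comp h; exact: (ostrict_comp_ide hD).
- by move=> i j x x' y y' a b p q c; exact: (ostrict_exchange hD).
Qed.

Definition tncat n : ncat n := NCat (tcat_strict n).

End Tower.

(** * The strict omega-category of cells *)

Section CellCategory.

Variable P : hypergraph.

Lemma cell_eq n (X Y : cell P n) : (forall j e, X j e = Y j e) -> X = Y.
Proof.
case: X Y => [[X tX oX] hX] [[Y tY oY] hY] /= h.
have eXY := fam_eq h; subst Y.
have etX : tX = tY by exact: Prop_irrelevance.
have eoX : oX = oY by exact: Prop_irrelevance.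
subst tY oY; congr MkCell; exact: Prop_irrelevance.
Qed.

Lemma cell_fcell n (X : cell P n) : fcell n X.
Proof. exact: is_cell_fcell (cellP X). Qed.

Lemma cell_top n (X : cell P n) e : X n e = X n true.
Proof. by case: e => //; exact: pface_top. Qed.

Lemma pbd_face_lt n i e (X : precell P n) j e' : j < i ->
  pbd_face i e X j e' = X j e'.
Proof. by rewrite /pbd_face => ->. Qed.

Lemma pbd_fcmp n i (X Y : cell P n) : i < n ->
  pbd i true X = pbd i false Y <-> fcmp i X Y.
Proof.
move=> ln; split=> [h|[h1 h2]].
  have eq j e : pbd_face i true X j e = pbd_face i false Y j e.
    exact: (congr1 (fun Z : precell P i => Z j e) h).
  split=> [j e ji|]; first by have := eq j e; rewrite /pbd_face ji.
  by have := eq i true; rewrite /pbd_face ltnn eqxx.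
have e : (pbd i true X : fam P) = pbd i false Y.
  apply: fam_eq => j e; rewrite /= /pbd_face; case: ltnP => [ji|_]; first exact: h1.
  by case: eqP => // ->.
move: e; rewrite /pbd /=; move: (pbd_top _ _ _) (@pbd_out _ _ _ _ _).
move: (pbd_top _ _ _) (@pbd_out _ _ _ _ _) => t1 o1 t2 o2 e.
move: t1 o1 t2 o2; rewrite e => t1 o1 t2 o2.
by congr Precell; exact: Prop_irrelevance.
Qed.

Lemma cell_compP n i (X Y Z : ocell (Cell P) n) :
  ocomp i X Y Z <-> [/\ i < n, fcmp i X Y & (Z : fam P) = fcomp i X Y].
Proof.
split=> [[ln h1 h2]|[ln h1 h2]].
  by split=> //; [apply/pbd_fcmp|apply: fam_eq].
by split=> //; [apply/pbd_fcmp|move=> j e; rewrite h2].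
Qed.

Lemma cell_bd n (X : ocell (Cell P) n.+1) e j e' :
  (obd e X : cell P n) j e' =
  if j < n then X j e' else if j == n then X j e else fset0.
Proof. by []. Qed.

Lemma cell_bd_lt n (X : ocell (Cell P) n.+1) e j e' : j < n ->
  (obd e X : cell P n) j e' = X j e'.
Proof. by rewrite cell_bd => ->. Qed.

Lemma cell_bd_eq n (X : ocell (Cell P) n.+1) e e' :
  (obd e X : cell P n) n e' = X n e.
Proof. by rewrite cell_bd ltnn eqxx. Qed.

Lemma cell_composable n i (X Y : ocell (Cell P) n) :
  ocomposable i X Y <-> i < n /\ fcmp i X Y.
Proof.
elim: n X Y => [|n IH] X Y; first by split=> // -[].
rewrite ocomposableS; case: eqP => [->|/eqP ni].
  split=> [h|[_ [h1 h2]]].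
    have h' j e : (obd true X : cell P n) j e = (obd false Y : cell P n) j e.
      exact: (congr1 (fun Z : cell P n => Z j e) h).
    split=> //; split=> [j e jn|].
      by rewrite -(cell_bd_lt X true) // h' cell_bd_lt.
    by rewrite -(cell_bd_eq X true true) h' cell_bd_eq.
  apply: cell_eq => j e; rewrite !cell_bd; case: ltnP => [jn|_]; first exact: h1.
  by case: eqP => // ->.
rewrite IH ltnS [i <= n]leq_eqVlt (negPf ni) /=.
split=> -[il [h1 h2]]; split=> //; split.
- move=> j e ji; have jn := ltn_trans ji il.
  by have := h1 j e ji; rewrite !pbd_face_lt.
- by move: h2; rewrite !pbd_face_lt.
- by move=> j e ji; have jn := ltn_trans ji il; rewrite !pbd_face_lt // h1.
- by rewrite !pbd_face_lt.
Qed.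

Lemma cell_idbd n e i (X : ocell (Cell P) n) j e' : i < n ->
  (oidbd e i X : cell P n) j e' =
  if j < i then X j e' else if j == i then X j e else fset0.
Proof.
elim: n X => // n IH X; rewrite ltnS leq_eqVlt => /orP[/eqP ->|il] /=.
  by rewrite eqxx.
rewrite (ltn_eqF il); have := IH (obd e X) il => /= ->.
case: ltnP => [ji|ij]; first by rewrite /pbd_face (ltn_trans ji il).
by case: eqP => // ->; rewrite /pbd_face il.
Qed.

Hypothesis hP : torsion_free_complex P.
Let gP := torsion_free_gluable hP.

Lemma cell_comp_ex n i (X Y : ocell (Cell P) n) : i < n -> fcmp i X Y ->
  exists Z, ocomp i X Y Z.
Proof.
move=> ln c.
have [Z hZ] := cell_of_fcell (fcomp_cell gP ln (cell_fcell X) (cell_fcell Y) c).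
by exists Z; apply/cell_compP.
Qed.

(** Existence of composites is gluing, through [fcomp_cell]; the other laws are compared component
    by component, with unions above the dimension of composition. *)
Lemma Cell_strict : ostrict (Cell P).
Proof.
split.
- move=> n X e; apply: cell_eq => j e'; rewrite [LHS]cell_bd [RHS]cell_bd.
  case: ltnP => [jn|nj]; first by rewrite !cell_bd_lt // leqW.
  by case: eqP => // ->; rewrite !cell_bd_lt.
- move=> n e X; apply: cell_eq => j e'; rewrite cell_bd.
  case: ltngtP => [//|nj|->] /=; first by rewrite pface_out.
  by rewrite !cell_top.
- by move=> i x y z /cell_compP[].
- move=> n i X Y; rewrite cell_composable; split.
    by move=> [Z /cell_compP[]].
  by move=> [ln c]; exact: cell_comp_ex.
- move=> n i X Y Z Z' /cell_compP[_ _ h] /cell_compP[_ _ h'].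
  by apply: cell_eq => j e; rewrite h h'.
- move=> n i X Y Z /cell_compP[ln [c1 c2] h]; case: eqP => [ni|/eqP ni].
    subst i; split; apply: cell_eq => j e; rewrite !cell_bd h.
      case: ltngtP => [jn|//|->]; first by rewrite fcomp_lt.
      by rewrite fcomp_eq.
    case: ltngtP => [jn|//|->]; first by rewrite fcomp_lt // c1.
    by rewrite fcomp_eq.
  have il : i < n by rewrite ltn_neqAle ni.
  move=> e; apply/cell_compP; split=> //.
    split=> [j e' ji|]; last by rewrite !cell_bd_lt.
    by have jn := ltn_trans ji il; rewrite !cell_bd_lt // c1.
  apply: fam_eq => j e'; rewrite cell_bd h; case: ltngtP => [jn|nj|->].
  + by rewrite /fcomp !cell_bd_lt.
  + rewrite fcomp_gt; last exact: ltn_trans nj.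
    by rewrite !cell_bd !(ltnNge j) (ltnW nj) /= !(gtn_eqF nj) fsetU0.
  + by rewrite !fcomp_gt // !cell_bd_eq.
- move=> n i X ln; apply/cell_compP; split=> //.
    by split=> [j e ji|]; rewrite cell_idbd // ?ji // ltnn eqxx.
  apply: fam_eq => j e; have [ji|ij|->] := ltngtP j i.
  + by rewrite fcomp_lt // cell_idbd // ji.
  + by rewrite fcomp_gt // cell_idbd // ltnNge (ltnW ij) /= (gtn_eqF ij) fset0U.
  + by rewrite fcomp_eq cell_idbd // ltnn eqxx; case: e.
- move=> n i X ln; apply/cell_compP; split=> //.
    by split=> [j e ji|]; rewrite cell_idbd // ?ji // ltnn eqxx.
  apply: fam_eq => j e; have [ji|ij|->] := ltngtP j i.
  + by rewrite fcomp_lt.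
  + by rewrite fcomp_gt // cell_idbd // ltnNge (ltnW ij) /= (gtn_eqF ij) fsetU0.
  + by rewrite fcomp_eq cell_idbd // ltnn eqxx; case: e.
- move=> n i x y z u v w /cell_compP[ln [c1 c2] hu] /cell_compP[_ [d1 d2] hw].
  move=> /cell_compP[_ _ hv]; apply/cell_compP; split=> //.
    split=> [j e ji|]; first by rewrite hv fcomp_lt // c1.
    by rewrite hv fcomp_eq.
  rewrite hw; apply: fam_eq => j e; have [ji|ij|->] := ltngtP j i.
  + by rewrite !fcomp_lt // hu fcomp_lt.
  + by rewrite !fcomp_gt // hu hv !fcomp_gt // fsetUA.
  + by rewrite !fcomp_eq hu hv !fcomp_eq.
- move=> n i x y z /cell_compP[ln c h]; apply/cell_compP; split=> //.
  exact: leqW.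
- move=> n i j x x' y y' a b p q c ij /cell_compP[li f1 ha].
  move=> /cell_compP[_ f2 hb] /cell_compP[lj f3 hc].
  move=> /cell_compP[_ f4 hp] /cell_compP[_ f5 hq]; apply/cell_compP; split=> //.
    split=> [l e l_i|]; rewrite hp hq !fcomp_lt ?(ltn_trans l_i ij) //.
      exact: f1.1.
    exact: f1.2.
  rewrite hc; apply: fam_eq => l e; have [l_i|il|->] := ltngtP l i.
  + have l_j := ltn_trans l_i ij.
    by rewrite !fcomp_lt // ha hp !fcomp_lt.
  + rewrite [RHS]fcomp_gt //; have [l_j|jl|->] := ltngtP l j.
    * by rewrite fcomp_lt // ha hp hq fcomp_gt // !fcomp_lt.
    * by rewrite fcomp_gt // ha hb hp hq !fcomp_gt // fsetUACA.
    * by rewrite fcomp_eq ha hb hp hq !fcomp_eq !fcomp_gt //; case: e.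
  + by rewrite fcomp_lt // ha hp hq !fcomp_eq !fcomp_lt.
Qed.

End CellCategory.

(** * Freeness of the category of cells *)

(** Lexicographic order with the highest index most significant: below the index that decreases, the
    measures are unrestricted. *)
Lemma lex_ind (N : nat) (T : Type) (m : T -> nat -> nat) (Q : T -> Prop) :
  (forall x, (forall y, (exists2 j, j < N &
      (forall l, j < l -> m y l <= m x l) /\ m y j < m x j) -> Q y) -> Q x) ->
  forall x, Q x.
Proof.
elim: N Q => [|N IH] Q h x; first by apply: h => y [].
suff H c : forall x, m x N <= c -> Q x by exact: H (leqnn _).
elim/ltn_ind: c {x} => c IHc.
apply: IH => x hx mc; apply: h => y [j]; rewrite ltnS leq_eqVlt.
move=> /orP[/eqP ->|jN] [h1 h2].
  by apply: (IHc (m y N)) => //; exact: leq_trans h2 mc.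
apply: hx; first by exists j.
by apply: leq_trans mc; exact: h1.
Qed.

Lemma composable_idbd m (B : precat m) i (x y : cells B) :
  composable i x y -> idbd true i x = idbd false i y.
Proof.
elim: m B x y => // m IH B x y /=; case: eqP => [_ ->//|_ h].
by congr ide; exact: IH.
Qed.

Section Generation.

Variables (P : hypergraph) (hP : torsion_free_complex P) (n : nat).
Let gP := torsion_free_gluable hP.
Let hC := Cell_strict hP.

Definition atomc k (u : P k) : ocell (Cell P) k := MkCell (relevance hP u).

Lemma cell_ex X : fcell n.+1 X -> exists x : ocell (Cell P) n.+1, X = x.
Proof. by move=> /cell_of_fcell[c <-]; exists c. Qed.

Implicit Types X Y Z A B C : ocell (Cell P) n.+1.

Definition triv i X : Prop := forall l e, i < l -> X l e = fset0.

(** A non-empty set has a non-empty net source one dimension lower, so emptiness spreads upwards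
    from the source in dimension [i.+1]; the target there then equals the source. *)
Lemma trivP i X : X i.+1 false = fset0 -> triv i X.
Proof.
move=> h0; have [sX tX oX] := cell_fcell X.
have step l : X l false = fset0 -> forall e, X l.+1 e = fset0.
  move=> h e; have [ln|ln] := ltnP l n.+1; last by apply: oX; exact: ln.
  apply/eqP; have [//|S0] := eqVneq (X l.+1 e) fset0.
  have /fset0Pn[y yS] := sbdD_ne hP false S0.
  by have := moves_sub (sph_moves e (ln : l.+1 < n.+2) sX) yS; rewrite h.
have all d e : X (d + i.+2)%N e = fset0.
  by elim: d e => [|d IH] e; apply: step.
move=> l e; rewrite leq_eqVlt => /orP[/eqP <-|il]; last by rewrite -(subnK il).
case: e => //; have [ln|ln] := ltnP i.+1 n.+1.
  have := sph_moves true (ln : i.+2 < n.+2) sX; rewrite (all 0) => /moves_act ->.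
  by rewrite h0 /act !sbd0 fsetU0 fsetD0.
move: ln; rewrite leq_eqVlt => /orP[/eqP h|h]; last exact: oX.
by move: h0; rewrite -h tX.
Qed.

Lemma triv_dec i X : triv i X \/ X i.+1 false != fset0.
Proof.
by case: (eqVneq (X i.+1 false) fset0) => h; [left; exact: trivP|right].
Qed.

Lemma triv_top i X : i <= n.+1 -> triv i X -> X i true = X i false.
Proof.
move=> li t; have [sX tX oX] := cell_fcell X.
move: li; rewrite leq_eqVlt => /orP[/eqP ->|ln]; first exact/esym/tX.
have := sph_moves true (ln : i.+1 < n.+2) sX; rewrite t // => /moves_act ->.
by rewrite /act !sbd0 fsetU0 fsetD0.
Qed.

Lemma triv_idbd i e X : i <= n -> triv i X -> X = oidbd e i X.
Proof.
move=> li t; apply: cell_eq => j e'; rewrite cell_idbd //.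
case: ltngtP => // [ij|->]; first exact: t.
by have h := triv_top (leqW li) t; case: e; case: e'; rewrite ?h.
Qed.

Definition mes X l : nat := #|` X l false|.
Definition smaller Y X : Prop := exists2 j, j < n.+2 &
  (forall l, j < l -> mes Y l <= mes X l) /\ mes Y j < mes X j.

Lemma smaller_trans X Y Z : smaller X Y -> smaller Y Z -> smaller X Z.
Proof.
move=> [j jn [h1 h2]] [k kn [h3 h4]]; have [jk|jk|jk] := ltngtP j k.
- exists k => //; split=> [l kl|].
    by apply: (leq_trans (h1 l _) (h3 l kl)); exact: ltn_trans kl.
  exact: leq_ltn_trans (h1 k jk) h4.
- exists j => //; split=> [l jl|].
    by apply: (leq_trans (h1 l jl) (h3 l _)); exact: ltn_trans jl.
  exact: leq_trans h2 (h3 j jk).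
- subst k; exists j => //; split=> [l jl|]; first exact: leq_trans (h1 l jl) (h3 l jl).
  exact: ltn_trans h2 h4.
Qed.

Lemma comp_sub i X Y Z l e : ocomp i X Y Z -> i < l ->
  {subset X l e <= Z l e} /\ {subset Y l e <= Z l e}.
Proof.
move=> /cell_compP[_ _ ->] il; rewrite fcomp_gt //.
by split=> y h; rewrite in_fsetU h ?orbT.
Qed.

Lemma comp_disj i X Y Z l e e' : ocomp i X Y Z -> i < l -> dis (X l e) (Y l e').
Proof.
move=> /cell_compP[ln c _] il.
have [sX _ oX] := cell_fcell X; have [sY _ _] := cell_fcell Y.
have [lN|lN] := leqP l n.+1; first exact: (comp_dis gP e e' ln sX sY c il lN).
by move=> y; rewrite oX.
Qed.

Lemma fcard_le (T : choiceType) (S S' : {fset T}) :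
  {subset S <= S'} -> #|` S| <= #|` S'|.
Proof. by move=> h; apply: fsubset_leq_card; apply/fsubsetP. Qed.

Lemma comp_smaller i X Y Z : ocomp i X Y Z ->
  X i.+1 false != fset0 -> Y i.+1 false != fset0 ->
  smaller X Z /\ smaller Y Z.
Proof.
move=> c /fset0Pn[x xX] /fset0Pn[y yY]; have [ln _ _] := (cell_compP _ _ _ _).1 c.
have d := comp_disj false false c (leqnn i.+1).
have sub l := comp_sub (l := l) false c.
split; exists i.+1 => //; split.
- by move=> l il; apply: fcard_le; exact: (sub _ (ltnW il)).1.
- apply: (fcard_lt (x := y)); [exact: (sub _ _).1|exact: (sub _ _).2|].
  by have := d y; rewrite yY andbT.
- by move=> l il; apply: fcard_le; exact: (sub _ (ltnW il)).2.
- apply: (fcard_lt (x := x)); [exact: (sub _ _).2|exact: (sub _ _).1|].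
  by have := d x; rewrite xX.
Qed.

Lemma ocomp_fun i X Y Z Z' : ocomp i X Y Z -> ocomp i X Y Z' -> Z = Z'.
Proof. exact: (ostrict_comp_fun hC). Qed.

Lemma ocomp_ex i X Y : i <= n -> fcmp i X Y -> exists Z, ocomp i X Y Z.
Proof. by move=> li; exact: cell_comp_ex. Qed.

Lemma ocomp_unitr i X Y Z : ocomp i X Y Z -> triv i Y -> Z = X.
Proof.
move=> /cell_compP[ln [c1 c2] h] t; apply: cell_eq => l e; rewrite h.
have [li|il|->] := ltngtP l i; first by rewrite fcomp_lt.
  by rewrite fcomp_gt // t // fsetU0.
by rewrite fcomp_eq; case: e => //; rewrite triv_top // ltnW.
Qed.

Lemma ocomp_unitl i X Y Z : ocomp i X Y Z -> triv i X -> Z = Y.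
Proof.
move=> /cell_compP[ln [c1 c2] h] t; apply: cell_eq => l e; rewrite h.
have [li|il|->] := ltngtP l i; first by rewrite fcomp_lt // c1.
  by rewrite fcomp_gt // t // fset0U.
by rewrite fcomp_eq; case: e => //; rewrite -c2 triv_top // ltnW.
Qed.

(** Going down by net boundaries, the factor that contains [u] contains every component of the atom
    above [i]; the other one is disjoint from it, hence trivial. *)
Lemma atom_indec (u : P n.+1) i X Y : ocomp i X Y (atomc u) ->
  triv i X \/ triv i Y.
Proof.
move=> c; have [ln cXY h] := (cell_compP _ _ _ _).1 c.
have step (V W : ocell (Cell P) n.+1) : (forall l e, i < l -> {subset V l e <= atom u l e}) ->
    (forall l e, i < l -> dis (V l e) (W l e)) ->
    (forall l e, i < l -> {subset W l e <= atom u l e}) ->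
    u \in V n.+1 true -> triv i W.
  move=> sV d sW uV; have [sphV tV oV] := cell_fcell V.
  have all k : i < n.+1 - k -> forall e, V (n.+1 - k)%N e = atom u (n.+1 - k)%N e.
    elim: k => [|k IH] ik e.
      rewrite subn0 atom_self; apply/fsetP => y; apply/idP/idP.
        by move/(sV _ _ ln); rewrite atom_self.
      by rewrite inE => /eqP ->; case: e; rewrite ?tV.
    have kn : k < n.+1 by lia.
    have ik' : i < n.+1 - k by lia.
    apply/fsetP => y; apply/idP/idP; first exact: sV.
    rewrite atom_step; last by rewrite ltnS leq_subLR; exact: leq_addl.
    have e1 : (n.+1 - k.+1).+1 = (n.+1 - k)%N := subnSK kn.
    have V1 : V (n.+1 - k.+1).+1 e = atom u (n.+1 - k.+1).+1 e.
      by move: (IH ik' e); rewrite -e1.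
    rewrite -V1; have lt : (n.+1 - k.+1).+1 < n.+2 by rewrite e1 ltnS leq_subr.
    have mv := sph_moves e lt sphV.
    by case: e mv {V1} => mv; [exact: (moves_subr mv)|exact: (moves_sub mv)].
  apply: trivP; apply/fsetP => y; rewrite in_fset0; apply/negbTE/negP => yW.
  have h2 := all (n - i)%N; have e2 : (n.+1 - (n - i) = i.+1)%N by lia.
  move: h2; rewrite e2 => /(_ (leqnn _) false) h2.
  by have := d i.+1 false (leqnn _) y; rewrite h2 (sW _ _ _ _ yW) // yW.
have sX l e : i < l -> {subset X l e <= atom u l e} by move=> il; exact: (comp_sub e c il).1.
have sY l e : i < l -> {subset Y l e <= atom u l e} by move=> il; exact: (comp_sub e c il).2.
have d l e : i < l -> dis (X l e) (Y l e) by exact: comp_disj c.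
have uA : u \in atom u n.+1 true by rewrite atom_self inE.
have : u \in fcomp i X Y n.+1 true by rewrite -h; exact: uA.
rewrite fcomp_gt // in_fsetU => /orP[uX|uY]; [right|left].
  exact: step uX.
by apply: step uY => // l e il; apply: disC; exact: d.
Qed.

End Generation.

(** * The subcategory generated by atoms and identities *)

Section Graph.

Variables (P : hypergraph) (hP : torsion_free_complex P) (n : nat).
Variables (E : ncat n.+1) (f : ocell (Cell P) n -> cells (trunc E)).
Variable g : P n.+1 -> cells E.
Hypothesis f_comp : forall i (x y z : ocell (Cell P) n),
  ocomp i x y z -> comp i (f x) (f y) (f z).
Hypothesis f_idbd : forall e i (x : ocell (Cell P) n),
  f (oidbd e i x) = idbd e i (f x).
Hypothesis g_bd : forall e u, bd e (g u) = f (obd e (atomc hP u)).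

Let gP := torsion_free_gluable hP.
Let hC := Cell_strict hP.
Let hE := proj2 (nstrict E).
Let hE0 : strict (trunc E) := proj1 (nstrict E).

Notation T := (ocell (Cell P) n.+1).
Implicit Types X Y Z A B C : T.
Implicit Types x y z : cells E.

(* The graph of the unique functor extending f and g. *)
Inductive gen : T -> cells E -> Prop :=
| gen_atom u : gen (atomc hP u) (g u)
| gen_id (X : ocell (Cell P) n) : gen (oide X) (ide (f X))
| gen_comp i X Y Z x y z : ocomp i X Y Z -> comp i x y z ->
    gen X x -> gen Y y -> gen Z z.

Lemma gen_bd X x e : gen X x -> bd e x = f (obd e X).
Proof.
elim=> [u|X0|i X0 Y0 Z0 x0 y0 z0 c c' _ IH1 _ IH2]; first exact: g_bd.
  by rewrite (bd_ide hE) (ostrict_bd_ide hC).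
have := bd_comp hE c'; have := ostrict_bd_comp hC c; case: eqP => _.
  by move=> [h1 h2] [h3 h4]; case: e IH1 IH2 => IH1 IH2; rewrite ?h1 ?h2 ?h3 ?h4.
move=> h1 /(_ e); rewrite IH1 IH2 => h2.
exact: (Defs.FreeExistence.comp_uniq hE0 h2 (f_comp (h1 e))).
Qed.

Lemma gen_comp_ex i X Y Z x y : ocomp i X Y Z -> gen X x -> gen Y y ->
  exists2 z, comp i x y z & gen Z z.
Proof.
move=> c hx hy.
suff /(comp_dom hE)[z hz] : composable i x y by exists z => //; exact: (gen_comp c hz hx hy).
have /(ostrict_comp_dom hC) : exists Z, ocomp i X Y Z by exists Z.
rewrite ocomposableS /=; case: eqP => _.
  by rewrite (gen_bd true hx) (gen_bd false hy) => h; congr f.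
rewrite (gen_bd true hx) (gen_bd false hy) => /cell_composable[ln c'].
have [W /f_comp hW] := cell_comp_ex hP ln c'.
exact: ((Defs.FreeExistence.comp_lt hE0 hW).2).
Qed.

(** If the top of a composite is empty, so are the tops of both factors, and composites of
    identities are identities; for [i = n] the factors are identities of the same cell, and a unit
    law applies. *)
Lemma gen_id_inv X x : gen X x -> X n.+1 true = fset0 ->
  X = oide (obd true X) /\ x = ide (f (obd true X)).
Proof.
elim=> [u|X0|i X0 Y0 Z0 x0 y0 z0 c c' _ IH1 _ IH2] h.
- have := in_fset0 u; rewrite -h.
  by have -> : (atomc hP u : fam P) = atom u by []; rewrite atom_self inE eqxx.
- by rewrite (ostrict_bd_ide hC).
have [li cXY hZ] := (cell_compP _ _ _ _).1 c.
have [hX hY] : X0 n.+1 true = fset0 /\ Y0 n.+1 true = fset0.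
  by move: h; rewrite hZ fcomp_gt // => /eqP; rewrite fsetU_eq0 => /andP[/eqP-> /eqP->].
have [eX ex] := IH1 hX; have [eY ey] := IH2 hY.
have := ostrict_bd_comp hC c; case: eqP => [ni|/eqP ni].
  move=> [_ b2]; subst i.
  have tX : triv n X0 by apply: (trivP hP); rewrite -hX; have [_ ->] := cell_fcell X0.
  have eZ := ocomp_unitl c tX; subst Z0; split=> //.
  have e1 : obd true X0 = obd true Y0.
    have [_ [c1 c2] _] := (cell_compP _ _ _ _).1 c.
    rewrite eY (ostrict_bd_ide hC) eX (ostrict_bd_ide hC).
    apply: cell_eq => j e; rewrite !cell_bd; case: ltnP => [jn|_]; first exact: c1.
    case: eqP => // ->; rewrite c2; have [sY _ _] := cell_fcell Y0.
    by have tY : triv n Y0; [apply: (trivP hP); rewrite -hY; have [_ ->] := cell_fcell Y0|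
      rewrite (triv_top (leqnSn n) tY)].
  have := comp_idl hE x0 (leqnn n).
  have -> : idbd false n x0 = x0.
    by rewrite /= eqxx ex (bd_ide hE).
  move=> c0; have exy : x0 = y0 by rewrite ex ey e1.
  by rewrite -ey; apply: (comp_fun hE c'); rewrite -exy.
have il : i < n by rewrite ltn_neqAle ni.
move=> /(_ true) b.
have b' : ocomp i X0 Y0 (oide (obd true Z0)).
  by rewrite eX eY; exact: (ostrict_comp_ide hC).
split; first exact: ostrict_comp_fun hC _ _ _ _ _ _ c b'.
apply: (comp_fun hE c'); rewrite ex ey.
exact: (comp_ide hE (f_comp b)).
Qed.

Lemma gen_triv i e X x : i <= n -> gen X x -> triv i X ->
  X = oidbd e i X /\ x = idbd e i x.
Proof.
move=> li hx t; have eX := triv_idbd e li t; split=> //.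
have [_ ex] := gen_id_inv hx (t _ _ (li : i < n.+1)).
rewrite [LHS]ex idbdS (gen_bd e hx) -f_idbd -(fun_if f); congr (ide (f _)).
have -> : obd true X = obd true (oidbd e i X) by rewrite -eX.
by rewrite oidbdS (ostrict_bd_ide hC).
Qed.

Lemma gen_idbd i e X x : gen X x -> gen (oidbd e i X) (idbd e i x).
Proof.
move=> hx; rewrite oidbdS idbdS (gen_bd e hx) -f_idbd -(fun_if f).
exact: gen_id.
Qed.

Lemma gen_unitr i X Y Z x y z : i <= n -> ocomp i X Y Z -> comp i x y z ->
  gen Y y -> triv i Y -> Z = X /\ z = x.
Proof.
move=> li c c' hy t; split; first exact: ocomp_unitr c t.
have [_ ey] := gen_triv false li hy t; apply: (comp_fun hE c').
have /(comp_dom hE)/composable_idbd h : exists z, comp i x y z by exists z.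
rewrite ey -h; exact: (comp_idr hE x li).
Qed.

Lemma gen_unitl i X Y Z x y z : i <= n -> ocomp i X Y Z -> comp i x y z ->
  gen X x -> triv i X -> Z = Y /\ z = y.
Proof.
move=> li c c' hx t; split; first exact: ocomp_unitl c t.
have [_ ex] := gen_triv true li hx t; apply: (comp_fun hE c').
have /(comp_dom hE)/composable_idbd h : exists z, comp i x y z by exists z.
rewrite ex h; exact: (comp_idl hE y li).
Qed.

(** With this property, the value over a composite can be computed along any one chosen
    decomposition. *)
Definition lifts X x : Prop := forall i Y Z, ocomp i Y Z X ->
  exists y z, [/\ gen Y y, gen Z z & comp i y z x].

Lemma ocomp_le i X Y Z : ocomp i X Y Z -> i <= n.
Proof. by move=> /cell_compP[]. Qed.

Lemma lifts_triv i X x Y Z : gen X x -> ocomp i Y Z X ->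
  triv i Y \/ triv i Z -> exists y z, [/\ gen Y y, gen Z z & comp i y z x].
Proof.
move=> hx c; have li := ocomp_le c.
have [_ cm _] := (cell_compP _ _ _ _).1 c; case=> t.
  have eX := ocomp_unitl c t; subst Z.
  exists (idbd false i x), x; split=> //; last exact: (comp_idl hE).
  suff -> : Y = oidbd false i X by exact: gen_idbd.
  rewrite [LHS](triv_idbd true li t); apply: cell_eq => j e'.
  rewrite !cell_idbd //; case: ltngtP => // [ji|->]; first exact: cm.1.
  exact: cm.2.
have eX := ocomp_unitr c t; subst Y.
exists x, (idbd true i x); split=> //; last exact: (comp_idr hE).
suff -> : Z = oidbd true i X by exact: gen_idbd.
rewrite [LHS](triv_idbd false li t); apply: cell_eq => j e'.
rewrite !cell_idbd //; case: ltngtP => // [ji|->]; first by rewrite cm.1.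
by rewrite cm.2.
Qed.

(** The common refinement is a square of four cells. Two of its sides lift by [L1] and [L2], the
    lifted pieces are composed the other way, and the exchange law in [E] gives back [x]. *)
Lemma lift_lt i j X1 X2 X x1 x2 x Y Z : i < j ->
  ocomp j X1 X2 X -> comp j x1 x2 x -> lifts X1 x1 -> lifts X2 x2 ->
  ocomp i Y Z X -> exists y z, [/\ gen Y y, gen Z z & comp i y z x].
Proof.
move=> ij c c' L1 L2 cYZ.
have [lj f12 eX] := (cell_compP _ _ _ _).1 c.
have [li fYZ eX'] := (cell_compP _ _ _ _).1 cYZ.
have eq : fcomp i Y Z = fcomp j X1 X2 by rewrite -eX.
have [Y1 [Y2 [Z1 [Z2 [[d1 d2 d3 d4] [f1 f2 f3 f4] [e1 e2] [e3 e4]]]]]] :=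
  refine_lt gP ij lj (cell_fcell Y) (cell_fcell Z) (cell_fcell X1)
    (cell_fcell X2) fYZ f12 eq.
have [A1 A1E] := cell_ex d1; have [A2 A2E] := cell_ex d2.
have [B1 B1E] := cell_ex d3; have [B2 B2E] := cell_ex d4; subst Y1 Y2 Z1 Z2.
have k1 : ocomp i A1 A2 X1 by apply/cell_compP.
have k2 : ocomp i B1 B2 X2 by apply/cell_compP.
have k3 : ocomp j A1 B1 Y by apply/cell_compP.
have k4 : ocomp j A2 B2 Z by apply/cell_compP.
have [a1 [a2 [ha1 ha2 ca]]] := L1 i _ _ k1.
have [b1 [b2 [hb1 hb2 cb]]] := L2 i _ _ k2.
have [y cy hy] := gen_comp_ex k3 ha1 hb1.
have [z cz hz] := gen_comp_ex k4 ha2 hb2.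
by exists y, z; split=> //; exact: (comp_exchange hE ij ca cb c' cy cz).
Qed.

(** The square of [lift_lt] with the dimensions interchanged: here the exchange law starts from the
    composite of the new factors, which must first be shown to exist. *)
Lemma lift_gt i j X1 X2 X x1 x2 x Y Z : j < i ->
  ocomp j X1 X2 X -> comp j x1 x2 x -> lifts X1 x1 -> lifts X2 x2 ->
  ocomp i Y Z X -> exists y z, [/\ gen Y y, gen Z z & comp i y z x].
Proof.
move=> ji c c' L1 L2 cYZ.
have [lj f12 eX] := (cell_compP _ _ _ _).1 c.
have [li fYZ eX'] := (cell_compP _ _ _ _).1 cYZ.
have eq : fcomp j X1 X2 = fcomp i Y Z by rewrite -eX.
have [Y1 [Y2 [Z1 [Z2 [[d1 d2 d3 d4] [f1 f2 f3 f4] [e1 e2] [e3 e4]]]]]] :=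
  refine_lt gP ji li (cell_fcell X1) (cell_fcell X2) (cell_fcell Y)
    (cell_fcell Z) f12 fYZ eq.
have [A1 A1E] := cell_ex d1; have [A2 A2E] := cell_ex d2.
have [B1 B1E] := cell_ex d3; have [B2 B2E] := cell_ex d4; subst Y1 Y2 Z1 Z2.
have k1 : ocomp i A1 B1 X1 by apply/cell_compP.
have k2 : ocomp i A2 B2 X2 by apply/cell_compP.
have k3 : ocomp j A1 A2 Y by apply/cell_compP.
have k4 : ocomp j B1 B2 Z by apply/cell_compP.
have [a1 [b1 [ha1 hb1 c1]]] := L1 i _ _ k1.
have [a2 [b2 [ha2 hb2 c2]]] := L2 i _ _ k2.
have [y cy hy] := gen_comp_ex k3 ha1 ha2.
have [z cz hz] := gen_comp_ex k4 hb1 hb2.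
have [x' cx' _] := gen_comp_ex cYZ hy hz.
exists y, z; split=> //.
by rewrite -(comp_fun hE (comp_exchange hE ji cy cz cx' c1 c2) c').
Qed.

Lemma gen_interchange i l B1 B2 C1 C2 X1 X2 X b1 b2 c1 c2 x1 x2 x : i < l ->
  ocomp l B1 B2 X1 -> ocomp l C1 C2 X2 -> ocomp i X1 X2 X ->
  gen B1 b1 -> gen B2 b2 -> gen C1 c1 -> gen C2 c2 ->
  comp l b1 b2 x1 -> comp l c1 c2 x2 -> comp i x1 x2 x ->
  exists U V u v, [/\ ocomp i B1 C1 U, ocomp i B2 C2 V, ocomp l U V X
    & [/\ gen U u, gen V v & comp l u v x]].
Proof.
move=> il cX1 cX2 cX hb1 hb2 hc1 hc2 cx1 cx2 cx.
have [ll [fB1 fB2] eX1] := (cell_compP _ _ _ _).1 cX1.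
have [_ [fC1 fC2] eX2] := (cell_compP _ _ _ _).1 cX2.
have [li [fX1 fX2] eX] := (cell_compP _ _ _ _).1 cX.
have XB j e : j < l -> X1 j e = B1 j e by move=> jl; rewrite eX1 fcomp_lt.
have XC j e : j < l -> X2 j e = C1 j e by move=> jl; rewrite eX2 fcomp_lt.
have [|U cU] := ocomp_ex hP (X := B1) (Y := C1) (li : i <= n).
  split=> [j e ji|]; last by rewrite -XB // -XC.
  by have jl := ltn_trans ji il; rewrite -XB // -XC // fX1.
have [|V cV] := ocomp_ex hP (X := B2) (Y := C2) (li : i <= n).
  split=> [j e ji|]; last by rewrite -fB1 // -fC1 // -XB // -XC.
  by have jl := ltn_trans ji il; rewrite -fB1 // -fC1 // -XB // -XC // fX1.
have [_ _ eU] := (cell_compP _ _ _ _).1 cU.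
have [_ _ eV] := (cell_compP _ _ _ _).1 cV.
have [|W cW] := ocomp_ex hP (X := U) (Y := V) (ll : l <= n).
  split=> [j e jl|]; last by rewrite eU eV !fcomp_gt // fB2 fC2.
  by rewrite eU eV /fcomp !fB1 // !fC1.
have eW := ocomp_fun hP (ostrict_exchange hC il cU cV cW cX1 cX2) cX; subst W.
have [u cu hu] := gen_comp_ex cU hb1 hc1.
have [v cv hv] := gen_comp_ex cV hb2 hc2.
have [w cw hw] := gen_comp_ex cW hu hv.
exists U, V, u, v; split=> //; split=> //.
by rewrite -(comp_fun hE (comp_exchange hE il cu cv cw cx1 cx2) cx).
Qed.

Definition lifts_below X : Prop :=
  forall Y y, smaller Y X -> gen Y y -> lifts Y y.

(** Only the middle piece [W], which is [B] then [C] and also [C'] then [B'], remains to be lifted.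
    It is smaller than [X] unless [A] and [D] are both trivial; in that case the two decompositions
    have the same factors above [i] in opposite orders. *)
Lemma lift_eq i X1 X2 X x1 x2 x Y Z : lifts_below X ->
  ocomp i X1 X2 X -> comp i x1 x2 x -> gen X1 x1 -> gen X2 x2 ->
  X1 i.+1 false != fset0 -> X2 i.+1 false != fset0 -> ocomp i Y Z X ->
  (exists y z, [/\ gen Y y, gen Z z & comp i y z x]) \/
  (forall l e, i < l -> X1 l e = Z l e /\ X2 l e = Y l e).
Proof.
move=> IH c c' h1 h2 n1 n2 cYZ; have li := ocomp_le c.
have [li' f12 eX] := (cell_compP _ _ _ _).1 c.
have [_ fYZ eX'] := (cell_compP _ _ _ _).1 cYZ.
have eq : fcomp i X1 X2 = fcomp i Y Z by rewrite -eX.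
have [A0 [B0 [C0 [D0 [B0' [C0' [[d1 d2 d3 d4 [d5 d6]]
   [f1 f2 f3 f4 [f5 f6]] [e1 e2 e3 e4] eW same]]]]]]] :=
  refine_eq gP li' (cell_fcell X1) (cell_fcell X2) (cell_fcell Y)
    (cell_fcell Z) f12 fYZ eq.
have [A AE] := cell_ex d1; have [B BE] := cell_ex d2.
have [C CE] := cell_ex d3; have [D DE] := cell_ex d4.
have [B' BE'] := cell_ex d5; have [C' CE'] := cell_ex d6.
subst A0 B0 C0 D0 B0' C0'.
have k1 : ocomp i A B X1 by apply/cell_compP.
have k2 : ocomp i C D X2 by apply/cell_compP.
have k3 : ocomp i A C' Y by apply/cell_compP.
have k4 : ocomp i B' D Z by apply/cell_compP.
have [s1 s2] := comp_smaller hP c n1 n2.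
have [a [b [ha hb cab]]] := IH _ _ s1 h1 _ _ _ k1.
have [c0 [d [hc hd ccd]]] := IH _ _ s2 h2 _ _ _ k2.
have [W cW] := ocomp_ex hP li f5.
have [_ _ eW'] := (cell_compP _ _ _ _).1 cW.
have cW' : ocomp i C' B' W by apply/cell_compP; split=> //; rewrite eW'.
have [w cw hw] := gen_comp_ex cW hb hc.
have [|V cV] := ocomp_ex hP (X := W) (Y := D) li.
  split=> [j e ji|]; first by rewrite eW' fcomp_lt // f5.1 // f2.1.
  by rewrite eW' fcomp_eq; exact: f2.2.
have finish : (exists y z, [/\ gen C' y, gen B' z & comp i y z w]) ->
    exists y z, [/\ gen Y y, gen Z z & comp i y z x].
  move=> [y0 [z0 [hy0 hz0 cyz]]].
  have [v cv _] := gen_comp_ex cV hw hd.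
  have bv := comp_assoc hE cw cv ccd.
  have av := comp_assoc hE cab c' bv.
  have [z cz hz] := gen_comp_ex k4 hz0 hd.
  have zv := comp_assoc hE cyz cv cz.
  have [y cy hy] := gen_comp_ex k3 ha hy0.
  have [x' cx' _] := gen_comp_ex cYZ hy hz.
  have ax' := comp_assoc hE cy cx' zv.
  by exists y, z; split=> //; rewrite (comp_fun hE av ax').
have [tC|nC] := triv_dec hP i C'.
  by left; apply/finish/(lifts_triv hw cW'); left.
have [tB|nB] := triv_dec hP i B'.
  by left; apply/finish/(lifts_triv hw cW'); right.
have BV := ostrict_assoc hC cW cV k2.
have AV := ostrict_assoc hC k1 c BV.
have nW : W i.+1 false != fset0.
  have /fset0Pn[y yC] := nC; apply/fset0Pn; exists y.
  exact: (comp_sub _ cW' (leqnn _)).1.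
have nV : V i.+1 false != fset0.
  have /fset0Pn[y yW] := nW; apply/fset0Pn; exists y.
  exact: (comp_sub _ cV (leqnn _)).1.
have smW : smaller W X -> exists y z, [/\ gen Y y, gen Z z & comp i y z x].
  by move=> sW; apply: finish; exact: IH sW hw _ _ _ cW'.
have [tA|nA] := triv_dec hP i A; have [tD|nD] := triv_dec hP i D.
- right=> l e il; have [q1 q2] := same l e il.
  rewrite e1 e2 e3 e4 !fcomp_gt // tA // tD //.
  by rewrite !fset0U !fsetU0.
- left; apply: smW; rewrite (ocomp_unitl AV tA).
  by have [] := comp_smaller hP cV nW nD.
- left; apply: smW; rewrite -(ocomp_unitr cV tD).
  by have [] := comp_smaller hP AV nA nV.
- left; apply: smW; have [sW _] := comp_smaller hP cV nW nD.
  by have [_ sV] := comp_smaller hP AV nA nV; exact: smaller_trans sW sV.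
Qed.

Lemma ocomp_fst_eq i Y Z Y' Z' X : ocomp i Y Z X -> ocomp i Y' Z' X ->
  (forall l e, i < l -> Y l e = Y' l e) -> Y = Y'.
Proof.
move=> /cell_compP[li _ e1] /cell_compP[_ _ e2] h.
have f0 : Y i false = Y' i false.
  by rewrite -(fcomp_eq i Y Z false) -e1 e2 fcomp_eq.
apply: cell_eq => l e; have [l_i|il|->] := ltngtP l i; last 1 first.
- case: e => //.
  apply: (det_true (e := false) li (cell_fcell Y) (cell_fcell Y')) => //.
  exact: h.
- by rewrite -(fcomp_lt Y Z e l_i) -e1 e2 fcomp_lt.
- exact: h.
Qed.

Lemma ocomp_snd_eq i Y Z Y' Z' X : ocomp i Y Z X -> ocomp i Y' Z' X ->
  (forall l e, i < l -> Z l e = Z' l e) -> Z = Z'.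
Proof.
move=> /cell_compP[li c1 e1] /cell_compP[_ c2 e2] h.
have f0 : Z i true = Z' i true.
  by rewrite -(fcomp_eq i Y Z true) -e1 e2 fcomp_eq.
apply: cell_eq => l e; have [l_i|il|->] := ltngtP l i; last 1 first.
- case: e => //.
  apply: (det_false (e := false) li (cell_fcell Z) (cell_fcell Z')) => //.
  exact: h.
- rewrite -(c1.1 _ _ l_i) -(c2.1 _ _ l_i).
  by rewrite -(fcomp_lt Y Z e l_i) -e1 e2 fcomp_lt.
- exact: h.
Qed.

Lemma gen_atom_eq X x u : gen X x -> X = atomc hP u -> x = g u.
Proof.
elim=> [v|X0|i X0 Y0 {}Z x0 y0 z0 c c' hx IH1 hy IH2] e.
- congr g; have /fsetP/(_ v) : atom v n.+1 true = atom u n.+1 true.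
    exact: (congr1 (fun Z : T => Z n.+1 true) e).
  by rewrite !atom_self !inE eqxx => /esym/eqP.
- have /fsetP/(_ u) : (oide X0 : T) n.+1 true = atom u n.+1 true.
    exact: (congr1 (fun Z : T => Z n.+1 true) e).
  have -> : (oide X0 : T) n.+1 true = fset0.
    exact: (@pface_out _ _ (X0 : cell P n) n.+1 true (leqnn _)).
  by rewrite atom_self !inE eqxx.
have li := ocomp_le c.
have [t|t] : triv i X0 \/ triv i Y0 by apply: (atom_indec (hP := hP) (u := u)); rewrite -e.
  have [eZ ->] := gen_unitl li c c' hx t.
  by apply: IH2; rewrite -eZ.
have [eZ ->] := gen_unitr li c c' hy t.
by apply: IH1; rewrite -eZ.
Qed.

Lemma splits_cells l X : l <= n -> splits n.+1 l X -> exists A B,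
  [/\ ocomp l A B X, A l.+1 false != fset0 & B l.+1 false != fset0].
Proof.
move=> ll [A0 [B0 [cA cB c e [nA nB]]]].
have [A AE] := cell_ex cA; have [B BE] := cell_ex cB; subst A0 B0.
by exists A, B; split=> //; apply/cell_compP.
Qed.

(* If neither factor of X can be decomposed in dimensions >= i, both are
   carried by atoms and torsion-freeness turns the two decompositions into an
   instance of the exchange law one dimension lower. *)
Lemma lift_swap i X1 X2 X x1 x2 x Y Z : lifts_below X ->
  ocomp i X1 X2 X -> comp i x1 x2 x -> gen X1 x1 -> gen X2 x2 ->
  X1 i.+1 false != fset0 -> X2 i.+1 false != fset0 -> ocomp i Y Z X ->
  (forall l e, i < l -> X1 l e = Z l e /\ X2 l e = Y l e) ->
  exists y z, [/\ gen Y y, gen Z z & comp i y z x].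
Proof.
move=> IH c c' h1 h2 n1 n2 cYZ same; have li := ocomp_le c.
have [li' f12 eX] := (cell_compP _ _ _ _).1 c.
have [_ fYZ eX'] := (cell_compP _ _ _ _).1 cYZ.
have [s1 s2] := comp_smaller hP c n1 n2.
have L1 := IH _ _ s1 h1; have L2 := IH _ _ s2 h2.
have ii : i < i.+1 := leqnn _.
(* A splitting of [X1] or [X2] in a dimension [l > i] makes [X] a composite in dimension [l] of
   smaller cells, which [lift_lt] handles. *)
have interchange l B1 B2 C1 C2 b1 b2 c1 c2 : i < l ->
    ocomp l B1 B2 X1 -> ocomp l C1 C2 X2 ->
    gen B1 b1 -> gen B2 b2 -> gen C1 c1 -> gen C2 c2 ->
    comp l b1 b2 x1 -> comp l c1 c2 x2 ->
    B1 l.+1 false != fset0 \/ C1 l.+1 false != fset0 ->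
    B2 l.+1 false != fset0 \/ C2 l.+1 false != fset0 ->
    exists y z, [/\ gen Y y, gen Z z & comp i y z x].
  move=> il cX1 cX2 hb1 hb2 hc1 hc2 cx1 cx2 m1 m2.
  have [U [V [u [v [cU cV cW [hu hv cw]]]]]] :=
    gen_interchange il cX1 cX2 c hb1 hb2 hc1 hc2 cx1 cx2 c'.
  have il1 : i < l.+1 := leqW il.
  have mU : U l.+1 false != fset0.
    have [q1 q2] := comp_sub false cU il1.
    by case: m1 => /fset0Pn[y hy]; apply/fset0Pn; exists y; [apply: q1|apply: q2].
  have mV : V l.+1 false != fset0.
    have [q1 q2] := comp_sub false cV il1.
    by case: m2 => /fset0Pn[y hy]; apply/fset0Pn; exists y; [apply: q1|apply: q2].
  have [sU sV] := comp_smaller hP cW mU mV.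
  exact: lift_lt il cW cw (IH _ _ sU hu) (IH _ _ sV hv) cYZ.
have k1 : i.+1 <= n.+2 by exact: leqW.
have [t1|[[l [il ln sp]]|[m [u cu]]]] := classify hP (cell_fcell X1) k1.
- by rewrite t1 ?eqxx in n1.
- have [B1 [B2 [cB m1 m2]]] := splits_cells ln sp.
  have [b1 [b2 [hb1 hb2 cb]]] := L1 _ _ _ cB.
  move: il; rewrite ltnS leq_eqVlt => /orP[/eqP il|il].
    (* For [l = i], regroup as [B1] followed by [B2] with [X2]. The second alternative of [lift_eq]
       would make [B1] and [X1] agree above [i], although [X1] also contains the disjoint non-empty
       part [B2]. *)
    subst l; have [_ [fB1 fB2] eB] := (cell_compP _ _ _ _).1 cB.
    have [|V cV] := ocomp_ex hP (X := B2) (Y := X2) li.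
      split=> [j e ji|]; first by rewrite -f12.1 // eB fcomp_lt // fB1.
      by rewrite -f12.2 eB fcomp_eq.
    have [v cv hv] := gen_comp_ex cV hb2 h2.
    have nV : V i.+1 false != fset0.
      have /fset0Pn[y yX] := n2; apply/fset0Pn; exists y.
      exact: (comp_sub _ cV ii).2.
    have cBV := ostrict_assoc hC cB c cV.
    have [//|alt] := lift_eq IH cBV (comp_assoc hE cb c' cv) hb1 hv m1 nV cYZ.
    have /fset0Pn[y yB] := m2.
    have yX : y \in X1 i.+1 false by exact: (comp_sub _ cB ii).2.
    have := comp_disj hP false false cB ii y.
    by rewrite (alt _ false ii).1 -(same _ false ii).1 yX yB.
  apply: (interchange l B1 B2 (oidbd false l X2) X2 b1 b2 (idbd false l x2) x2) => //.
  + exact: (ostrict_idl hC).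
  + exact: gen_idbd.
  + exact: (comp_idl hE).
  + by left.
  + by left.
have [t2|[[l [il ln sp]]|[m' [v cv]]]] := classify hP (cell_fcell X2) k1.
- by rewrite t2 ?eqxx in n2.
- have [C1 [C2 [cC m1 m2]]] := splits_cells ln sp.
  have [c1 [c2 [hc1 hc2 cc]]] := L2 _ _ _ cC.
  move: il; rewrite ltnS leq_eqVlt => /orP[/eqP il|il].
    subst l; have [_ [fC1 fC2] eC] := (cell_compP _ _ _ _).1 cC.
    have [|V cV] := ocomp_ex hP (X := X1) (Y := C1) li.
      split=> [j e ji|]; first by rewrite f12.1 // eC fcomp_lt.
      by rewrite f12.2 eC fcomp_eq.
    have [v0 cv0 hv0] := gen_comp_ex cV h1 hc1.
    have nV : V i.+1 false != fset0.
      have /fset0Pn[y yX] := n1; apply/fset0Pn; exists y.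
      exact: (comp_sub _ cV ii).1.
    have [_ fV eV] := (cell_compP _ _ _ _).1 cV.
    have [|W cVC] := ocomp_ex hP (X := V) (Y := C2) li.
      split=> [j e ji|]; last by rewrite eV fcomp_eq.
      by rewrite eV fcomp_lt // f12.1 // eC fcomp_lt // fC1.
    have eW := ocomp_fun hP (ostrict_assoc hC cV cVC cC) c; subst W.
    have [w cw hw] := gen_comp_ex cVC hv0 hc2.
    have ew := comp_fun hE (comp_assoc hE cv0 cw cc) c'; subst w.
    have [//|alt] := lift_eq IH cVC cw hv0 hc2 nV m2 cYZ.
    have /fset0Pn[y yC] := m1.
    have yV : y \in V i.+1 false by exact: (comp_sub _ cV ii).2.
    have := comp_disj hP false false cV ii y.
    by rewrite (same _ false ii).1 -(alt _ false ii).1 yV yC.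
  apply: (interchange l X1 (oidbd true l X1) C1 C2 x1 (idbd true l x1) c1 c2) => //.
  + exact: (ostrict_idr hC).
  + exact: gen_idbd.
  + exact: (comp_idr hE).
  + by right.
  + by right.
have same' l e : i < l -> Y l e = X2 l e /\ Z l e = X1 l e.
  by move=> il; have [-> ->] := same l e il.
have [k [B0 [B0' [C0 [C0' [ik [d1 d2 d3 d4] [f1 f2 f3 f4] [e1 e2] alt]]]]]] :=
  exchange_split hP li' (cell_fcell X1) (cell_fcell X2) (cell_fcell Y)
    (cell_fcell Z) f12 fYZ same' cu cv.
have [B1 B1E] := cell_ex d1; have [B2 B2E] := cell_ex d2.
have [C1 C1E] := cell_ex d3; have [C2 C2E] := cell_ex d4; subst B0 B0' C0 C0'.
have kn : k < n.+1 by move: li'; rewrite ik => /ltnW.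
have ki : k < i by rewrite ik.
have cB : ocomp k B1 B2 X1 by apply/cell_compP.
have cC : ocomp k C1 C2 X2 by apply/cell_compP.
have [b1 [b2 [hb1 hb2 cb]]] := L1 _ _ _ cB.
have [c1 [c2 [hc1 hc2 cc]]] := L2 _ _ _ cC.
have [U cU] := ocomp_ex hP li f3; have [V cV] := ocomp_ex hP li f4.
have [p cp hp] := gen_comp_ex cU hb1 hc1.
have [q cq hq] := gen_comp_ex cV hb2 hc2.
have cUV := ostrict_exchange hC ki cB cC c cU cV.
have cpq := comp_exchange hE ki cb cc c' cp cq.
(* Eckmann-Hilton: [X] is now [U] followed by [V] in dimension [k]. Both are padded with identities
   in dimension [i], on opposite sides, and exchanging back yields the order of [Y] and [Z]. *)
have fin U1 U2 V1 V2 u1 u2 v1 v2 : ocomp i U1 U2 U -> ocomp i V1 V2 V ->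
    gen U1 u1 -> gen U2 u2 -> gen V1 v1 -> gen V2 v2 ->
    comp i u1 u2 p -> comp i v1 v2 q ->
    (forall l e, i < l -> U1 l e `|` V1 l e = Y l e /\ U2 l e `|` V2 l e = Z l e) ->
    exists y z, [/\ gen Y y, gen Z z & comp i y z x].
  move=> cU' cV' hu1 hu2 hv1 hv2 cu' cv' hh.
  have [R [S [r [s [cR cS cRS [hr hs crs]]]]]] :=
    gen_interchange ki cU' cV' cUV hu1 hu2 hv1 hv2 cu' cv' cpq.
  have [_ _ eR] := (cell_compP _ _ _ _).1 cR.
  have [_ _ eS] := (cell_compP _ _ _ _).1 cS.
  exists r, s; split=> //.
    suff -> : Y = R by [].
    apply: (ocomp_fst_eq cYZ cRS) => l e il.
    by rewrite eR fcomp_gt ?(ltn_trans ki il) // (hh l e il).1.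
  suff -> : Z = S by [].
  apply: (ocomp_snd_eq cYZ cRS) => l e il.
  by rewrite eS fcomp_gt ?(ltn_trans ki il) // (hh l e il).2.
have X1E l e : i < l -> X1 l e = B1 l e `|` B2 l e.
  by move=> il; rewrite e1 fcomp_gt // (ltn_trans ki il).
have X2E l e : i < l -> X2 l e = C1 l e `|` C2 l e.
  by move=> il; rewrite e2 fcomp_gt // (ltn_trans ki il).
have idb0 e (A : T) l e' : i < l -> (oidbd e i A : T) l e' = fset0.
  by move=> il; rewrite cell_idbd // ltnNge (ltnW il) /= gtn_eqF.
case: alt => alt.
- have tB2 : triv i B2 by move=> l e /alt-/(_ e)[].
  have tC1 : triv i C1 by move=> l e /alt-/(_ e)[].
  have [eU ep] := gen_unitr li cU cp hc1 tC1; subst U p.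
  have [eV eq] := gen_unitl li cV cq hb2 tB2; subst V q.
  apply: (fin (oidbd false i B1) B1 C2 (oidbd true i C2)
    (idbd false i b1) b1 c2 (idbd true i c2)) => //.
  + exact: (ostrict_idl hC).
  + exact: (ostrict_idr hC).
  + exact: gen_idbd.
  + exact: gen_idbd.
  + exact: (comp_idl hE).
  + exact: (comp_idr hE).
  + move=> l e il; have [-> ->] := same' l e il.
    by rewrite !idb0 // X1E // X2E // tB2 // tC1 // !fset0U !fsetU0.
- have tB1 : triv i B1 by move=> l e /alt-/(_ e)[].
  have tC2 : triv i C2 by move=> l e /alt-/(_ e)[].
  have [eU ep] := gen_unitl li cU cp hb1 tB1; subst U p.
  have [eV eq] := gen_unitr li cV cq hc2 tC2; subst V q.
  apply: (fin C1 (oidbd true i C1) (oidbd false i B2) B2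
    c1 (idbd true i c1) (idbd false i b2) b2) => //.
  + exact: (ostrict_idr hC).
  + exact: (ostrict_idl hC).
  + exact: gen_idbd.
  + exact: gen_idbd.
  + exact: (comp_idr hE).
  + exact: (comp_idl hE).
  + move=> l e il; have [-> ->] := same' l e il.
    by rewrite !idb0 // X1E // X2E // tB1 // tC2 // !fset0U !fsetU0.
Qed.

Lemma cell_topless X : X n.+1 true = fset0 -> X = oide (obd true X).
Proof.
move=> X0; have [_ tX oX] := cell_fcell X.
apply: cell_eq => l e'; have -> : (oide (obd true X) : T) l e' =
    (obd true X : cell P n) l e' by [].
rewrite cell_bd; case: ltngtP => // [nl|->].
  move: nl; rewrite leq_eqVlt => /orP[/eqP <-|]; last exact: oX.
  by case: e'; rewrite // tX.
have tnX : triv n X by apply: (trivP hP); rewrite tX.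
by case: e' => //; rewrite (triv_top (leqnSn n) tnX).
Qed.

(** The induction on the derivation serves to remove trivial factors, where the cell does not get
    smaller; all other composites rely on the outer hypothesis [lifts_below]. *)
Lemma lifts_step X x : lifts_below X -> gen X x -> lifts X x.
Proof.
move=> IH hx; elim: hx IH => {X x} [u|X0|j X1 X2 X x1 x2 x c c' h1 IH1 h2 IH2] IH
  i Y Z cYZ.
- have hx := gen_atom u; apply: (lifts_triv hx cYZ).
  exact: atom_indec cYZ.
- have [tY|nY] := triv_dec hP i Y.
    by apply: (lifts_triv (gen_id X0) cYZ); left.
  have [li fYZ e] := (cell_compP _ _ _ _).1 cYZ.
  have tops : Y n.+1 true = fset0 /\ Z n.+1 true = fset0.
    have : fcomp i Y Z n.+1 true = fset0.
      by rewrite -e; exact: (@pface_out _ _ (X0 : cell P n) n.+1 true (leqnn _)).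
    by rewrite fcomp_gt // => /eqP; rewrite fsetU_eq0 => /andP[/eqP-> /eqP->].
  have eY := cell_topless tops.1; have eZ := cell_topless tops.2.
  move: li; rewrite ltnS leq_eqVlt => /orP[/eqP ni|li].
    subst i; case/eqP: nY; have [_ tY _] := cell_fcell Y; rewrite tY.
    exact: tops.1.
  have := ostrict_bd_comp hC cYZ; rewrite (ltn_eqF li) => /(_ true).
  rewrite (ostrict_bd_ide hC) => b.
  exists (ide (f (obd true Y))), (ide (f (obd true Z))); split.
  + by rewrite {1}eY; exact: gen_id.
  + by rewrite {1}eZ; exact: gen_id.
  + exact: (comp_ide hE (f_comp b)).
have hx := gen_comp c c' h1 h2.
have [tY|nY] := triv_dec hP i Y; first by apply: (lifts_triv hx cYZ); left.
have [tZ|nZ] := triv_dec hP i Z; first by apply: (lifts_triv hx cYZ); right.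
have lj := ocomp_le c.
have [t1|n1] := triv_dec hP j X1.
  have [e1 e2] := gen_unitl lj c c' h1 t1; subst X2 x2.
  exact: IH2.
have [t2|n2] := triv_dec hP j X2.
  have [e1 e2] := gen_unitr lj c c' h2 t2; subst X1 x1.
  exact: IH1.
have [s1 s2] := comp_smaller hP c n1 n2.
have L1 := IH _ _ s1 h1; have L2 := IH _ _ s2 h2.
have [ij|ji|ij] := ltngtP i j.
- exact: lift_lt ij c c' L1 L2 cYZ.
- exact: lift_gt ji c c' L1 L2 cYZ.
- subst j; have [//|alt] := lift_eq IH c c' h1 h2 n1 n2 cYZ.
  exact: lift_swap IH c c' h1 h2 n1 n2 cYZ alt.
Qed.

Lemma gen_lifts X x : gen X x -> lifts X x.
Proof.
move: X x; apply: (lex_ind (N := n.+2) (m := @mes P n)) => X IH x.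
by apply: lifts_step => Y y sY; exact: IH.
Qed.

Lemma carried0 X m (u : P m) : carried n.+1 0 X u ->
  (exists v, X = atomc hP v) \/ X n.+1 true = fset0.
Proof.
move=> [_ mn hX]; move: (mn); rewrite leq_eqVlt => /orP[/eqP h|h]; last first.
  by right; rewrite hX // atom_gt.
by left; subst m; exists u; apply: cell_eq => l e; rewrite hX.
Qed.

Lemma cell_case X : (exists v, X = atomc hP v) \/ X n.+1 true = fset0 \/
  exists i A B, [/\ ocomp i A B X, smaller A X & smaller B X].
Proof.
have [h|[[i [_ ln sp]]|[m [u cu]]]] := classify hP (cell_fcell X) (leq0n n.+2).
- by right; left; exact: h.
- right; right; have [A [B [c nA nB]]] := splits_cells ln sp.
  by exists i, A, B; have [] := comp_smaller hP c nA nB.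
- by case: (carried0 cu) => h; [left|right; left].
Qed.

(** One decomposition of [X] into smaller cells is fixed, and both values over [X] decompose along
    it. *)
Lemma gen_functional X x x' : gen X x -> gen X x' -> x = x'.
Proof.
move: X x x'; apply: (lex_ind (N := n.+2) (m := @mes P n)) => X IH x x' h h'.
have [[v e]|[X0|[i [A [B [c sA sB]]]]]] := cell_case X.
- by rewrite (gen_atom_eq h e) (gen_atom_eq h' e).
- by have [_ ->] := gen_id_inv h X0; have [_ ->] := gen_id_inv h' X0.
have [a [b [ha hb cab]]] := gen_lifts h c.
have [a' [b' [ha' hb' cab']]] := gen_lifts h' c.
have ea := IH A sA _ _ ha ha'; have eb := IH B sB _ _ hb hb'; subst a' b'.
exact: (comp_fun hE cab cab').
Qed.

Lemma gen_total X : exists x, gen X x.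
Proof.
move: X; apply: (lex_ind (N := n.+2) (m := @mes P n)) => X IH.
have [[v ->]|[X0|[i [A [B [c sA sB]]]]]] := cell_case X.
- by exists (g v); exact: gen_atom.
- by rewrite (cell_topless X0); exists (ide (f (obd true X))); exact: gen_id.
have [a ha] := IH A sA; have [b hb] := IH B sB.
by have [x _ hx] := gen_comp_ex c ha hb; exists x.
Qed.

End Graph.

(** * Truncations of Cell(P) as free extensions *)

Section Free.

Variables (P : hypergraph) (hP : torsion_free_complex P) (n : nat).
Let hC := Cell_strict hP.

Definition atom_ext : cellext (tncat hC n) (P n.+1) :=
  @CellExt n (tcat (Cell P) n) (P n.+1)
    (fun e u => @bd n (tcat (Cell P) n.+1) e (atomc hP u))
    (fun u => globular (proj2 (tcat_strict hC n.+1)) (atomc hP u)).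

Definition atom_layer : based_layer (tncat hC n) (P n.+1) :=
  @BasedLayer n (tcat (Cell P) n) (P n.+1) (projT2 (tcat (Cell P) n.+1))
    (@atomc P hP n.+1).

Lemma Cell_free : is_free atom_ext atom_layer.
Proof.
split; [exact: (tcat_strict hC n.+1)|by []|].
move=> E f g hg.
pose f' (x : ocell (Cell P) n) : cells (trunc E) := fapp f (oof x).
have f_comp i (x y z : ocell (Cell P) n) : ocomp i x y z ->
    comp i (f' x) (f' y) (f' z).
  move=> h; apply: Defs.FreeExistence.fapp_comp.
  by apply/(oval_comp hC); rewrite !oofK.
have f_idbd e i (x : ocell (Cell P) n) : f' (oidbd e i x) = idbd e i (f' x).
  rewrite /f' -Defs.FreeExistence.fapp_idbd; congr fapp.
  by apply: oval_inj; rewrite oval_idbd !oofK.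
have g_bd e u : bd e (g u) = f' (obd e (atomc hP u)).
  by rewrite hg; congr fapp.
pose h (X : ocell (Cell P) n.+1) : cells E := sval (cid (gen_total f_comp g_bd X)).
have hh X : gen hP f' g X (h X) := svalP (cid (gen_total f_comp g_bd X)).
have hE X x : gen hP f' g X x -> h X = x.
  by move=> hx; exact: (gen_functional f_comp f_idbd g_bd (hh X) hx).
have hpres : @preserves n (tcat (Cell P) n.+1) E (fapp f) h.
  split.
  - by move=> e X; rewrite (gen_bd f_comp g_bd e (hh X)).
  - move=> X; apply: hE; rewrite -[in ide (fapp f X)](ovalK X).
    exact: gen_id.
  - move=> i X Y Z c.
    have [z cz hz] := gen_comp_ex f_comp g_bd c (hh X) (hh Y).
    by rewrite (hE _ _ hz).
pose F : nfunctor (tcat (Cell P) n.+1) E := existT _ f (exist _ h hpres).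
exists F; split.
  by split=> // u; apply: hE; exact: gen_atom.
move=> [f0 [h0 hp0]] [/= ef hg0]; rewrite /ftrunc /= in ef; subst f0.
have [p1 p2 p3] := hp0.
have eh : h0 = h.
  apply: funext => X; apply/esym/hE.
  (* The graph of any competitor contains [gen], which is already total. *)
  suff H x : gen hP f' g X x -> h0 X = x by rewrite (H _ (hh X)); exact: hh.
  elim=> {X x} [u|X|i X Y Z x y z c c' _ e1 _ e2].
  - exact: hg0.
  - by rewrite -{1}(oofK X); exact: p2 (oof X).
  - have := p3 _ _ _ _ c; rewrite e1 e2 => c0.
    exact: (comp_fun (proj2 (nstrict E)) c0 c').
by subst h0; congr (existT _ f _); apply: eq_exist.
Qed.

End Free.

(** * Polygraphs of a strict omega-category with free truncations *)

Lemma existT_inj2 (A : Type) (T : A -> Type) (a : A) (b c : T a) :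
  existT T a b = existT T a c -> b = c.
Proof.
move=> h; have := projT2_eq h => /=.
by have -> : projT1_eq h = erefl by exact: Prop_irrelevance.
Qed.

Section Functors.

Lemma fapp_bd n (C D : precat n.+1) (F : nfunctor C D) e (x : cells C) :
  bd e (fapp F x) = fapp (ftrunc F) (bd e x).
Proof. by case: F => f [h [h1 h2 h3]]; exact: h1. Qed.

Lemma fapp_ide n (C D : precat n.+1) (F : nfunctor C D) x :
  fapp F (ide x) = ide (fapp (ftrunc F) x).
Proof. by case: F => f [h [h1 h2 h3]]; exact: h2. Qed.

Lemma fapp_ftrunc n (C D : precat n.+1) (F : nfunctor C D) x :
  strict C -> fapp (ftrunc F) x = bd true (fapp F (ide x)).
Proof. by move=> [_ hC]; rewrite fapp_bd (bd_ide hC). Qed.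

Lemma fapp_parallel n (C D : precat n) (F : nfunctor C D) (x y : cells C) :
  parallel x y -> parallel (fapp F x) (fapp F y).
Proof. by case: n C D F x y => // n C D F x y h e; rewrite !fapp_bd h. Qed.

(** A functor is recovered from its top level, since a lower cell is the boundary of its
    identity. *)
Lemma nfunctor_ext n (C D : precat n) (F G : nfunctor C D) : strict C ->
  (forall x, fapp F x = fapp G x) -> F = G.
Proof.
elim: n C D F G => [|n IH] C D F G hC h; first exact: funext.
have e : ftrunc F = ftrunc G.
  by apply: IH; [case: hC|move=> x; rewrite !fapp_ftrunc // h].
case: F G h e => f [k pf] [f' [k' pf']] h /= e.
rewrite /ftrunc /= in e; subst f'.
have ek : k = k' by exact: funext.
by subst k'; congr (existT _ f _); apply: eq_exist.
Qed.

Lemma nfunctor_id n (C : precat n) :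
  exists F : nfunctor C C, forall x, fapp F x = x.
Proof.
elim: n C => [|n IH] C; first by exists id.
have [F hF] := IH (trunc C).
have p : preserves (fapp F) (id : cells C -> cells C).
  by split=> [e x|x|]; rewrite ?hF.
by exists (existT _ F (exist _ id p)).
Qed.

Lemma nfunctor_comp n (C D E : precat n) (F : nfunctor C D)
    (G : nfunctor D E) :
  exists H : nfunctor C E, forall x, fapp H x = fapp G (fapp F x).
Proof.
elim: n C D E F G => [|n IH] C D E F G; first by exists (G \o F).
have [H hH] := IH _ _ _ (ftrunc F) (ftrunc G).
have p : preserves (fapp H) (fun x => fapp G (fapp F x)).
  split.
  - by move=> e x; rewrite !fapp_bd hH.
  - by move=> x; rewrite !fapp_ide hH.
  - by move=> i x y z c; do 2!apply: Defs.FreeExistence.fapp_comp.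
by exists (existT _ H (exist _ _ p)).
Qed.

Lemma free_uniq n (C : ncat n) S (d : cellext C S) (L : based_layer C S)
    (D : ncat n.+1) (F G : nfunctor (addlayer (blayer L)) D) :
  is_free d L -> (forall x, fapp (ftrunc F) x = fapp (ftrunc G) x) ->
  (forall s, fapp F (binc L s) = fapp G (binc L s)) -> F = G.
Proof.
move=> [hs hd hu] h1 h2.
have e : ftrunc F = ftrunc G by apply: nfunctor_ext h1; exact: nstrict.
have [|K [_ uK]] := hu D (ftrunc F) (fun s => fapp F (binc L s)).
  by move=> e' s; rewrite fapp_bd; congr fapp; exact: hd.
rewrite -(uK F); last by [].
by apply: uK; split; [rewrite -e|move=> s; rewrite -h2].
Qed.

(** The composite fixes the generators and all cells below, so freeness of [L] makes it the
    identity. *)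
Lemma free_inverse n (C C' : ncat n) S (d : cellext C S) (d' : cellext C' S)
    (L : based_layer C S) (L' : based_layer C' S)
    (F : nfunctor (addlayer (blayer L)) (addlayer (blayer L')))
    (G : nfunctor (addlayer (blayer L')) (addlayer (blayer L))) :
  is_free d L -> is_free d' L' ->
  (forall s, fapp F (binc L s) = binc L' s) ->
  (forall s, fapp G (binc L' s) = binc L s) ->
  cancel (fapp (ftrunc F)) (fapp (ftrunc G)) -> cancel (fapp F) (fapp G).
Proof.
move=> fL fL' hF hG FG.
have [H hH] := nfunctor_comp F G; have [I hI] := nfunctor_id (addlayer (blayer L)).
have [sL _ _] := fL; have [sL' _ _] := fL'.
suff e : H = I by move=> x; rewrite -hH e hI.
apply: (@free_uniq _ _ _ _ _ (NCat sL) H I fL) => [x|s].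
  rewrite !fapp_ftrunc // hH hI !fapp_ide.
  by rewrite (bd_ide (proj2 sL)) FG (bd_ide (proj2 sL)).
by rewrite hH hI hF hG.
Qed.

End Functors.

Section Polygraph.

Variables (D : odata) (hD : ostrict D) (G : nat -> Type).
Variable gam : forall n, G n -> ocell D n.

Definition gen_ext n : cellext (tncat hD n) (G n.+1) :=
  @CellExt n (tcat D n) (G n.+1)
    (fun e u => @bd n (tcat D n.+1) e (gam u))
    (fun u => globular (proj2 (tcat_strict hD n.+1)) (gam u : cells (tcat D n.+1))).

Definition gen_layer n : based_layer (tncat hD n) (G n.+1) :=
  @BasedLayer n (tcat D n) (G n.+1) (projT2 (tcat D n.+1)) (@gam n.+1).

Hypothesis gam0 : bijective (@gam 0).
Hypothesis gam_free : forall n, is_free (gen_ext n) (gen_layer n).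

(** The polygraph is built together with an isomorphism onto the truncation of [D], because the
    inverse supplies the attaching maps of the next generators. *)
Record stage n := Stage {
  sQ : polygraph G n;
  sF : nfunctor (pstar sQ) (tcat D n);
  sinv : exists K : nfunctor (tcat D n) (pstar sQ),
    cancel (fapp sF) (fapp K) /\ cancel (fapp K) (fapp sF);
  sgen : forall u : G n, oval (fapp sF (pgen sQ u)) = gam u
}.

(** Transparent, because the base case of [stages_uniq] compares its components by computation. *)
Lemma stage0 : stage 0.
Proof.
apply: (@Stage 0 (tt : polygraph G 0) (@gam 0)) => //.
by case: gam0 => k kK Kk; exists k.
Defined.

Lemma stage_ext n (s : stage n) : exists d : cellext (pstar (sQ s)) (G n.+1),
  forall e u, fapp (sF s) (d e u) = gen_ext n e u.
Proof.
have [K [FK KF]] := sinv s.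
exists (@CellExt _ _ _ (fun e u => fapp K (gen_ext n e u))
  (fun u => fapp_parallel K (ebd_parallel (gen_ext n) u))).
by move=> e u; rewrite /= KF.
Qed.

Lemma stage_functor n (s : stage n) (d : cellext (pstar (sQ s)) (G n.+1)) :
  (forall e u, fapp (sF s) (d e u) = gen_ext n e u) ->
  exists F : nfunctor (pstar (existT _ (sQ s) d : polygraph G n.+1)) (tcat D n.+1),
    [/\ ftrunc F = sF s,
        forall u, fapp F (binc (free_layer d) u) = gam u
      & exists K : nfunctor (tcat D n.+1) (free_ext d),
          cancel (fapp F) (fapp K) /\ cancel (fapp K) (fapp F)].
Proof.
move=> hd; have fL := free_layerP d; have [sL dL uL] := fL.
have fL' := gam_free n; have [sL' dL' uL'] := fL'.
have [K0 [FK KF]] := sinv s.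
have [|F [[tF gF] _]] := uL (tncat hD n.+1) (sF s) (fun u => gam u).
  by move=> e u; rewrite hd.
have [|K [[tK gK] _]] := uL' (free_ext d) K0 (fun u => binc (free_layer d) u).
  by move=> e u; rewrite -hd FK; exact: dL.
exists F; split=> //; exists K; split.
- apply: (free_inverse fL fL' gF gK) => x.
  by have := FK x; rewrite -tF -tK.
- apply: (free_inverse fL' fL gK gF) => x.
  by have := KF x; rewrite -tF -tK.
Qed.

Definition next_ext n (s : stage n) : cellext (pstar (sQ s)) (G n.+1) :=
  sval (cid (stage_ext s)).

Definition next_functor n (s : stage n) :
    nfunctor (pstar (existT _ (sQ s) (next_ext s) : polygraph G n.+1)) (tcat D n.+1) :=
  sval (cid (stage_functor (svalP (cid (stage_ext s))))).

Lemma next_functorP n (s : stage n) :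
  [/\ ftrunc (next_functor s) = sF s,
      forall u, fapp (next_functor s) (binc (free_layer (next_ext s)) u) = gam u
    & exists K : nfunctor (tcat D n.+1) (free_ext (next_ext s)),
        cancel (fapp (next_functor s)) (fapp K) /\
        cancel (fapp K) (fapp (next_functor s))].
Proof. exact: svalP (cid (stage_functor (svalP (cid (stage_ext s))))). Qed.

Definition next n (s : stage n) : stage n.+1 :=
  @Stage n.+1 (existT _ (sQ s) (next_ext s)) (next_functor s)
    (let: And3 _ _ h := next_functorP s in h)
    (let: And3 _ h _ := next_functorP s in h).

Fixpoint stages n : stage n :=
  match n with 0 => stage0 | m.+1 => next (stages m) end.

Definition opoly : opolygraph G :=
  @OPolygraph G (fun k => sQ (stages k)) (fun k => erefl).

Definition ofun_of n (x : ocell (ostar opoly) n) : ocell D n :=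
  oval (fapp (sF (stages n)) x).

Lemma ofun_of_bd n e (x : ocell (ostar opoly) n.+1) :
  ofun_of (obd e x) = obd e (ofun_of x).
Proof.
rewrite -[RHS](oval_bd e (fapp (sF (stages n.+1)) x)) fapp_bd.
by have [-> _ _] := next_functorP (stages n).
Qed.

Lemma ofun_of_ide n (x : ocell (ostar opoly) n) :
  ofun_of (oide x) = oide (ofun_of x).
Proof.
have := fapp_ide (sF (stages n.+1)) (x : cells (trunc (pstar (sQ (stages n.+1))))).
have [-> _ _] := next_functorP (stages n).
by move=> h; rewrite /ofun_of; have := congr1 (@oval D n.+1) h.
Qed.

Lemma ofun_of_comp n i (x y z : ocell (ostar opoly) n) :
  ocomp i x y z -> ocomp i (ofun_of x) (ofun_of y) (ofun_of z).
Proof.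
move=> c; apply/(oval_comp hD).
exact: Defs.FreeExistence.fapp_comp.
Qed.

Definition ofunc : ofunctor (ostar opoly) D :=
  @OFunctor (ostar opoly) D (@ofun_of) ofun_of_bd ofun_of_ide ofun_of_comp.

Lemma ofunc_gen n (u : G n) : ofunc n (ogen opoly u) = gam u.
Proof. exact: (sgen (stages n)). Qed.

Lemma ofunc_iso : isomorphism ofunc.
Proof.
pose K n := sval (cid (sinv (stages n))).
have hK n : cancel (fapp (sF (stages n))) (fapp (K n)) /\
    cancel (fapp (K n)) (fapp (sF (stages n))) := svalP (cid (sinv (stages n))).
pose k n (y : ocell D n) : ocell (ostar opoly) n := fapp (K n) (oof y).
have kK n (y : ocell D n) : ofunc n (k n y) = y.
  by rewrite /= /ofun_of (hK n).2 oofK.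
have Kk n (x : ocell (ostar opoly) n) : k n (ofunc n x) = x.
  by rewrite /k /= /ofun_of ovalK (hK n).1.
have inj n : injective (ofunc n) := can_inj (Kk n).
have kbd n e (y : ocell D n.+1) : k n (obd e y) = obd e (k n.+1 y).
  by apply: inj; rewrite kK ofun_bd kK.
have kide n (y : ocell D n) : k n.+1 (oide y) = oide (k n y).
  by apply: inj; rewrite kK ofun_ide kK.
have kcomp n i (x y z : ocell D n) : ocomp i x y z ->
    ocomp i (k n x) (k n y) (k n z).
  move=> c; apply: Defs.FreeExistence.fapp_comp.
  by apply/(oval_comp hD); rewrite !oofK.
by exists (@OFunctor D (ostar opoly) k kbd kide kcomp).
Qed.

Lemma nfunctor_cast n (A B : precat n) (e : A = B) (C : precat n)
    (H : nfunctor B C) :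
  exists H' : nfunctor A C, forall y, fapp H' y = fapp H (ecast C (cells C) e y).
Proof. by case: _ / e H => H; exists H. Qed.

Lemma cells_castK n (A B : precat n) (e : A = B) (y : cells A) :
  ecast C (cells C) (esym e) (ecast C (cells C) e y) = y.
Proof. by case: _ / e. Qed.

(** Passes from functors given dimension by dimension to nested ones, to which freeness applies. The
    cast is there because truncations of an [ocat] agree only propositionally. *)
Lemma ofunctor_trunc (C : ocat) (F : ofunctor C D) n :
  exists H : nfunctor (otrunc C n) (tcat D n),
    forall x : ocell C n, oval (fapp H x) = F n x.
Proof.
elim: n => [|n [H hH]]; first by exists (F 0).
have [H' hH'] := nfunctor_cast (otruncE C n) H.
pose h : cells (otrunc C n.+1) -> cells (tcat D n.+1) := F n.+1.
have p : @preserves n (otrunc C n.+1) (tcat D n.+1) (fapp H') h.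
  split.
  - move=> e x; apply: oval_inj; rewrite oval_bd hH' hH.
    exact/esym/(ofun_bd F e x).
  - move=> x; have := ofun_ide F (ecast B (cells B) (otruncE C n) x : ocell C n).
    rewrite {1}/oide /= cells_castK => e; apply: (@oval_inj D n.+1).
    by rewrite oval_ide hH' hH; exact: e.
  - by move=> i x y z c; exact: (ofun_comp F (c : @ocomp C n.+1 i x y z)).
by exists (existT _ H' (exist _ h p)).
Qed.

(** [sF s] is injective and sends the boundary of a generator [u] to that of [gam u], which forces
    the attaching maps; freeness then forces the functor. *)
Lemma stage_uniq n (s : stage n) (R : polygraph G n.+1)
    (H : nfunctor (pstar R) (tcat D n.+1)) :
  existT (fun Q => nfunctor (pstar Q) (tcat D n)) (ptrunc R) (ftrunc H) =
    existT _ (sQ s) (sF s) ->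
  (forall u, fapp H (pgen R u) = gam u) ->
  existT (fun Q => nfunctor (pstar Q) (tcat D n.+1)) R H =
    existT _ (sQ (next s)) (sF (next s)).
Proof.
case: R H => R d H e hH; have e1 : R = sQ s := projT1_eq e; subst R.
have e2 : ftrunc H = sF s := existT_inj2 e.
have [t1 t2 _] := next_functorP s.
have fL := free_layerP d; have [sL dL _] := fL.
have fL2 := free_layerP (next_ext s); have [sL2 dL2 _] := fL2.
have [K [FK _]] := sinv s.
have ed : d = next_ext s.
  have eb : d = next_ext s :> (bool -> G n.+1 -> cells (pstar (sQ s))).
    apply: funext => b; apply: funext => u; apply: (can_inj FK).
    have q1 : fapp (sF s) (d b u) = bd b (fapp H (binc (free_layer d) u)).
      by rewrite fapp_bd e2; congr fapp; exact/esym/dL.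
    have q2 : fapp (sF s) (next_ext s b u) =
        bd b (fapp (next_functor s) (binc (free_layer (next_ext s)) u)).
      by rewrite fapp_bd t1; congr fapp; exact/esym/dL2.
    by rewrite q1 q2 t2; exact: (congr1 (@bd n (tcat D n.+1) b) (hH u)).
  case: d {H e hH e2 fL sL dL} (next_ext s) eb {t1 t2 fL2 sL2 dL2} => b1 p1 [b2 p2] /= eb.
  by subst b2; congr CellExt; exact: Prop_irrelevance.
change (existT (fun Q => nfunctor (pstar Q) (tcat D n.+1))
  (existT _ (sQ s) d : polygraph G n.+1) H =
  existT _ (existT _ (sQ s) (next_ext s) : polygraph G n.+1) (next_functor s)).
move: (next_functor s) t1 t2; case: (next_ext s) / ed => N t1 t2.
suff -> : H = N by [].
apply: (@free_uniq _ _ _ _ _ (tncat hD n.+1) H N fL) => [x|u].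
  by move: e2 t1 => /= -> ->.
by rewrite t2; exact: hH.
Qed.

Lemma stages_uniq (Q : opolygraph G) (F : ofunctor (ostar Q) D) :
  (forall n (u : G n), F n (ogen Q u) = gam u) ->
  forall n (H : nfunctor (pstar (opol Q n)) (tcat D n)),
    (forall x : ocell (ostar Q) n, oval (fapp H x) = F n x) ->
    existT (fun R => nfunctor (pstar R) (tcat D n)) (opol Q n) H =
    existT _ (sQ (stages n)) (sF (stages n)).
Proof.
move=> hF; elim=> [|n IH] H hH.
  have eH : H = @gam 0 by apply: funext => u; rewrite -(hF 0 u) -hH.
  rewrite eH; case: (opol Q 0) {H hH eH}.
  by [].
have [H0 hH0] : exists H0 : nfunctor (pstar (opol Q n)) (tcat D n),
    forall x : ocell (ostar Q) n, oval (fapp H0 x) = F n x := ofunctor_trunc F n.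
apply: stage_uniq; last by move=> u; rewrite -(hF n.+1 u) -hH.
rewrite -(IH H0 hH0).
have h x : fapp (ftrunc H) x = fapp H0 (ecast B (cells B) (otruncE (ostar Q) n) x).
  apply: oval_inj; rewrite hH0.
  have sR : strict (pstar (opol Q n.+1)) := nstrict (pstar (opol Q n.+1)).
  rewrite fapp_ftrunc // oval_bd.
  have -> : oval (fapp H (ide x)) = F n.+1 (ide x : ocell (ostar Q) n.+1) := hH (ide x).
  rewrite -ofun_bd; congr (F n _).
  by rewrite /obd /= (bd_ide (proj2 sR)).
move: (ftrunc H) h; rewrite /=; case: _ / (opolE Q n) H0 {hH0} => H0 H1 h.
by congr existT; apply: nfunctor_ext h; exact: nstrict.
Qed.

Lemma ofunctor_eq (Q Q' : opolygraph G) (F : ofunctor (ostar Q) D)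
    (F' : ofunctor (ostar Q') D) :
  (forall n, existT (fun R => cells (pstar R) -> ocell D n) (opol Q n) (F n) =
             existT _ (opol Q' n) (F' n)) ->
  existT (fun R => ofunctor (ostar R) D) Q F = existT _ Q' F'.
Proof.
case: Q F => o e F; case: Q' F' => o' e' F' h.
have eo : o = o'.
  by apply: functional_extensionality_dep => n; exact: projT1_eq (h n).
subst o'; have ee : e = e' by exact: Prop_irrelevance.
subst e'; congr existT.
have ef n : F n = F' n := existT_inj2 (h n).
case: F F' ef {h} => f f1 f2 f3 [f' f1' f2' f3'] /= ef.
have eff : f = f' by apply: functional_extensionality_dep.
by subst f'; congr OFunctor; exact: Prop_irrelevance.
Qed.

Lemma ofunc_uniq (Q : opolygraph G) (F : ofunctor (ostar Q) D) :
  (forall n (u : G n), F n (ogen Q u) = gam u) ->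
  existT (fun R => ofunctor (ostar R) D) Q F = existT _ opoly ofunc.
Proof.
move=> hF; apply: ofunctor_eq => n.
have [H hH] := ofunctor_trunc F n.
have e := stages_uniq hF hH.
have -> : F n = (fun x => oval (fapp H x)) by apply: funext => x; rewrite hH.
exact: (congr1 (fun p : {R : polygraph G n & nfunctor (pstar R) (tcat D n)} =>
  existT (fun R => cells (pstar R) -> ocell D n) (projT1 p)
    (fun x => oval (fapp (projT2 p) x))) e).
Qed.

End Polygraph.

(** Fork-freeness in dimension 0 means having exactly one element, so every 0-cell is the atom of a
    point. *)
Lemma atomc_bij (P : hypergraph) (hP : torsion_free_complex P) :
  bijective (@atomc P hP 0).
Proof.
have sur (X : ocell (Cell P) 0) : exists x : P 0, atomc hP x = X.
  have [sX tX oX] := cell_fcell X.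
  have /eqP/cardfs1P[x hx] : #|` X 0 true| = 1 := sph_ff true (leqnn 1) sX.
  exists x; apply: cell_eq => -[|j] e; last by rewrite oX //; exact: (atom_gt x e).
  have -> : (atomc hP x : cell P 0) 0 e = [fset x] := atom_self x e.
  by case: e; rewrite ?tX hx.
exists (fun X => sval (cid (sur X))) => [x|X]; last exact: svalP (cid (sur X)).
have := svalP (cid (sur (atomc hP x))); move: (sval _) => y e.
have : atom y 0 true = atom x 0 true.
  exact: (congr1 (fun X : cell P 0 => X 0 true) e).
by rewrite !atom_self; exact: fset1_inj.
Qed.

Theorem mainTheorem4 (P : hypergraph) (hP : torsion_free_complex P) :
  exists (Q : opolygraph (fun n : nat => P n : Type))
         (F : ofunctor (ostar Q) (Cell P)),
    [/\ forall (n : nat) (g : P n), F n (ogen Q g) = atom g :> precell P n,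
        forall (Q' : opolygraph (fun n : nat => P n : Type))
               (F' : ofunctor (ostar Q') (Cell P)),
          (forall (n : nat) (g : P n),
             F' n (ogen Q' g) = atom g :> precell P n) ->
          existT (fun R => ofunctor (ostar R) (Cell P)) Q' F' =
          existT (fun R => ofunctor (ostar R) (Cell P)) Q F
      & isomorphism F].
Proof.
pose gam n (u : P n) : ocell (Cell P) n := atomc hP u.
have gam_free n : is_free (gen_ext (Cell_strict hP) gam n)
    (gen_layer (Cell_strict hP) gam n) := Cell_free hP n.
pose F := ofunc (atomc_bij hP) gam_free.
exists (opoly (atomc_bij hP) gam_free), F; split.
- by move=> n u; rewrite ofunc_gen.
- move=> Q' F' h; apply: ofunc_uniq => n u; apply: cell_eq => j e.
  by rewrite h.
- exact: ofunc_iso.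
Qed.
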